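(* Let $U\subseteq\mathbf{R}^d$ be open, let $\tau>0$, $\sigma>1$, and let $u\in\mathcal{D}'(U)$. Let $P(D)=\sum_{|\alpha|\le m}a_\alpha D^\alpha$ be a partial differential operator of order $m$ with constant coefficients. Then $$\mathrm{WF}_{\{2^{\sigma-1}\tau,\sigma\}}(P(D)u)\subseteq \mathrm{WF}_{\{2^{\sigma-1}\tau,\sigma\}}(u)\subseteq \mathrm{WF}_{\{\tau,\sigma\}}(P(D)u)\cup\bigl(U\times\mathrm{Char}(P(D))\bigr).$$
   Context: $\mathcal{D}'(U)$ denotes the Schwartz distributions on $U$, $\mathcal{E}'(U)$ the compactly supported ones, $\mathbf{N}=\{0,1,2,\dots\}$, and $\lfloor\cdot\rfloor$ is the floor function. The Fourier transform is $\widehat f(\xi)=\int_{\mathbf{R}^d}f(x)e^{-2\pi i x\xi}\,dx$, extended to distributions by duality. A conic neighborhood of $\xi_0\in\mathbf{R}^d\setminus\{0\}$ is an open cone $\Gamma\subset\mathbf{R}^d$ with $\xi_0\in\Gamma$. Wave front set: let $\tau>0$, $\sigma>1$, $u\in\mathcal{D}'(U)$, $(x_0,\xi_0)\in U\times(\mathbf{R}^d\setminus\{0\})$. Then $(x_0,\xi_0)\notin \mathrm{WF}_{\{\tau,\sigma\}}(u)$ if there exist an open neighborhood $\Omega\subset U$ of $x_0$, a conic neighborhood $\Gamma$ of $\xi_0$, and a bounded sequence $\{u_N\}_{N\in\mathbf{N}}$ in $\mathcal{E}'(U)$ such that $u_N=u$ on $\Omega$ for every $N$ and, for some constants $A,h>0$,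 $$|\widehat u_N(\xi)|\le A\,\frac{h^N N!^{\tau/\sigma}}{|\xi|^{\lfloor N^{1/\sigma}\rfloor}},\qquad N\in\mathbf{N},\ \xi\in\Gamma\setminus\{0\}.$$ For $P(D)=\sum_{|\alpha|\le m}a_\alpha D^\alpha$ with constant coefficients, the principal symbol is $P_m(\xi)=\sum_{|\alpha|=m}a_\alpha\xi^\alpha$, and the characteristic set is $\mathrm{Char}(P(D))=\{\xi\in\mathbf{R}^d\setminus\{0\}: P_m(\xi)=0\}$. Here $D^\alpha$ is $\partial^\alpha$ up to the usual normalizing factor $c^{|\alpha|}$ ($c\ne0$ constant, e.g. $c=-i$), whose choice is immaterial. *)

(* Defs.v *)
From HB Require Import structures.
From mathcomp Require Import all_boot all_order all_algebra.
From mathcomp Require Import all_classical all_reals all_analysis.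
From mathcomp Require Export complex.

Set Implicit Arguments.
Unset Strict Implicit.
Unset Printing Implicit Defensive.

Import Order.TTheory GRing.Theory Num.Theory.
Import numFieldNormedType.Exports.
Import ComplexField.Normc.

Local Open Scope classical_set_scope.
Local Open Scope ring_scope.
Local Open Scope complex_scope.

Section Euclidean.
Variables (R : realType) (d : nat).
Implicit Types x xi : 'rV[R]_d.

Definition dot x xi : R := \sum_(j < d) x ord0 j * xi ord0 j.

(* The library norm on 'rV[R]_d is the sup norm. *)
Definition enorm x : R := Num.sqrt (dot x x).

Definition cone (G : set 'rV[R]_d) : Prop :=
  forall (t : R) xi, 0 < t -> G xi -> G (t *: xi).

End Euclidean.

Section SmoothFunctions.
Variables (R : realType) (d : nat).
Implicit Types (U K : set 'rV[R]_d) (j : 'I_d) (s : seq 'I_d).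
Implicit Types (f : 'rV[R]_d -> R) (phi psi : 'rV[R]_d -> R[i]).

Definition unit_vec j : 'rV[R]_d := delta_mx ord0 j.

Definition partial j f : 'rV[R]_d -> R := fun x => 'D_(unit_vec j) f x.

Definition iter_partial s f : 'rV[R]_d -> R := foldr partial f s.

(* C^oo(U): all iterated partial derivatives, in any order, exist and are
   continuous at every point of U. For an open set U this does not depend on
   the values of f outside U. *)
Definition real_smooth U f : Prop :=
  forall s x, U x ->
    {for x, continuous (iter_partial s f)} /\
    forall j, derivable (iter_partial s f) x (unit_vec j).

Definition smooth U phi : Prop :=
  real_smooth U (fun x => complex.Re (phi x)) /\
  real_smooth U (fun x => complex.Im (phi x)).

Definition real_dpartial (alpha : 'I_d -> nat) f : 'rV[R]_d -> R :=
  foldr (fun j g => iter (alpha j) (partial j) g) f (enum 'I_d).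

Definition dpartial (alpha : 'I_d -> nat) phi : 'rV[R]_d -> R[i] :=
  fun x => real_dpartial alpha (fun y => complex.Re (phi y)) x
        +i* real_dpartial alpha (fun y => complex.Im (phi y)) x.

Definition fsupport phi : set 'rV[R]_d := closure [set x | phi x != 0].

(* The test functions on U, extended by 0 to R^d. *)
Definition test U phi : Prop :=
  [/\ smooth setT phi, compact (fsupport phi) & fsupport phi `<=` U].

(* The multi-indices alpha with |alpha| <= m are the alpha : multi_index m with
   mdeg alpha <= m; multi_index m itself only bounds each component by m. *)
Definition multi_index (m : nat) := {ffun 'I_d -> 'I_m.+1}.

Definition mdeg (m : nat) (alpha : multi_index m) : nat :=
  (\sum_(j < d) alpha j)%N.

Definition mnat (m : nat) (alpha : multi_index m) : 'I_d -> nat :=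
  fun j => alpha j.

Definition Cnorm K (k : nat) phi : R :=
  \sum_(alpha : multi_index k | (mdeg alpha <= k)%N)
    sup [set normc (dpartial (mnat alpha) phi x) | x in K].

(* Bounded subsets of the Frechet space C^oo(U). *)
Definition bounded_smooth U (B : set ('rV[R]_d -> R[i])) : Prop :=
  B `<=` smooth U /\
  forall K (alpha : 'I_d -> nat), compact K -> K `<=` U ->
    exists M : R, forall phi x, B phi -> K x -> normc (dpartial alpha phi x) <= M.

End SmoothFunctions.

Section Distributions.
Variables (R : realType) (d : nat).
Notation functional := (('rV[R]_d -> R[i]) -> R[i]).
Implicit Types (U K Omega : set 'rV[R]_d) (phi psi chi : 'rV[R]_d -> R[i]).
Implicit Types (u v : functional).

(* D'(U): only the values of u on test functions on U are meaningful. *)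
Definition is_distribution U u : Prop :=
  (forall (a : R[i]) phi psi, test U phi -> test U psi ->
     u (fun x => a * phi x + psi x) = a * u phi + u psi) /\
  (forall K, compact K -> K `<=` U ->
     exists (C : R) (k : nat), forall phi, test U phi -> fsupport phi `<=` K ->
       normc (u phi) <= C * Cnorm K k phi).

Definition eq_distribution Omega u v : Prop :=
  forall phi, test Omega phi -> u phi = v phi.

(* supp v is contained in K *)
Definition supported_in U K v : Prop :=
  forall phi, test U phi -> fsupport phi `&` K = set0 -> v phi = 0.

(* E'(U) *)
Definition compact_distribution U v : Prop :=
  is_distribution U v /\
  exists K, [/\ compact K, K `<=` U & supported_in U K v].

(* The pairing <v, phi> of v in E'(U) with phi in C^oo(U): v (chi phi) for any
   test function chi equal to 1 near a compact set containing supp v. The value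
   does not depend on chi. *)
Definition pairing U v phi : R[i] :=
  xget 0 [set z | exists K chi,
    [/\ compact K, K `<=` U, supported_in U K v, test U chi &
        (exists2 W, open W & K `<=` W /\ forall x, W x -> chi x = 1) /\
        z = v (fun x => chi x * phi x)]].

(* Boundedness for the strong topology of E'(U), the dual of C^oo(U): uniformly
   bounded on every bounded subset of C^oo(U). *)
Definition bounded_compact_distributions U (u_ : nat -> functional) : Prop :=
  forall B, bounded_smooth U B ->
    exists M : R, forall N phi, B phi -> normc (pairing U (u_ N) phi) <= M.

(* x |-> exp (- 2 pi i x . xi) *)
Definition character (xi : 'rV[R]_d) : 'rV[R]_d -> R[i] :=
  fun x => cos (2 * pi * dot x xi) -i* sin (2 * pi * dot x xi).

(* The Fourier transform of v in E'(U) is the smooth function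
   xi |-> <v, exp (- 2 pi i x . xi)>. *)
Definition fourier U v (xi : 'rV[R]_d) : R[i] := pairing U v (character xi).

(* d^alpha u *)
Definition dderiv (m : nat) (alpha : multi_index d m) u : functional :=
  fun phi => (-1) ^+ mdeg alpha * u (dpartial (mnat alpha) phi).

(* P(D) u = \sum_(|alpha| <= m) a_alpha D^alpha u, where D^alpha is
   c^|alpha| d^alpha. *)
Definition pdo (c : R[i]) (m : nat) (a : multi_index d m -> R[i]) u : functional :=
  fun phi => \sum_(alpha : multi_index d m | (mdeg alpha <= m)%N)
    a alpha * (c ^+ mdeg alpha * dderiv alpha u phi).

Definition principal_symbol (m : nat) (a : multi_index d m -> R[i])
    (xi : 'rV[R]_d) : R[i] :=
  \sum_(alpha : multi_index d m | mdeg alpha == m)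
    a alpha * \prod_(j < d) (xi ord0 j)%:C ^+ alpha j.

Definition Char (m : nat) (a : multi_index d m -> R[i]) : set 'rV[R]_d :=
  [set xi | xi != 0 /\ principal_symbol a xi = 0].

Definition WF_regular (tau sigma : R) U u (x0 xi0 : 'rV[R]_d) : Prop :=
  exists (Omega Gamma : set 'rV[R]_d) (u_ : nat -> functional),
    [/\ [/\ open Omega, Omega `<=` U & Omega x0],
        [/\ open Gamma, cone Gamma & Gamma xi0],
        (forall N, compact_distribution U (u_ N)) /\
          bounded_compact_distributions U u_,
        forall N, eq_distribution Omega (u_ N) u &
        exists A h : R, [/\ 0 < A, 0 < h &
          forall N xi, Gamma xi -> xi != 0 ->
            normc (fourier U (u_ N) xi) <=
              A * (h ^+ N * (N`!%:R `^ (tau / sigma))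
                   / enorm xi ^+ Num.truncn (N%:R `^ sigma^-1))]].

Definition WF (tau sigma : R) U u : set ('rV[R]_d * 'rV[R]_d) :=
  [set p | [/\ U p.1, p.2 != 0 & ~ WF_regular tau sigma U u p.1 p.2]].

End Distributions.

(* Main.v *)
Require Import Defs.
From mathcomp Require Import all_boot all_order all_algebra.
From mathcomp Require Import all_classical all_reals all_analysis.
From mathcomp Require Import ring lra zify.
Import Order.TTheory GRing.Theory Num.Theory.
Import numFieldNormedType.Exports.
Import ComplexField.Normc.
Set Implicit Arguments.
Unset Strict Implicit.
Unset Printing Implicit Defensive.
Local Open Scope classical_set_scope.
Local Open Scope ring_scope.
Local Open Scope complex_scope.

(** Why the theorem holds.

    Write [p] for [order_of sigma N], the exponent [floor (N^(1/sigma))], and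
    [W N] for the weight [N!^(tau/sigma)].

    First inclusion ([WF_regular_pdo]). If [u_N] is an adapted sequence for [u],
    then [P(D) u_N] agrees with [P(D) u] near [x0], and its Fourier transform is
    the symbol, of size [O(|xi|^m)], times that of [u_N].  The [m] lost powers of
    the frequency are recovered by passing to a subsequence [u_(f N)] whose
    exponent exceeds [p] by [m]: since the exponent is about [N^(1/sigma)] with
    [sigma > 1], [f N - N] is [O(N^(1-1/sigma))], and [W (f N)] is at most a
    geometric factor times [W N] ([index_shift]).

    Second inclusion ([WF_regular_elliptic]). Let [f_N] be an adapted sequence
    for [P(D) u] at [(x0, xi0)], where [P_m xi0] does not vanish.  The sequence
    shown for [u] is constant, equal to [chi u] for one cut-off [chi] of Gevrey
    class 2: the derivatives of [chi] of order [k] are bounded by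
    [C b^k (2k)!] ([cutoff_cube]), and for [k] proportional to [p] this is
    geometric in [N], again because [sigma > 1] ([gevrey_growth]).
    Let [F psi] and [G psi] be the Fourier transforms of [psi u] and of
    [psi P(D) u] at [xi] ([amplitude]).  Applying the transposed operator to a
    character times [psi] gives
      [G psi = symbol xi * F psi + sum of zpow xi s * F (d^t psi)],
    where [t] is not empty and [s ++ t] has length at most [m] ([pdo_character]).
    In a cone around [xi0] the symbol is at least [c0 |xi|^m]
    ([symbol_elliptic]), so that, with the normalisation [F (d^t chi) / |xi|^|t|],
    each term is controlled by those with more derivatives and by [G]
    ([amplitude_step]).  A downward recursion ([recursion_bound]) starts
    at orders [|t|] about [p], where the polynomial growth of [F] alone gives the
    decay [|xi|^-p].  Each step costs a constant factor, so the total cost is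
    geometric in [N].

    It remains to bound [G (d^t chi)], the transform of [psi f_N] for
    [psi = d^t chi], knowing that of [f_N] only in a cone.  This is the
    convolution of two transforms ([localized_fourier_bound]): near [xi] the decay
    of [f_N] is used, and far from [xi] that of the transform of [psi] against
    the polynomial growth of that of [f_N], which is uniform in [N]
    ([bounded_fourier]).  The convolution is obtained in a discrete
    form: [psi] is replaced by its trigonometric interpolant on a grid, a finite
    combination of characters, to which [f_N] applies term by term; the
    coefficients decay by summation by parts ([dft_decay]), uniformly in the
    mesh, and the interpolants converge in every [C^s] ([trig_error]).

    This yields regularity of [u] with the weights of [P(D) u]; as [N! >= 1] and
    [2^(sigma-1) >= 1], it passes to the larger weights of the statement
    ([WF_regular_mono]). *)

(** * Complex moduli *)

Section Modulus.
Variable R : realType.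
Implicit Types (z w : R[i]) (x : R).

Lemma normcD z w : normc (z + w) <= normc z + normc w.
Proof. exact: le_normcD. Qed.

Lemma normcB z w : normc (z - w) <= normc z + normc w.
Proof. by apply: le_trans (normcD _ _) _; rewrite (normcN w). Qed.

Lemma normc_ge0 z : 0 <= normc z.
Proof. by case: z => a b; apply: sqrtr_ge0. Qed.

Lemma normc_real x : normc x%:C = `|x|.
Proof. by rewrite /= expr0n addr0 sqrtr_sqr. Qed.

Lemma normcX z n : normc (z ^+ n) = normc z ^+ n.
Proof. by elim: n => [|n IH]; rewrite ?expr0 ?normc1 // !exprS normcM IH. Qed.

Lemma normc_sum (I : Type) (r : seq I) (P : pred I) (F : I -> R[i]) :
  normc (\sum_(i <- r | P i) F i) <= \sum_(i <- r | P i) normc (F i).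
Proof.
elim/big_ind2: _ => [|z1 x1 z2 x2 h1 h2|//]; first by rewrite normc0.
by apply: le_trans (normcD _ _) (lerD h1 h2).
Qed.

Lemma normc_prod (I : Type) (r : seq I) (P : pred I) (F : I -> R[i]) :
  normc (\prod_(i <- r | P i) F i) = \prod_(i <- r | P i) normc (F i).
Proof.
by elim/big_ind2: _ => [|z1 x1 z2 x2 <- <-|//]; rewrite ?normc1 // normcM.
Qed.

Lemma ler_norm_Re z : `|complex.Re z| <= normc z.
Proof.
by case: z => a b /=; rewrite -sqrtr_sqr ler_sqrt ?lerDl ?addr_ge0 ?sqr_ge0.
Qed.

Lemma ler_norm_Im z : `|complex.Im z| <= normc z.
Proof.
by case: z => a b /=; rewrite -sqrtr_sqr ler_sqrt ?lerDr ?addr_ge0 ?sqr_ge0.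
Qed.

Lemma normc_le_ReIm z : normc z <= `|complex.Re z| + `|complex.Im z|.
Proof.
case: z => a b /=; rewrite -(ger0_norm (addr_ge0 (normr_ge0 a) (normr_ge0 b))).
rewrite -sqrtr_sqr ler_sqrt ?sqr_ge0 // sqrrD !real_normK ?num_real //.
by rewrite addrAC lerDl mulrn_wge0 // mulr_ge0.
Qed.

Lemma normc_eq0 z : (normc z == 0) = (z == 0).
Proof.
by apply/eqP/eqP => [/eq0_normc|->]; rewrite ?normc0.
Qed.

Lemma ReM z w : complex.Re (z * w) =
  complex.Re z * complex.Re w - complex.Im z * complex.Im w.
Proof. by case: z; case: w. Qed.

Lemma ImM z w : complex.Im (z * w) =
  complex.Re z * complex.Im w + complex.Im z * complex.Re w.
Proof. by case: z; case: w. Qed.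

Lemma ReD z w : complex.Re (z + w) = complex.Re z + complex.Re w.
Proof. by case: z; case: w. Qed.

Lemma ImD z w : complex.Im (z + w) = complex.Im z + complex.Im w.
Proof. by case: z; case: w. Qed.

End Modulus.

(** * Calculus of complex-valued functions *)

Section Calculus.
Variables (R : realType) (d : nat).
Notation vec := 'rV[R]_d.
Notation cfun := (vec -> R[i]).
Implicit Types (U V : set vec) (x : vec) (j : 'I_d) (s t : seq 'I_d).
Implicit Types (phi psi : cfun).

Definition repart phi : vec -> R := fun x => complex.Re (phi x).
Definition impart phi : vec -> R := fun x => complex.Im (phi x).

Definition ccontinuous phi x : Prop :=
  {for x, continuous (repart phi)} /\ {for x, continuous (impart phi)}.

Definition is_partial j phi x (l : R[i]) : Prop :=
  is_derive x (unit_vec R j) (repart phi) (complex.Re l) /\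
  is_derive x (unit_vec R j) (impart phi) (complex.Im l).

Definition cpartial j phi : cfun :=
  fun x => partial j (repart phi) x +i* partial j (impart phi) x.

(** Derivatives are indexed by lists of directions: differentiating once more is
    [cons], and lists split between the factors of a product. *)
Definition cpartials s phi : cfun := foldr cpartial phi s.

Lemma cpartialsE s phi x : cpartials s phi x =
  iter_partial s (repart phi) x +i* iter_partial s (impart phi) x.
Proof.
elim: s x => [x|j s IH x] /=; first by rewrite /repart /impart; case: (phi x).
have e (p : R[i] -> R) (q : vec -> R) : (forall y, p (cpartials s phi y) = q y) ->
    partial j (fun y => p (cpartials s phi y)) x = partial j q x.
  by move=> h; congr (partial j _ x); apply: funext.
have := e (@complex.Re R) (iter_partial s (repart phi)).
have := e (@complex.Im R) (iter_partial s (impart phi)).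
by rewrite /cpartial => -> => [->//|y]; move=> *; rewrite IH.
Qed.

Lemma cpartials_cat s t phi : cpartials (s ++ t) phi = cpartials s (cpartials t phi).
Proof. by rewrite /cpartials foldr_cat. Qed.

Lemma is_partialE j phi x l : is_partial j phi x l -> cpartial j phi x = l.
Proof.
by case: l => a b [h1 h2]; rewrite /cpartial /partial !derive_val.
Qed.

Lemma smoothP U phi : smooth U phi <-> forall s x, U x ->
  ccontinuous (cpartials s phi) x /\
  forall j, is_partial j (cpartials s phi) x (cpartials (j :: s) phi x).
Proof.
have reE s : repart (cpartials s phi) = iter_partial s (repart phi).
  by apply: funext => y; rewrite /repart cpartialsE.
have imE s : impart (cpartials s phi) = iter_partial s (impart phi).
  by apply: funext => y; rewrite /impart cpartialsE.
split=> [[h1 h2] s x Ux|h].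
  have [c1 d1] := h1 s x Ux; have [c2 d2] := h2 s x Ux.
  split; first by split; rewrite ?reE ?imE.
  move=> j; rewrite /= /cpartial; split; apply: derivableP.
    by rewrite reE; apply: d1.
  by rewrite imE; apply: d2.
split=> s x Ux; have [[c1 c2] ds] := h s x Ux; split.
- by move: c1; rewrite reE.
- by move=> j; have [[d1 _] _] := ds j; move: d1; rewrite reE.
- by move: c2; rewrite imE.
- by move=> j; have [_ [d1 _]] := ds j; move: d1; rewrite imE.
Qed.

Lemma ccontinuous_near phi psi x :
  (\forall y \near x, phi y = psi y) -> ccontinuous phi x -> ccontinuous psi x.
Proof.
move=> e [c1 c2].
have aux (p : R[i] -> R) : {for x, continuous (p \o phi)} -> {for x, continuous (p \o psi)}.
  rewrite /prop_for /continuous_at /= -(nbhs_singleton e).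
  have e' : {near nbhs x, p \o phi =1 p \o psi} by apply: filterS e => y /= ->.
  exact: cvg_trans (near_eq_cvg e').
by split; apply: aux.
Qed.

Lemma is_partial_near j phi psi x l :
  (\forall y \near x, phi y = psi y) -> is_partial j phi x l -> is_partial j psi x l.
Proof.
move=> e [[d1 v1] [d2 v2]].
have e1 : {near x, repart phi =1 repart psi}.
  by apply: filterS e => y; rewrite /repart => ->.
have e2 : {near x, impart phi =1 impart psi}.
  by apply: filterS e => y; rewrite /impart => ->.
split; apply: DeriveDef.
- exact: near_eq_derivable e1 d1.
- by rewrite -(near_eq_derive _ e1).
- exact: near_eq_derivable e2 d2.
- by rewrite -(near_eq_derive _ e2).
Qed.

Lemma ccontinuousD phi psi x : ccontinuous phi x -> ccontinuous psi x ->
  ccontinuous (fun y => phi y + psi y) x.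
Proof.
move=> [a1 a2] [b1 b2]; split.
  rewrite (_ : repart _ = repart phi + repart psi); first exact: continuousD.
  by apply: funext => y; rewrite /repart ReD.
rewrite (_ : impart _ = impart phi + impart psi); first exact: continuousD.
by apply: funext => y; rewrite /impart ImD.
Qed.

Lemma ccontinuousM phi psi x : ccontinuous phi x -> ccontinuous psi x ->
  ccontinuous (fun y => phi y * psi y) x.
Proof.
move=> [a1 a2] [b1 b2]; split.
  rewrite (_ : repart _ = repart phi * repart psi - impart phi * impart psi).
    by apply: continuousB; apply: continuousM.
  by apply: funext => y; rewrite /repart ReM.
rewrite (_ : impart _ = repart phi * impart psi + impart phi * repart psi).
  by apply: continuousD; apply: continuousM.
by apply: funext => y; rewrite /impart ImM.
Qed.

Lemma ccontinuous_cst (z : R[i]) x : ccontinuous (fun=> z) x.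
Proof. by split; apply: cst_continuous. Qed.

Lemma is_partialD j phi psi x k l : is_partial j phi x k -> is_partial j psi x l ->
  is_partial j (fun y => phi y + psi y) x (k + l).
Proof.
move=> [a1 a2] [b1 b2]; split.
  rewrite (_ : repart _ = repart phi + repart psi) ?ReD; first exact: is_deriveD.
  by apply: funext => y; rewrite /repart ReD.
rewrite (_ : impart _ = impart phi + impart psi) ?ImD; first exact: is_deriveD.
by apply: funext => y; rewrite /impart ImD.
Qed.

Lemma is_partialM j phi psi x k l : is_partial j phi x k -> is_partial j psi x l ->
  is_partial j (fun y => phi y * psi y) x (k * psi x + phi x * l).
Proof.
move=> [a1 a2] [b1 b2]; split.
  rewrite (_ : repart _ = repart phi * repart psi - impart phi * impart psi).
    apply: is_derive_eq; rewrite ReD !ReM /repart /impart /GRing.scale /=; ring.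
  by apply: funext => y; rewrite /repart ReM.
rewrite (_ : impart _ = repart phi * impart psi + impart phi * repart psi).
  apply: is_derive_eq; rewrite ImD !ImM /repart /impart /GRing.scale /=; ring.
by apply: funext => y; rewrite /impart ImM.
Qed.

Lemma is_partial_cst j (z : R[i]) x : is_partial j (fun=> z) x 0.
Proof. by split; apply: is_derive_cst. Qed.

Lemma eq_open_cpartials U phi psi : open U -> (forall x, U x -> phi x = psi x) ->
  forall s x, U x -> cpartials s phi x = cpartials s psi x.
Proof.
move=> oU e; elim=> [//|j s IH x Ux] /=.
have {}IH : \forall y \near x, cpartials s phi y = cpartials s psi y.
  by apply: filterS (open_nbhs_nbhs (conj oU Ux)) => y /IH.
rewrite /cpartial /partial; congr (Complex _ _); apply: near_eq_derive; apply: filterS IH => y.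
  by rewrite /repart => ->.
by rewrite /impart => ->.
Qed.

(** The derivatives of [phi] are exhibited rather than computed: a family
    [D] of functions indexed by lists that is closed under differentiation.
    Smoothness and the formula for the derivatives come together. *)
Lemma smooth_family U (phi : cfun) (D : seq 'I_d -> cfun) : open U ->
  D [::] = phi ->
  (forall s x, U x -> ccontinuous (D s) x /\ forall j, is_partial j (D s) x (D (j :: s) x)) ->
  smooth U phi /\ forall s x, U x -> cpartials s phi x = D s x.
Proof.
move=> oU D0 DS.
have DE s x : U x -> cpartials s phi x = D s x.
  elim: s x => [x _|j s IH x Ux]; first by rewrite D0.
  apply: is_partialE; apply: (@is_partial_near _ (D s)); last by have [_ ] := DS s x Ux.
  by apply: filterS (open_nbhs_nbhs (conj oU Ux)) => y /IH.
split=> //; apply/smoothP => s x Ux; have [c p] := DS s x Ux.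
have e : \forall y \near x, D s y = cpartials s phi y.
  by apply: filterS (open_nbhs_nbhs (conj oU Ux)) => y /DE.
split; first exact: ccontinuous_near c.
by move=> j; rewrite DE //; apply: is_partial_near (p j).
Qed.

Lemma eq_open_smooth U phi psi : open U -> (forall x, U x -> phi x = psi x) ->
  smooth U phi -> smooth U psi.
Proof.
move=> oU e /smoothP h; apply/smoothP => s x Ux; have [c p] := h s x Ux.
have e1 : \forall y \near x, cpartials s phi y = cpartials s psi y.
  by apply: filterS (open_nbhs_nbhs (conj oU Ux)) => y; apply: eq_open_cpartials.
split; first exact: ccontinuous_near c.
by move=> j; rewrite -(eq_open_cpartials oU e) //; apply: is_partial_near (p j).
Qed.

Lemma smooth_sub U V phi : V `<=` U -> smooth U phi -> smooth V phi.
Proof. by move=> VU /smoothP h; apply/smoothP => s x /VU; apply: h. Qed.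

Lemma smooth_local U phi :
  (forall x, U x -> exists V, [/\ open V, V x & smooth V phi]) -> smooth U phi.
Proof.
move=> h; apply/smoothP => s x /h[V [oV Vx /smoothP]]; exact.
Qed.

Lemma smooth_cpartials U phi s : smooth U phi -> smooth U (cpartials s phi).
Proof.
move=> /smoothP h; apply/smoothP => t x Ux; rewrite -cpartials_cat.
by have [c p] := h (t ++ s) x Ux; split=> // j; rewrite -cpartials_cat; apply: p.
Qed.

Lemma smooth_cst_cpartials U (z : R[i]) : open U -> smooth U (fun=> z) /\
  forall s x, U x -> cpartials s (fun=> z) x = if s is [::] then z else 0.
Proof.
move=> oU; apply: (@smooth_family _ _ (fun s _ => if s is [::] then z else 0)) => //.
move=> s x Ux; split; first by case: s => *; apply: ccontinuous_cst.
by move=> j; case: s => *; apply: is_partial_cst.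
Qed.

Lemma smoothD_cpartials U phi psi : open U -> smooth U phi -> smooth U psi ->
  smooth U (fun x => phi x + psi x) /\
  forall s x, U x ->
    cpartials s (fun x => phi x + psi x) x = cpartials s phi x + cpartials s psi x.
Proof.
move=> oU /smoothP h1 /smoothP h2.
apply: (@smooth_family _ _ (fun s x => cpartials s phi x + cpartials s psi x)) => //.
move=> s x Ux; have [c1 p1] := h1 s x Ux; have [c2 p2] := h2 s x Ux.
split; first exact: ccontinuousD.
by move=> j; apply: is_partialD.
Qed.

(** The terms of the Leibniz formula, with repetitions in place of binomial
    coefficients. *)
Fixpoint splits s : seq (seq 'I_d * seq 'I_d) :=
  if s is j :: s' then
    [seq (j :: p.1, p.2) | p <- splits s'] ++ [seq (p.1, j :: p.2) | p <- splits s']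
  else [:: ([::], [::])].

Lemma size_splits s : size (splits s) = (2 ^ size s)%N.
Proof.
by elim: s => //= j s IH; rewrite size_cat !size_map IH expnS mul2n -addnn.
Qed.

Lemma splits_size s p : p \in splits s -> (size p.1 + size p.2 = size s)%N.
Proof.
elim: s p => [|j s IH] p /=; first by rewrite inE => /eqP->.
rewrite mem_cat => /orP[] /mapP[q /IH <- ->] /=; first by rewrite addSn.
by rewrite addnS.
Qed.

Lemma is_partial_sum j (I : Type) (r : seq I) (F : I -> cfun) (G : I -> R[i]) x :
  (forall i, is_partial j (F i) x (G i)) ->
  is_partial j (fun y => \sum_(i <- r) F i y) x (\sum_(i <- r) G i).
Proof.
move=> h; elim: r => [|i r IH].
  rewrite big_nil (_ : (fun _ => _) = fun=> 0); first exact: is_partial_cst.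
  by apply: funext => y; rewrite big_nil.
rewrite big_cons (_ : (fun _ => _) = fun y => F i y + \sum_(k <- r) F k y).
  exact: is_partialD.
by apply: funext => y; rewrite big_cons.
Qed.

Lemma ccontinuous_sum (I : Type) (r : seq I) (F : I -> cfun) x :
  (forall i, ccontinuous (F i) x) -> ccontinuous (fun y => \sum_(i <- r) F i y) x.
Proof.
move=> h; elim: r => [|i r IH].
  rewrite (_ : (fun _ => _) = fun=> 0); first exact: ccontinuous_cst.
  by apply: funext => y; rewrite big_nil.
rewrite (_ : (fun _ => _) = fun y => F i y + \sum_(k <- r) F k y).
  exact: ccontinuousD.
by apply: funext => y; rewrite big_cons.
Qed.

Lemma smoothM_cpartials U phi psi : open U -> smooth U phi -> smooth U psi ->
  smooth U (fun x => phi x * psi x) /\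
  forall s x, U x -> cpartials s (fun x => phi x * psi x) x =
    \sum_(p <- splits s) cpartials p.1 phi x * cpartials p.2 psi x.
Proof.
move=> oU /smoothP h1 /smoothP h2.
apply: (@smooth_family _ _
  (fun s x => \sum_(p <- splits s) cpartials p.1 phi x * cpartials p.2 psi x)) => //.
  by apply: funext => x; rewrite big_seq1.
move=> s x Ux; split.
  apply: ccontinuous_sum => p; apply: ccontinuousM.
    by have [] := h1 p.1 x Ux.
  by have [] := h2 p.2 x Ux.
move=> j; rewrite [splits _]/= big_cat !big_map /= -big_split.
apply: is_partial_sum => p; apply: is_partialM.
  by have [_] := h1 p.1 x Ux; apply.
by have [_] := h2 p.2 x Ux; apply.
Qed.

Lemma smoothD U phi psi : open U -> smooth U phi -> smooth U psi ->
  smooth U (fun x => phi x + psi x).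
Proof. by move=> oU h1 h2; have [] := smoothD_cpartials oU h1 h2. Qed.

Lemma smoothM U phi psi : open U -> smooth U phi -> smooth U psi ->
  smooth U (fun x => phi x * psi x).
Proof. by move=> oU h1 h2; have [] := smoothM_cpartials oU h1 h2. Qed.

Lemma cpartialsM U phi psi s x : open U -> smooth U phi -> smooth U psi -> U x ->
  cpartials s (fun x => phi x * psi x) x =
    \sum_(p <- splits s) cpartials p.1 phi x * cpartials p.2 psi x.
Proof. by move=> oU h1 h2 Ux; have [_ ->] := smoothM_cpartials oU h1 h2. Qed.

Lemma smoothZ_cpartials U (z : R[i]) phi : open U -> smooth U phi ->
  smooth U (fun x => z * phi x) /\
  forall s x, U x -> cpartials s (fun x => z * phi x) x = z * cpartials s phi x.
Proof.
move=> oU /smoothP h.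
apply: (@smooth_family _ _ (fun s x => z * cpartials s phi x)) => // s x Ux.
have [c p] := h s x Ux; split; first exact: ccontinuousM (ccontinuous_cst _ _) c.
move=> j; have := is_partialM (is_partial_cst j z x) (p j).
by rewrite mul0r add0r.
Qed.

Lemma smooth_sum_cpartials U (I : Type) (r : seq I) (F : I -> cfun) : open U ->
  (forall i, smooth U (F i)) ->
  smooth U (fun x => \sum_(i <- r) F i x) /\
  forall s x, U x -> cpartials s (fun x => \sum_(i <- r) F i x) x =
    \sum_(i <- r) cpartials s (F i) x.
Proof.
move=> oU h; apply: (@smooth_family _ _ (fun s x => \sum_(i <- r) cpartials s (F i) x)) => //.
move=> s x Ux; split; first by apply: ccontinuous_sum => i; have /smoothP/(_ s x Ux)[] := h i.
by move=> j; apply: is_partial_sum => i; have /smoothP/(_ s x Ux)[_] := h i; apply.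
Qed.

End Calculus.

(** * Mean values and the symmetry of second derivatives *)

Section MeanValue.
Variables (R : realType) (d : nat).
Notation vec := 'rV[R]_d.
Notation cfun := (vec -> R[i]).
Notation e_ := (unit_vec R).
Implicit Types (U : set vec) (x : vec) (j : 'I_d) (s : seq (ordinal d)).

Lemma is_derive_line (f : vec -> R) x v (t l : R) :
  is_derive (x + t *: v) v f l -> is_derive t 1 (fun h => f (x + h *: v)) l.
Proof.
move=> [h1 h2].
have e : (fun h : R => h^-1 *: (((fun h => f (x + h *: v)) \o shift t) (h *: 1) - f (x + t *: v)))
       = (fun h : R => h^-1 *: ((f \o shift (x + t *: v)) (h *: v) - f (x + t *: v))).
  apply: funext => h; congr (_ *: (f _ - _)) => /=.
  by rewrite [h *: 1]mulr1 scalerDl addrCA addrA addrC addrA.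
split; first by rewrite /derivable e.
by rewrite /derive e.
Qed.

Lemma mean_value_line (f : vec -> R) x v (h : R) : 0 <= h ->
  (forall t, 0 <= t <= h -> derivable f (x + t *: v) v) ->
  exists2 t, 0 <= t <= h & f (x + h *: v) - f x = h * 'D_v f (x + t *: v).
Proof.
move=> h0 H.
have D t : 0 <= t <= h -> is_derive t 1 (fun h => f (x + h *: v)) ('D_v f (x + t *: v)).
  by move=> /H th; apply: is_derive_line; apply: derivableP.
have [||t] := @MVT_segment R (fun h => f (x + h *: v)) (fun t => 'D_v f (x + t *: v)) 0 h h0.
- by move=> t; rewrite in_itv /= => /andP[/ltW a /ltW b]; apply: D; rewrite a.
- apply: derivable_within_continuous => t; rewrite in_itv /= => /D th.
  exact: ex_derive.
rewrite in_itv /= => th; rewrite subr0 scale0r addr0 mulrC; exists t => //.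
Qed.

Lemma rv_norm_leP (x : vec) (r : R) : 0 <= r ->
  reflect (forall j, `|x ord0 j| <= r) (`|x| <= r).
Proof.
move=> r0; rewrite -[`|x|]/(mx_norm x) mx_normrE.
apply: (iffP (bigmax_leP _ _ _ _)) => [[_ h] j|h]; first exact: (h (ord0, j)).
by split=> // -[i j] _ /=; rewrite (ord1 i).
Qed.

Lemma norm_coord (x : vec) j : `|x ord0 j| <= `|x|.
Proof. exact: (rv_norm_leP x (normr_ge0 x) (lexx _)). Qed.

Lemma norm_unit_vec j : `|e_ j| = 1.
Proof.
apply/eqP; rewrite eq_le; apply/andP; split.
  apply/(rv_norm_leP _ ler01) => k.
  by rewrite /unit_vec mxE; case: (_ && _); rewrite ?normr1 ?normr0.
by have := norm_coord (e_ j) j; rewrite /unit_vec mxE !eqxx normr1.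
Qed.

Lemma partialC U (f : vec -> R) x i j : open U -> real_smooth U f -> U x ->
  partial i (partial j f) x = partial j (partial i f) x.
Proof.
move=> oU sm Ux.
have /nbhs_ballP[r /= r0 rU] := open_nbhs_nbhs (conj oU Ux).
have inU (k l : 'I_d) (a b h : R) : 0 <= a <= h -> 0 <= b <= h -> h < r / 2 ->
    U (x + a *: e_ k + b *: e_ l).
  move=> /andP[a0 ah] /andP[b0 bh] hr; apply: rU; rewrite -ball_normE /=.
  rewrite opprD addrA opprD addrA subrr add0r -opprD normrN.
  apply: le_lt_trans (ler_normD _ _) _; rewrite !normrZ !norm_unit_vec !mulr1 !ger0_norm //.
  lra.
(* The double increment along two axes does not depend on their order; two mean
   values turn it into either mixed derivative at a point near x *)
pose Delta (k l : 'I_d) (h : R) := (f (x + h *: e_ k + h *: e_ l) - f (x + h *: e_ k))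
  - (f (x + h *: e_ l) - f x).
have step (k l : 'I_d) h : 0 < h -> h < r / 2 -> exists a b, [/\ 0 <= a <= h, 0 <= b <= h &
    Delta k l h = h * (h * partial l (partial k f) (x + a *: e_ k + b *: e_ l))].
  move=> h0 hr.
  have hh : 0 <= h <= h by apply/andP; split; lra.
  have zh : 0 <= (0 : R) <= h by rewrite lexx ltW.
  pose g (y : vec) := f (y + h *: e_ l) - f y.
  have dg t : 0 <= t <= h -> is_derive (x + t *: e_ k) (e_ k) g
      (partial k f (x + t *: e_ k + h *: e_ l) - partial k f (x + t *: e_ k)).
    move=> th; rewrite (_ : g = (fun y => f (y + h *: e_ l)) - f) //.
    have d1 : is_derive (x + t *: e_ k) (e_ k) (fun y => f (y + h *: e_ l))
        (partial k f (x + t *: e_ k + h *: e_ l)).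
      have [_ /(_ k) /derivableP[q1 q2]] := sm [::] _ (inU k l t h h th hh hr).
      have e : (fun a : R => a^-1 *: (((fun y => f (y + h *: e_ l)) \o shift (x + t *: e_ k)) (a *: e_ k)
            - f (x + t *: e_ k + h *: e_ l))) =
          (fun a : R => a^-1 *: ((f \o shift (x + t *: e_ k + h *: e_ l)) (a *: e_ k)
            - f (x + t *: e_ k + h *: e_ l))).
        by apply: funext => a /=; rewrite !addrA.
      by split; [rewrite /derivable e|rewrite /derive e].
    have d2 : is_derive (x + t *: e_ k) (e_ k) f (partial k f (x + t *: e_ k)).
      have := inU k l t 0 h th zh hr; rewrite scale0r addr0 => q.
      by have [_ /(_ k) /derivableP] := sm [::] _ q.
    exact: is_deriveB.
  have [a ah ea] := @mean_value_line g x (e_ k) h (ltW h0) (fun t th => @ex_derive _ _ _ _ _ _ _ (dg t th)).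
  have [b bh eb] := @mean_value_line (partial k f) (x + a *: e_ k) (e_ l) h (ltW h0)
    (fun t th => proj2 (sm [:: k] _ (inU k l a t h ah th hr)) l).
  exists a, b; split=> //; rewrite -[Delta k l h]/(g (x + h *: e_ k) - g x) ea.
  by rewrite (@derive_val _ _ _ _ _ _ _ (dg a ah)) eb.
pose eps : R := `|partial i (partial j f) x - partial j (partial i f) x|.
have [/eqP|ne] := eqVneq eps 0; first by rewrite normr_eq0 subr_eq0 => /eqP.
have e0 : 0 < eps / 2 by rewrite divr_gt0 // lt_def ne normr_ge0.
have close (k l : 'I_d) : exists2 q : R, 0 < q & forall y, `|x - y| < q ->
    `|partial l (partial k f) x - partial l (partial k f) y| < eps / 2.
  have [c _] := sm [:: l; k] _ Ux.
  have /cvgrPdist_lt/(_ _ e0)/nbhs_ballP[q /= q0 h] := c.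
  by exists q => // y xy; apply: h; rewrite -ball_normE.
have [q q0 hq] := close i j; have [q' q0' hq'] := close j i.
pose h := Num.min (r / 4) (Num.min (q / 4) (q' / 4)).
have h0 : 0 < h by rewrite /h !lt_min !divr_gt0.
have hr : h < r / 2.
  by apply: le_lt_trans (_ : h <= r / 4) _; [rewrite /h ge_min lexx|lra].
have h1 : h <= q / 4 by rewrite /h !ge_min lexx !orbT.
have h2 : h <= q' / 4 by rewrite /h !ge_min lexx !orbT.
clearbody h.
have hq2 : h + h < q by clear -h1 q0; lra.
have hq2' : h + h < q' by clear -h2 q0'; lra.
have dist (k l : 'I_d) a b : 0 <= a <= h -> 0 <= b <= h ->
    `|x - (x + a *: e_ k + b *: e_ l)| <= h + h.
  move=> /andP[a0 ah] /andP[b0 bh].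
  rewrite opprD addrA opprD addrA subrr add0r -opprD normrN.
  apply: le_trans (ler_normD _ _) _; rewrite !normrZ !norm_unit_vec !mulr1 !ger0_norm //.
  lra.
have [a [b [ah bh eD]]] := step i j h h0 hr.
have [a' [b' [ah' bh' eD']]] := step j i h h0 hr.
have sym : Delta i j h = Delta j i h.
  by rewrite /Delta (addrAC x (h *: e_ i)); ring.
have := hq _ (le_lt_trans (dist i j a b ah bh) hq2).
have := hq' _ (le_lt_trans (dist j i a' b' ah' bh') hq2').
move: sym; rewrite eD eD' => /(mulfI (lt0r_neq0 h0))/(mulfI (lt0r_neq0 h0)) ->.
move=> A B.
have lt : eps < eps / 2 + eps / 2.
  by apply: le_lt_trans (ler_distD _ _ _) (ltrD A _); rewrite distrC; exact: B.
by exfalso; move: lt; rewrite -splitr ltxx.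
Qed.

Lemma cpartialC U (phi : cfun) x i j : open U -> smooth U phi -> U x ->
  cpartials [:: i; j] phi x = cpartials [:: j; i] phi x.
Proof.
move=> oU [s1 s2] Ux; rewrite !cpartialsE.
have e1 := partialC i j oU s1 Ux; have e2 := partialC i j oU s2 Ux.
rewrite /iter_partial /=.
exact: (f_equal2 (@Complex R) e1 e2).
Qed.

(** Lists of directions may stand for multi-indices because mixed derivatives are
    symmetric. *)
Lemma cpartials_perm U (phi : cfun) s (t : seq (ordinal d)) : open U -> smooth U phi -> perm_eq s t ->
  forall x, U x -> cpartials s phi x = cpartials t phi x.
Proof.
move=> oU sm; elim: s t => [t|j s IH t].
  by move=> /perm_size/esym/size0nil->.
move=> st; have jt : j \in t by rewrite -(perm_mem st) mem_head.
have [t1 [t2 et]] : exists t1 t2, t = t1 ++ j :: t2.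
  by case/splitPr: jt => t1 t2; exists t1, t2.
have {}st : perm_eq s (t1 ++ t2).
  by rewrite -(perm_cons j); apply: perm_trans st _; rewrite et perm_catC /= perm_cons perm_catC.
move=> x Ux; rewrite et.
have -> : cpartials (j :: s) phi x = cpartials (j :: t1 ++ t2) phi x.
  by apply: (@eq_open_cpartials _ _ U _ _ oU (IH _ st) [:: j]).
elim: t1 x Ux {st et jt IH} => [//|i t1 IH x Ux].
rewrite -[RHS]/(cpartials [:: i] (cpartials (t1 ++ j :: t2) phi) x).
rewrite -(@eq_open_cpartials _ _ U _ _ oU IH [:: i] x Ux).
exact: (cpartialC j i oU (smooth_cpartials (t1 ++ t2) sm) Ux).
Qed.

Definition mlist (alpha : 'I_d -> nat) : seq 'I_d :=
  flatten [seq nseq (alpha j) j | j <- enum 'I_d].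

Lemma dpartialE alpha (phi : cfun) : dpartial alpha phi = cpartials (mlist alpha) phi.
Proof.
apply: funext => x; rewrite cpartialsE /dpartial.
suff e (f : vec -> R) : real_dpartial alpha f = iter_partial (mlist alpha) f by rewrite !e.
rewrite /real_dpartial /iter_partial /mlist.
elim: (enum _) => [//|j s IH]; rewrite [LHS]/= IH.
rewrite [flatten _]/= (foldr_cat (@partial R d)).
by elim: (alpha j) => [//|n IHn]; rewrite [LHS]/= IHn.
Qed.

Lemma size_mlist (alpha : 'I_d -> nat) : size (mlist alpha) = (\sum_j alpha j)%N.
Proof.
rewrite /mlist size_flatten /shape -map_comp sumnE big_map big_enum /=.
by apply: eq_bigr => j _; rewrite size_nseq.
Qed.

Lemma count_mlist (alpha : 'I_d -> nat) j : count_mem j (mlist alpha) = alpha j.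
Proof.
rewrite /mlist count_flatten -map_comp sumnE big_map big_enum /= (bigD1 j) //=.
rewrite count_nseq /= eqxx mul1n big1 ?addn0 // => i ij.
by rewrite count_nseq /= (negbTE ij) mul0n.
Qed.

Lemma perm_mlist (s : seq (ordinal d)) : perm_eq s (mlist (fun j => count_mem j s)).
Proof. by apply/allP => j _ /=; rewrite count_mlist. Qed.

Lemma cpartials_dpartial U (phi : cfun) s x : open U -> smooth U phi -> U x ->
  cpartials s phi x = dpartial (fun j => count_mem j s) phi x.
Proof. by move=> oU sm; rewrite dpartialE; apply: (cpartials_perm oU sm); apply: perm_mlist. Qed.

(** The factor 2 pays for the two mean values, of the real and of the imaginary
    part. *)
Lemma increment_le (phi : cfun) x j (h B : R) : smooth setT phi -> 0 <= h ->
  (forall y, normc (cpartials [:: j] phi y) <= B) ->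
  normc (phi (x + h *: e_ j) - phi x) <= 2 * h * B.
Proof.
move=> [s1 s2] h0 bB.
have [t th et] := @mean_value_line (repart phi) x (e_ j) h h0 (fun t _ => proj2 (s1 [::] _ I) j).
have [t' th' et'] := @mean_value_line (impart phi) x (e_ j) h h0 (fun t _ => proj2 (s2 [::] _ I) j).
have k1 := le_trans (ler_norm_Re _) (bB (x + t *: e_ j)).
have k2 := le_trans (ler_norm_Im _) (bB (x + t' *: e_ j)).
apply: le_trans (normc_le_ReIm _) _.
have -> : complex.Re (phi (x + h *: e_ j) - phi x) = repart phi (x + h *: e_ j) - repart phi x.
  by rewrite /repart; case: (phi _); case: (phi _).
have -> : complex.Im (phi (x + h *: e_ j) - phi x) = impart phi (x + h *: e_ j) - impart phi x.
  by rewrite /impart; case: (phi _); case: (phi _).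
rewrite et et' !normrM (ger0_norm h0) -mulrDr -mulrA mulrCA.
by apply: ler_wpM2l => //; rewrite mulr_natl mulr2n lerD.
Qed.

Lemma increment2_le (phi : cfun) x j (h B : R) : smooth setT phi -> 0 <= h ->
  (forall y, normc (cpartials [:: j; j] phi y) <= B) ->
  normc (phi (x + h *: e_ j) - phi x - h%:C * cpartials [:: j] phi x) <= 2 * h ^+ 2 * B.
Proof.
move=> [s1 s2] h0 bB.
have aux (f : vec -> R) : real_smooth setT f ->
    (forall y, `|partial j (partial j f) y| <= B) ->
    `|f (x + h *: e_ j) - f x - h * partial j f x| <= h * (h * B).
  move=> sf hB.
  have [t /andP[t0 th] ->] := @mean_value_line f x (e_ j) h h0 (fun t _ => proj2 (sf [::] _ I) j).
  have [a _ ea] := @mean_value_line (partial j f) x (e_ j) t t0 (fun t _ => proj2 (sf [:: j] _ I) j).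
  rewrite -mulrBr normrM (ger0_norm h0) ler_wpM2l // -[X in X - _]/(partial j f _) ea.
  by rewrite normrM (ger0_norm t0); apply: ler_pM => //; apply: hB.
have := aux _ s1; have := aux _ s2.
have k1 y : `|partial j (partial j (repart phi)) y| <= B.
  have := le_trans (ler_norm_Re _) (bB y).
  by rewrite cpartialsE.
have k2 y : `|partial j (partial j (impart phi)) y| <= B.
  by have := le_trans (ler_norm_Im _) (bB y); rewrite cpartialsE.
move=> /(_ k2) a2 /(_ k1) a1.
apply: le_trans (normc_le_ReIm _) _.
rewrite cpartialsE.
have -> : complex.Re (phi (x + h *: e_ j) - phi x - h%:C *
    (iter_partial [:: j] (repart phi) x +i* iter_partial [:: j] (impart phi) x)) =
    repart phi (x + h *: e_ j) - repart phi x - h * partial j (repart phi) x.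
  by rewrite /repart; case: (phi _) => ? ?; case: (phi _) => ? ? /=; rewrite mul0r subr0.
have -> : complex.Im (phi (x + h *: e_ j) - phi x - h%:C *
    (iter_partial [:: j] (repart phi) x +i* iter_partial [:: j] (impart phi) x)) =
    impart phi (x + h *: e_ j) - impart phi x - h * partial j (impart phi) x.
  by rewrite /impart; case: (phi _) => ? ?; case: (phi _) => ? ? /=; rewrite mul0r addr0.
apply: le_trans (lerD a1 a2) _; rewrite expr2; lra.
Qed.

End MeanValue.

(** * Supports and test functions *)

Section TestFunctions.
Variables (R : realType) (d : nat).
Notation vec := 'rV[R]_d.
Notation cfun := (vec -> R[i]).
Implicit Types (U V K : set vec) (x : vec) (s : seq 'I_d) (phi psi chi : cfun).

Lemma fsupport_incl phi x : phi x != 0 -> fsupport phi x.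
Proof. by move=> h; apply: subset_closure. Qed.

Lemma fsupport_out phi x : ~ fsupport phi x -> phi x = 0.
Proof. by move=> h; apply: contrapT => /eqP /fsupport_incl. Qed.

Lemma closed_fsupport phi : closed (fsupport phi).
Proof. exact: closed_closure. Qed.

Lemma fsupport_sub K phi : closed K -> (forall x, phi x != 0 -> K x) -> fsupport phi `<=` K.
Proof. by move=> /closure_id cK h; rewrite cK; apply: closureS => x /h. Qed.

Lemma fsupportM phi psi : fsupport (fun x => phi x * psi x) `<=` fsupport phi `&` fsupport psi.
Proof.
apply: fsupport_sub; first by apply: closedI; apply: closed_fsupport.
by move=> x; rewrite mulf_eq0 negb_or => /andP[/fsupport_incl ? /fsupport_incl ?].
Qed.

Lemma cpartials0 s x : cpartials s (fun=> 0 : R[i]) x = 0.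
Proof.
by have [_ ->] := smooth_cst_cpartials (0 : R[i]) (@openT vec); case: s.
Qed.

Lemma cpartials_out phi s x : ~ fsupport phi x -> cpartials s phi x = 0.
Proof.
move=> h; have oV : open (~` fsupport phi) by rewrite openC; apply: closed_fsupport.
rewrite (@eq_open_cpartials _ _ _ _ (fun=> 0) oV) //; first exact: cpartials0.
by move=> y; apply: fsupport_out.
Qed.

Lemma fsupport_cpartials phi s : fsupport (cpartials s phi) `<=` fsupport phi.
Proof.
apply: fsupport_sub; first exact: closed_fsupport.
by move=> x h; apply: contrapT => /(cpartials_out s)/eqP; rewrite (negbTE h).
Qed.

Lemma test_smooth U phi : test U phi -> smooth setT phi.
Proof. by case. Qed.

Lemma test_smoothW U V phi : test U phi -> smooth V phi.
Proof. by move=> /test_smooth; apply: smooth_sub. Qed.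

Lemma test_sub U V phi : U `<=` V -> test U phi -> test V phi.
Proof. by move=> UV [h1 h2 h3]; split=> // x /h3/UV. Qed.

(** A product is a test function as soon as one factor is: outside the support
    of that factor the other one need not even be defined. *)
Lemma testM U chi phi : open U -> test U chi -> smooth U phi -> test U (fun x => chi x * phi x).
Proof.
move=> oU [s1 c1 k1] s2.
have sub : fsupport (fun x => chi x * phi x) `<=` fsupport chi.
  by move=> x /fsupportM[].
split; last 2 first.
- exact: subclosed_compact (@closed_fsupport _) c1 sub.
- by move=> x /sub/k1.
apply: smooth_local => x _.
have [kx|nkx] := pselect (fsupport chi x).
  exists U; split=> //; first exact: k1.
  by apply: smoothM => //; apply: smooth_sub s1.
exists (~` fsupport chi); split=> //; first by rewrite openC; exact: closed_fsupport.
have oV : open (~` fsupport chi) by rewrite openC; exact: closed_fsupport.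
apply: (@eq_open_smooth _ _ _ (fun=> 0) _ oV); last by have [] := smooth_cst_cpartials (0 : R[i]) oV.
by move=> y /fsupport_out ->; rewrite mul0r.
Qed.

Lemma testD U phi psi : test U phi -> test U psi -> test U (fun x => phi x + psi x).
Proof.
move=> [s1 c1 k1] [s2 c2 k2].
have sub : fsupport (fun x => phi x + psi x) `<=` fsupport phi `|` fsupport psi.
  apply: fsupport_sub; first by apply: closedU; exact: closed_fsupport.
  move=> x h; apply: contrapT => /not_orP[/fsupport_out e1 /fsupport_out e2].
  by move: h; rewrite e1 e2 addr0 eqxx.
split.
- exact: smoothD openT s1 s2.
- exact: subclosed_compact (@closed_fsupport _) (compactU c1 c2) sub.
- by move=> x /sub[/k1|/k2].
Qed.

Lemma testZ U (z : R[i]) phi : test U phi -> test U (fun x => z * phi x).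
Proof.
move=> [s1 c1 k1].
have sub : fsupport (fun x => z * phi x) `<=` fsupport phi by move=> x /fsupportM[].
split; last 2 first.
- exact: subclosed_compact (@closed_fsupport _) c1 sub.
- by move=> x /sub/k1.
by have [] := smoothZ_cpartials z openT s1.
Qed.

Lemma test0 U : test U (fun=> 0).
Proof.
have e : fsupport (fun=> 0 : R[i]) = set0 :> set vec.
  by rewrite -subset0; apply: fsupport_sub; [exact: closed0|move=> x; rewrite eqxx].
split; rewrite ?e //; last exact: compact0.
by have [] := smooth_cst_cpartials (0 : R[i]) (@openT vec).
Qed.

Lemma test_sum U (I : Type) (r : seq I) (F : I -> cfun) : (forall i, test U (F i)) ->
  test U (fun x => \sum_(i <- r) F i x).
Proof.
move=> h; elim: r => [|i r IH].
  by rewrite (_ : (fun _ => _) = fun=> 0); [exact: test0|apply: funext => x; rewrite big_nil].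
rewrite (_ : (fun _ => _) = fun y => F i y + \sum_(k <- r) F k y); first exact: testD.
by apply: funext => y; rewrite big_cons.
Qed.

Lemma test_cpartials U phi s : test U phi -> test U (cpartials s phi).
Proof.
move=> [s1 c1 k1]; split; first exact: smooth_cpartials.
  exact: subclosed_compact (@closed_fsupport _) c1 (@fsupport_cpartials _ _).
by move=> x /fsupport_cpartials/k1.
Qed.

Lemma smooth_compact_bounded U K phi s : smooth U phi -> compact K -> K `<=` U ->
  exists M, forall x, K x -> normc (cpartials s phi x) <= M.
Proof.
move=> /smoothP sm cK KU.
have aux (f : vec -> R) : (forall x, K x -> {for x, continuous f}) ->
    exists M, forall x, K x -> `|f x| <= M.
  move=> cf; have : compact (f @` K).
    by apply: continuous_compact => //; apply: continuous_in_subspaceT => x; rewrite inE => /cf.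
  move=> /compact_bounded[M [_ h]]; exists (M + 1) => x Kx.
  by apply: h; [rewrite ltrDl|exists x].
have [M1 h1] := aux (repart (cpartials s phi)) (fun x Kx => proj1 (proj1 (sm s x (KU x Kx)))).
have [M2 h2] := aux (impart (cpartials s phi)) (fun x Kx => proj2 (proj1 (sm s x (KU x Kx)))).
exists (M1 + M2) => x Kx.
by apply: le_trans (normc_le_ReIm _) _; apply: lerD; [apply: h1|apply: h2].
Qed.

(** ** The norms of [C^k] *)

(** A pointwise substitute for [Cnorm], which avoids suprema and passes to
    products and derivatives at each point separately. *)
Definition jet_le (k : nat) (M : R) phi x : Prop :=
  forall s, (size s <= k)%N -> normc (cpartials s phi x) <= M.

Lemma jet_leW k k' M M' phi x : (k <= k')%N -> M' <= M -> jet_le k' M' phi x -> jet_le k M phi x.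
Proof. by move=> kk MM h s sk; apply: le_trans MM; apply: h; apply: leq_trans kk. Qed.

Lemma jet_le_ge0 k M phi x : jet_le k M phi x -> 0 <= M.
Proof. by move=> /(_ [::] (leq0n _)); apply: le_trans; apply: normc_ge0. Qed.

Lemma jet_le_cpartials k M phi s x : jet_le (k + size s) M phi x -> jet_le k M (cpartials s phi) x.
Proof. by move=> h t tk; rewrite -cpartials_cat; apply: h; rewrite size_cat leq_add2r. Qed.

(** The Leibniz formula for at most [k] derivations has at most [2 ^ k] terms. *)
Lemma jet_leM U k A B phi psi x : open U -> U x -> smooth U phi -> smooth U psi ->
  jet_le k A phi x -> jet_le k B psi x ->
  jet_le k (2 ^+ k * (A * B)) (fun x => phi x * psi x) x.
Proof.
move=> oU Ux s1 s2 h1 h2 s sk; rewrite (cpartialsM _ oU) //.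
apply: le_trans (normc_sum _ _ _) _.
have A0 := jet_le_ge0 h1; have B0 := jet_le_ge0 h2.
apply: (@le_trans _ _ (\sum_(p <- splits s) A * B)).
  rewrite big_seq [X in _ <= X]big_seq; apply: ler_sum => p /splits_size e.
  rewrite normcM; apply: ler_pM; rewrite ?normc_ge0 //.
    by apply: h1; apply: leq_trans sk; rewrite -e leq_addr.
  by apply: h2; apply: leq_trans sk; rewrite -e leq_addl.
rewrite big_const_seq count_predT size_splits iter_addr_0 -[_ *+ (2 ^ _)]mulr_natl natrX.
by rewrite ler_wpM2r ?mulr_ge0 // ler_weXn2l // ler1n.
Qed.

Lemma jet_leD U k A B phi psi x : open U -> U x -> smooth U phi -> smooth U psi ->
  jet_le k A phi x -> jet_le k B psi x -> jet_le k (A + B) (fun x => phi x + psi x) x.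
Proof.
move=> oU Ux s1 s2 h1 h2 s sk; have [_ ->] := smoothD_cpartials oU s1 s2; last by [].
by apply: le_trans (normcD _ _) (lerD (h1 _ sk) (h2 _ sk)).
Qed.

Lemma jet_leZ U k A z phi x : open U -> U x -> smooth U phi ->
  jet_le k A phi x -> jet_le k (normc z * A) (fun x => z * phi x) x.
Proof.
move=> oU Ux s1 h1 s sk; have [_ ->] := smoothZ_cpartials z oU s1; last by [].
by rewrite normcM ler_wpM2l ?normc_ge0 // h1.
Qed.

Definition midx k (s : seq 'I_d) : multi_index d k :=
  [ffun j => inord (count_mem j s)].

Lemma count_midx k s j : (size s <= k)%N -> mnat (midx k s) j = count_mem j s.
Proof.
move=> sk; rewrite /mnat ffunE inordK // ltnS; apply: leq_trans sk; exact: count_size.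
Qed.

Lemma mdeg_midx k s : (size s <= k)%N -> mdeg (midx k s) = size s.
Proof.
move=> sk; rewrite (perm_size (perm_mlist s)) size_mlist /mdeg.
by apply: eq_bigr => j _; exact: (count_midx j sk).
Qed.

Lemma jet_le_Cnorm U K k phi x : open U -> compact K -> K `<=` U -> smooth U phi -> K x ->
  jet_le k (Cnorm K k phi) phi x.
Proof.
move=> oU cK KU sm Kx s sk.
have nonneg (alpha : multi_index d k) :
    0 <= sup [set normc (dpartial (mnat alpha) phi y) | y in K].
  have [hs|/sup_out->//] := pselect (has_sup [set normc (dpartial (mnat alpha) phi y) | y in K]).
  apply: le_trans (normc_ge0 (dpartial (mnat alpha) phi x)) _.
  by apply: (sup_upper_bound hs); exists x.
rewrite /Cnorm (bigD1 (midx k s)); last by rewrite (mdeg_midx sk); exact: sk.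
apply: le_trans (ler_wpDr _ (lexx _)); last by apply: sumr_ge0 => a _; apply: nonneg.
rewrite (cpartials_dpartial s oU sm (KU x Kx)).
have -> : (fun j => count_mem j s) = mnat (midx k s).
  by apply: funext => j; rewrite count_midx.
apply: ub_le_sup; last by exists x.
have [M hM] := smooth_compact_bounded (mlist (mnat (midx k s))) sm cK KU.
by exists M => _ [y Ky <-]; rewrite dpartialE; apply: hM.
Qed.

Lemma Cnorm_le K k phi M : 0 <= M -> (forall x, K x -> jet_le k M phi x) ->
  Cnorm K k phi <= #|{: multi_index d k}|%:R * M.
Proof.
move=> M0 h.
apply: (@le_trans _ _ (\sum_(alpha : multi_index d k) M)).
  rewrite /Cnorm big_mkcond; apply: ler_sum => alpha _; case: ifP => // ak.
  have [[y yK]|] := pselect ([set normc (dpartial (mnat alpha) phi y) | y in K] !=set0).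
    apply: ge_sup; first by exists y.
    by move=> _ [z Kz <-]; rewrite dpartialE; apply: (h z Kz); rewrite size_mlist; exact: ak.
  by move=> ne; rewrite sup_out // => -[].
by rewrite sumr_const mulr_natl.
Qed.

Lemma test_jet_le U k phi : test U phi -> exists M, forall x, jet_le k M phi x.
Proof.
move=> [sm cK _]; exists `|Cnorm (fsupport phi) k phi| => x.
have [Kx|nKx] := pselect (fsupport phi x); last first.
  by move=> s _; rewrite cpartials_out // normc0.
apply: jet_leW (leqnn k) (ler_norm _) _.
exact: (@jet_le_Cnorm _ _ k _ _ openT cK (@subsetT _ _) sm Kx).
Qed.

Lemma bounded_smoothP U (B : set cfun) : open U -> bounded_smooth U B <->
  B `<=` smooth U /\ forall K k, compact K -> K `<=` U ->
    exists M, forall phi x, B phi -> K x -> jet_le k M phi x.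
Proof.
move=> oU; split=> -[h1 h2]; split=> // K.
  move=> k cK KU.
  have [M hM] := choice (fun a : multi_index d k => h2 K (mnat a) cK KU).
  exists (\sum_a `|M a|) => phi x Bphi Kx s sk.
  rewrite (cpartials_dpartial s oU (h1 _ Bphi) (KU x Kx)).
  have -> : (fun j => count_mem j s) = mnat (midx k s).
    by apply: funext => j; rewrite count_midx.
  apply: le_trans (hM _ _ _ Bphi Kx) _; apply: le_trans (ler_norm _) _.
  by rewrite (bigD1 (midx k s)) //= lerDl sumr_ge0.
move=> alpha cK KU; have [M hM] := h2 K (size (mlist alpha)) cK KU.
by exists M => phi x Bphi Kx; rewrite dpartialE; apply: hM.
Qed.

End TestFunctions.

(** * Distributions *)

Section Distributions.
Variables (R : realType) (d : nat).
Notation vec := 'rV[R]_d.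
Notation cfun := (vec -> R[i]).
Implicit Types (U K : set vec) (u v : cfun -> R[i]) (phi psi chi : cfun).

(** On functions supported in [K] the norm [Cnorm K k] and the best bound of the
    [k]-jets differ at most by the number of multi-indices, so that continuity can
    be tested on jets. *)
Lemma is_distributionP U u : open U -> is_distribution U u <->
  (forall (a : R[i]) phi psi, test U phi -> test U psi ->
     u (fun x => a * phi x + psi x) = a * u phi + u psi) /\
  (forall K, compact K -> K `<=` U -> exists (C : R) (k : nat), 0 <= C /\
     forall phi M, test U phi -> fsupport phi `<=` K ->
       (forall x, jet_le k M phi x) -> normc (u phi) <= C * M).
Proof.
move=> oU; split=> -[h1 h2]; split=> // K cK KU; have := h2 K cK KU.
  move=> [C [k h]]; exists (`|C| * #|{: multi_index d k}|%:R), k; split.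
    exact: mulr_ge0.
  move=> phi M tphi sK jM; apply: le_trans (h phi tphi sK) _.
  have M0 := jet_le_ge0 (jM 0).
  have [Cn|Cn] := lerP 0 (Cnorm K k phi).
    apply: le_trans (ler_wpM2r Cn (ler_norm C)) _.
    by rewrite -mulrA ler_wpM2l // Cnorm_le.
  have K0 : 0 <= Cnorm K k phi.
    apply: sumr_ge0 => alpha _.
    have [hs|/sup_out->//] := pselect (has_sup [set normc (dpartial (mnat alpha) phi y) | y in K]).
    have [[y [z Kz ez]] _] := hs.
    apply: le_trans (normc_ge0 (dpartial (mnat alpha) phi z)) _.
    by apply: (sup_upper_bound hs); exists z.
  by move: (lt_le_trans Cn K0); rewrite ltxx.
move=> [C [k [C0 h]]]; exists C, k => phi tphi sK.
have [sm ck kU] := tphi.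
have [[x Kx]|] := pselect (K !=set0); last first.
  move=> nK; have z : forall x, ~ K x by move=> x Kx; apply: nK; exists x.
  have z' x : phi x = 0 by apply: fsupport_out => /sK/z.
  rewrite [X in _ <= _ * X]/Cnorm big1 ?mulr0 //; last first.
    by move=> alpha _; rewrite sup_out // => -[[w [y Ky _]] _]; exact: (z y Ky).
  have <- : C * 0 = 0 by rewrite mulr0.
  apply: h => // x s _; rewrite cpartials_out ?normc0 //.
  by move=> /sK/z.
apply: h => // y; have [Ky|nKy] := pselect (K y).
  exact: (@jet_le_Cnorm _ _ _ _ k _ _ oU cK KU (smooth_sub (@subsetT _ _) sm) Ky).
move=> s _; rewrite cpartials_out ?normc0; last by move=> /sK.
by apply: (@jet_le_ge0 _ _ k _ phi x); exact: (@jet_le_Cnorm _ _ _ _ k _ _ oU cK KU (smooth_sub (@subsetT _ _) sm) Kx).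
Qed.

Section Linear.
Variables (U : set vec) (u : cfun -> R[i]).
Hypothesis lin : forall (a : R[i]) phi psi, test U phi -> test U psi ->
  u (fun x => a * phi x + psi x) = a * u phi + u psi.

Lemma distr0 : u (fun=> 0) = 0.
Proof.
have := lin (-1) (test0 U) (test0 U).
have -> : (fun x : vec => -1 * (0 : R[i]) + 0) = fun=> 0.
  by apply: funext => x; rewrite mulr0 addr0.
by move=> ->; rewrite mulN1r addNr.
Qed.

Lemma distrZ z phi : test U phi -> u (fun x => z * phi x) = z * u phi.
Proof.
move=> t; have := lin z t (test0 U); rewrite distr0 addr0 => <-; congr u.
by apply: funext => x; rewrite addr0.
Qed.

Lemma distrD phi psi : test U phi -> test U psi -> u (fun x => phi x + psi x) = u phi + u psi.
Proof.
move=> t1 t2; have := lin 1 t1 t2; rewrite mul1r => <-; congr u.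
by apply: funext => x; rewrite mul1r.
Qed.

Lemma distrB phi psi : test U phi -> test U psi -> u (fun x => phi x - psi x) = u phi - u psi.
Proof.
move=> t1 t2; have := lin (-1) t2 t1; rewrite mulN1r addrC => <-; congr u.
by apply: funext => x; rewrite mulN1r addrC.
Qed.

Lemma distr_sum (I : Type) (r : seq I) (c : I -> R[i]) (F : I -> cfun) :
  (forall i, test U (F i)) ->
  u (fun x => \sum_(i <- r) c i * F i x) = \sum_(i <- r) c i * u (F i).
Proof.
move=> t; elim: r => [|i r IH].
  rewrite big_nil -[RHS]distr0; congr u; apply: funext => x; exact: big_nil.
rewrite big_cons -IH -lin //; last by apply: test_sum => k; apply: testZ.
by congr u; apply: funext => x; rewrite big_cons.
Qed.

End Linear.

End Distributions.

(** * A flat bump on the line, with explicit bounds on its derivatives *)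

Section Bump.
Variable R : realType.
Implicit Types (t h : R) (j l n : nat).

Lemma is_derive_near (f g : R -> R) t (l : R) :
  (\forall y \near t, f y = g y) -> is_derive t 1 f l -> is_derive t 1 g l.
Proof.
move=> e [d v].
have e1 : {near t, f =1 g} by apply: filterS e.
apply: DeriveDef; first exact: near_eq_derivable e1 d.
by rewrite -(near_eq_derive _ e1).
Qed.

(** [t^-j exp(-1/t)]: the span of this family is stable under derivation, and
    bounding its members bounds all derivatives of [exp(-1/t)] at once. *)
Definition flat j t : R := if 0 < t then t^-1 ^+ j * expR (- t^-1) else 0.

Lemma flat_le0 j t : t <= 0 -> flat j t = 0.
Proof. by move=> t0; rewrite /flat ltNge t0. Qed.

Lemma flat_ge0 j t : 0 <= flat j t.
Proof.
rewrite /flat; case: ifP => // t0.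
by rewrite mulr_ge0 ?expR_ge0 // exprn_ge0 // invr_ge0 ltW.
Qed.

Lemma flat_gt0 j t : 0 < t -> 0 < flat j t.
Proof. by move=> t0; rewrite /flat t0 mulr_gt0 ?expR_gt0 // exprn_gt0 // invr_gt0. Qed.

(** With [y = 1/t] this is [y ^ j / j! <= exp y]. *)
Lemma flat_le_fact j t : flat j t <= j`!%:R.
Proof.
rewrite /flat; case: ifP => t0; last exact: ler0n.
have y0 : 0 <= t^-1 by rewrite invr_ge0 ltW.
rewrite expRN ler_pdivrMr ?expR_gt0 //.
case: j => [|j].
  by rewrite expr0 fact0 mul1r -expR0 ler_expR.
have := expR_ge1Dxn j y0; rewrite -lerBrDl => h.
have f0 : (0 : R) < j.+1`!%:R by rewrite ltr0n fact_gt0.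
rewrite mulrC -ler_pdivrMr //; apply: le_trans h _.
by rewrite lerBlDr lerDl.
Qed.

Lemma flatS j t : flat j t = t * flat j.+1 t.
Proof.
have [t0|t0] := lerP t 0; first by rewrite !flat_le0 // mulr0.
by rewrite /flat t0 exprS !mulrA divff ?gt_eqF // mul1r.
Qed.

Lemma is_derive_flat j t : is_derive t 1 (flat j) (flat j.+2 t - j%:R * flat j.+1 t).
Proof.
case: (ltrgtP t 0) => [t0|t0|->].
- rewrite !flat_le0 ?ltW // mulr0 subr0.
  apply: (@is_derive_near (fun=> 0) _ _ _ _ (is_derive_cst (0 : R) t 1)).
  near=> y; rewrite flat_le0 //; apply: ltW; near: y; exact: lt_nbhsl.
- have d1 : is_derive t 1 (fun y : R => y^-1) (- t ^- 2).
    have := @is_deriveV R id t 1 1 (lt0r_neq0 t0) (is_derive_id _ _).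
    by rewrite /GRing.scale /= mulr1.
  have d2 : is_derive t 1 (fun y : R => - y^-1) (t ^- 2).
    by have := is_deriveN d1; rewrite opprK.
  have d3 : is_derive t 1 (fun y : R => expR (- y^-1)) (expR (- t^-1) * t ^- 2).
    exact: (@is_derive1_comp R expR (fun y => - y^-1) t).
  have d4 : is_derive t 1 (fun y : R => y^-1 ^+ j) (j%:R * t^-1 ^+ j.-1 * - t ^- 2).
    by have := is_deriveX j d1; rewrite exprfctE.
  have d5 := is_deriveM d4 d3.
  have near_f : \forall y \near t, y^-1 ^+ j * expR (- y^-1) = flat j y.
    by near=> y; rewrite /flat ifT //; near: y; exact: lt_nbhsr.
  apply: (@is_derive_near (fun y : R => y^-1 ^+ j * expR (- y^-1)) _ _ _ near_f).
  apply: is_derive_eq d5 _; rewrite /flat t0 /GRing.scale /=.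
  have -> : t ^- 2 = t^-1 ^+ 2 by rewrite exprVn.
  case: (j) => [|k]; first by rewrite !mul0r mulr0 addr0 subr0 expr0 mul1r mulrC.
  by rewrite /= !exprS; ring.
rewrite !(@flat_le0 _ 0) // mulr0 subr0.
(* at the origin the difference quotient is h * flat j.+2 h *)
have lim : (fun h => h^-1 *: ((flat j \o shift 0) (h *: 1) - flat j 0)) @ 0^' --> (0 : R).
  apply/cvgrPdist_le => e e0.
  have M0 : (0 : R) < j.+2`!%:R by rewrite ltr0n fact_gt0.
  near=> h; have h0 : h != 0 by near: h; exact: nbhs_dnbhs_neq.
  rewrite sub0r normrN /= addr0 [h *: 1]mulr1 (@flat_le0 _ 0) // subr0.
  rewrite -[_ *: _]/(h^-1 * flat j h) flatS mulrA mulVf // mul1r flatS normrM.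
  rewrite (ger0_norm (flat_ge0 _ _)).
  apply: le_trans (ler_wpM2l (normr_ge0 h) (flat_le_fact _ _)) _.
  rewrite -ler_pdivlMr //; near: h.
  apply: (@nbhs_dnbhs R (0 : R)); apply/nbhs_ballP; exists (e / j.+2`!%:R).
    exact: divr_gt0.
  by move=> y; rewrite -ball_normE /= sub0r normrN => /ltW.
split; first by apply/cvg_ex; exists 0.
exact: (cvg_lim (@Rhausdorff R) lim).
Unshelve. all: by end_near. Qed.

(** The [n]-th derivative of [flat j t * flat l (1 - t)], expanded by the rule of
    [is_derive_flat]; for [j = l = 0] it is a bump supported in the unit
    interval. *)
Fixpoint bump n j l : R -> R :=
  if n is n'.+1 then fun t =>
    (bump n' j.+2 l t - j%:R * bump n' j.+1 l t)
    - (bump n' j l.+2 t - l%:R * bump n' j l.+1 t)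
  else fun t => flat j t * flat l (1 - t).

Lemma is_derive_bump n j l t : is_derive t 1 (bump n j l) (bump n.+1 j l t).
Proof.
elim: n j l t => [|n IH] j l t.
  have d1 : is_derive t 1 (fun y : R => 1 - y) (-1).
    have := is_deriveB (is_derive_cst (1 : R) t 1) (is_derive_id t (1 : R)).
    by rewrite sub0r.
  have d2 : is_derive t 1 (fun y : R => flat l (1 - y))
      ((flat l.+2 (1 - t) - l%:R * flat l.+1 (1 - t)) * -1).
    exact: (@is_derive1_comp R (flat l) (fun y => 1 - y) t _ _ (is_derive_flat l (1 - t)) d1).
  apply: is_derive_eq (is_deriveM (is_derive_flat j t) d2) _.
  rewrite /GRing.scale /=; ring.
have sc (c : R) (f : R -> R) (df : R) : is_derive t 1 f df ->
    is_derive t 1 (fun y => c * f y) (c * df) by move=> h; exact: (is_deriveZ c h).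
exact: (is_deriveB (is_deriveB (IH j.+2 l t) (sc j%:R _ _ (IH j.+1 l t)))
                   (is_deriveB (IH j l.+2 t) (sc l%:R _ _ (IH j l.+1 t)))).
Qed.

Lemma bump_out n j l t : t <= 0 \/ 1 <= t -> bump n j l t = 0.
Proof.
move=> h; elim: n j l => [|n IH] j l /=; last by rewrite !IH !mulr0 !subr0.
case: h => h; first by rewrite flat_le0 // mul0r.
by rewrite (@flat_le0 l) ?mulr0 // subr_le0.
Qed.

Lemma leq_fact_add j l : (j`! * l`! <= (j + l)`!)%N.
Proof.
have := bin_fact (leq_addr l j); rewrite addKn => <-.
by rewrite leq_pmull // bin_gt0 leq_addr.
Qed.

(** Each derivation produces four terms and raises [j + l] by at most 2, and the
    integer factors it brings are absorbed by the factorial: the bump is of Gevrey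
    class 2. *)
Lemma bump_le n j l t : `|bump n j l t| <= 4 ^+ n * (j + l + n.*2)`!%:R.
Proof.
elim: n j l => [|n IH] j l.
  rewrite expr0 mul1r addn0 /= ger0_norm ?mulr_ge0 ?flat_ge0 //.
  apply: le_trans (ler_pM (flat_ge0 _ _) (flat_ge0 _ _) (flat_le_fact _ _) (flat_le_fact _ _)) _.
  by rewrite -natrM ler_nat leq_fact_add.
set F := (j + l + n.+1.*2)`!%:R.
have step (k j' l' : nat) : (k <= j + l + n.+1.*2)%N -> (j' + l' = j + l + 1)%N ->
    `|k%:R * bump n j' l' t| <= 4 ^+ n * F.
  move=> kk e; rewrite normrM ger0_norm ?ler0n //.
  apply: le_trans (ler_wpM2l (ler0n _ _) (IH _ _)) _.
  rewrite mulrCA ler_wpM2l ?exprn_ge0 // -natrM ler_nat e.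
  rewrite doubleS [in X in (_ <= X)%N]addnS [in X in (_ <= X)%N]factS [(_ + _.+1)%N in X in (_ <= X)%N]addnS.
  rewrite -addnA add1n addnS; apply: leq_mul => //.
  by move: kk; rewrite doubleS !addnS.
have step2 (j' l' : nat) : (j' + l' = j + l + 2)%N -> `|bump n j' l' t| <= 4 ^+ n * F.
  move=> e; apply: le_trans (IH _ _) _.
  rewrite ler_wpM2l ?exprn_ge0 // ler_nat e doubleS -!addnA.
  by rewrite (_ : (2 + n.*2 = n.*2.+2)%N).
rewrite /=.
have a1 := step2 j.+2 l ltac:(lia).
have a2 := step j j.+1 l ltac:(lia) ltac:(lia).
have a3 := step2 j l.+2 ltac:(lia).
have a4 := step l j l.+1 ltac:(lia) ltac:(lia).
apply: le_trans (ler_normB _ _) _.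
apply: le_trans (lerD (ler_normB _ _) (ler_normB _ _)) _.
rewrite exprS -mulrA; move: a1 a2 a3 a4.
move: (4 ^+ n * F) => X a1 a2 a3 a4.
apply: le_trans (lerD (lerD a1 a2) (lerD a3 a4)) _; lra.
Qed.

Lemma bump_primitive : exists G : R -> R, (forall t, is_derive t 1 G (bump 0 0 0 t)) /\
  forall t, t <= 0 -> G t = 0.
Proof.
pose G t := (\int[lebesgue_measure]_(x in [set` `[-1, t]]) bump 0 0 0 x : R)%R.
have cont t : {for t, continuous (bump 0 0 0)}.
  have [d _] := is_derive_bump 0 0 0 t.
  by apply: differentiable_continuous; apply/derivable1_diffP.
have G0 t : t <= 0 -> G t = 0.
  move=> t0; rewrite /G (_ : Rintegral _ _ _ =
      \int[lebesgue_measure]_(x in [set` `[-1, t]]) (0 : R)).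
    by rewrite Rintegral_cst // mul0r.
  apply: eq_Rintegral => x; rewrite inE => xt; apply: bump_out; left.
  by apply: le_trans t0; move: xt; rewrite /= in_itv /= => /andP[].
exists G; split=> // t.
have [t0|t0] := ltrP t 0.
  rewrite bump_out; last by left; apply: ltW.
  apply: (@is_derive_near (fun=> 0) _ _ _ _ (is_derive_cst (0 : R) t 1)).
  near=> y; rewrite G0 //; apply: ltW; near: y; exact: lt_nbhsl.
have [||||d v] := @continuous_FTC1 R (bump 0 0 0) (BLeft (-1)) t (t + 1).
- by rewrite ltrDl.
- apply: continuous_compact_integrable; first exact: segment_compact.
  by apply: continuous_in_subspaceT => x _; apply: cont.
- by rewrite /Order.lt /=; apply: lt_le_trans t0; rewrite ltrN10.
- exact: cont.
by rewrite derive1E in v; exact: DeriveDef d v.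
Unshelve. all: by end_near. Qed.

(** The plateau is the difference of two translates of a smooth step. *)
Lemma plateau : exists (D : nat -> R -> R) (C : R), [/\ 0 < C,
  forall n t, is_derive t 1 (D n) (D n.+1 t),
  forall t, `|t| <= 1 -> D 0 t = 1,
  forall n t, 2 <= `|t| -> D n t = 0 &
  forall n t, `|D n t| <= C * 4 ^+ n * n.*2`!%:R].
Proof.
have [G [dG G0]] := bump_primitive.
have mvt a b : a < b -> exists2 c, a < c < b & G b - G a = bump 0 0 0 c * (b - a).
  move=> ab; have cG : {within `[a, b], continuous G}.
    by apply: derivable_within_continuous => x _; have [] := dG x.
  have [c] := @MVT R G (bump 0 0 0) a b ab (fun x _ => dG x) cG.
  by rewrite in_itv /= => cab e; exists c.
pose I := G 1.
have I0 : 0 < I.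
  have [c /andP[c0 c1]] := mvt 0 1 ltr01.
  rewrite (G0 0) // !subr0 mulr1 /I => ->; rewrite /= mulr_gt0 // flat_gt0 //.
  by rewrite subr_gt0.
have G1 t : 1 <= t -> G t = I.
  rewrite le_eqVlt => /orP[/eqP<-//|t1]; have [c /andP[c1 _]] := mvt 1 t t1.
  by rewrite bump_out ?mul0r; [move=> /eqP; rewrite subr_eq0 => /eqP|right; apply: ltW].
have bnd c : 0 <= bump 0 0 0 c <= 1.
  rewrite /= mulr_ge0 ?flat_ge0 //=.
  rewrite -[X in _ <= X](mulr1 1); apply: ler_pM; rewrite ?flat_ge0 //.
    exact: (flat_le_fact 0).
  exact: (flat_le_fact 0).
have Gle t : `|G t| <= 1.
  have aux s : 0 < s -> s <= 1 -> `|G s| <= 1.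
    move=> s0 s1; have [c _] := mvt 0 s s0; rewrite (G0 0) // !subr0 => ->.
    have /andP[b0 b1] := bnd c.
    rewrite normrM (ger0_norm b0) (ger0_norm (ltW s0)).
    by apply: mulr_ile1 => //; apply: ltW.
  have [t0|t0] := lerP t 0; first by rewrite G0 // normr0.
  by have [t1|/ltW/G1 ->] := lerP t 1; apply: aux.
pose E n := if n is n'.+1 then bump n' 0 0 else G.
have dE n t : is_derive t 1 (E n) (E n.+1 t).
  by case: n => [|n]; [apply: dG|apply: is_derive_bump].
pose D n t := I^-1 * (E n (t + 2) - E n (t - 1)).
have sh (c : R) n t : is_derive t 1 (fun y => E n (y + c)) (E n.+1 (t + c)).
  have d1 : is_derive t 1 (fun y : R => y + c) 1.
    by have := is_deriveD (is_derive_id t (1 : R)) (is_derive_cst c t 1); rewrite addr0.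
  have := @is_derive1_comp R (E n) (fun y => y + c) t _ _ (dE n (t + c)) d1.
  by rewrite mulr1.
exists D, (2 / I); split.
- exact: divr_gt0.
- by move=> n t; exact: (is_deriveZ I^-1 (is_deriveB (sh 2 n t) (sh (-1) n t))).
- move=> t; rewrite ler_norml => /andP[t1 t2]; rewrite /D /= G1; last by lra.
  by rewrite G0 ?subr0 ?mulVf ?gt_eqF //; lra.
- move=> n t; rewrite /D ler_normr => /orP[t2|t2].
    case: n => [|n]; first by rewrite /= !G1 ?subrr ?mulr0 //; lra.
    by rewrite /= !bump_out ?subrr ?mulr0 //; right; lra.
  case: n => [|n]; first by rewrite /= !G0 ?subrr ?mulr0 //; lra.
  by rewrite /= !bump_out ?subrr ?mulr0 //; left; lra.
move=> n t; rewrite /D normrM gtr0_norm ?invr_gt0 // mulrAC -!mulrA [2 * _]mulrC -!mulrA.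
rewrite ler_pM2l ?invr_gt0 //.
have Ele s : `|E n s| <= 4 ^+ n * n.*2`!%:R.
  case: n => [|n]; first by rewrite expr0 mul1r.
  apply: le_trans (bump_le _ _ _ _) _; apply: ler_pM; rewrite ?exprn_ge0 //.
    by rewrite ler_weXn2l // ler1n.
  by rewrite ler_nat !add0n leq_fact // leq_double.
apply: le_trans (ler_normB _ _) _; apply: le_trans (lerD (Ele _) (Ele _)) _.
by rewrite mulrA [4 ^+ n * _]mulrC; lra.
Qed.

End Bump.

(** * Cut-off functions *)

Section Cutoffs.
Variables (R : realType) (d : nat).
Notation vec := 'rV[R]_d.
Notation cfun := (vec -> R[i]).
Notation e_ := (unit_vec R).
Implicit Types (U K : set vec) (x y : vec) (s : seq 'I_d) (phi psi chi : cfun).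

Lemma is_derive_tensor (f : 'I_d -> R -> R) (j : 'I_d) x (l : R) :
  is_derive (x ord0 j) 1 (f j) l ->
  is_derive x (e_ j) (fun y => \prod_i f i (y ord0 i))
    (l * \prod_(i | i != j) f i (x ord0 i)).
Proof.
set c := \prod_(i | _) _ => D.
have := is_deriveZ c D => -[d1 v1].
have e : (fun h : R => h^-1 *: (((fun y => \prod_i f i (y ord0 i)) \o shift x) (h *: e_ j)
        - \prod_i f i (x ord0 i)))
    = (fun h : R => h^-1 *: (((c \*: f j) \o shift (x ord0 j)) (h *: 1) - (c \*: f j) (x ord0 j))).
  apply: funext => h; congr (_ *: (_ - _)).
    rewrite /= (bigD1 j) //= mulrC; congr (_ * f j _).
      apply: eq_bigr => i ij; congr (f i _).
      by rewrite /unit_vec !mxE (negbTE ij) andbF mulr0 add0r.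
    by rewrite /unit_vec !mxE !eqxx.
  by rewrite /= (bigD1 j) //= mulrC.
apply: DeriveDef; first by rewrite /derivable e.
by rewrite /derive e -[RHS]mulrC -[c * l]/(c *: l) -v1.
Qed.

Lemma continuous_tensor (f : 'I_d -> R -> R) x : (forall i t, {for t, continuous (f i)}) ->
  {for x, continuous (fun y : vec => \prod_i f i (y ord0 i))}.
Proof.
move=> cf; rewrite /index_enum; elim: (Finite.enum _) => [|i r IH].
  rewrite (_ : (fun _ => _) = cst 1); first exact: cst_continuous.
  by apply: funext => y; rewrite big_nil.
rewrite (_ : (fun _ => _) = (fun y : vec => f i (y ord0 i)) *
    (fun y => \prod_(k <- r) f k (y ord0 k))); last first.
  by apply: funext => y; rewrite big_cons.
apply: continuousM; last exact: IH.
apply: (@continuous_comp _ _ _ (fun y : vec => y ord0 i) (f i)); last exact: cf.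
exact: coord_continuous.
Qed.

(** In a tensor product only the number of derivations along each axis matters. *)
Lemma smooth_tensor (D : nat -> 'I_d -> R -> R) :
  (forall n i (t : R), is_derive t 1 (D n i) (D n.+1 i t)) ->
  smooth setT (fun x : vec => (\prod_i D 0 i (x ord0 i))%:C) /\
  forall s x, cpartials s (fun x : vec => (\prod_i D 0 i (x ord0 i))%:C) x =
    (\prod_i D (count_mem i s) i (x ord0 i))%:C.
Proof.
move=> dD.
have cD n i (t : R) : {for t, continuous (D n i)}.
  by have [h _] := dD n i t; apply: differentiable_continuous; apply/derivable1_diffP.
suff [h1 h2] : smooth setT (fun x : vec => (\prod_i D 0 i (x ord0 i))%:C) /\
  forall s x, setT x -> cpartials s (fun x : vec => (\prod_i D 0 i (x ord0 i))%:C) x =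
    (\prod_i D (count_mem i s) i (x ord0 i))%:C by split=> // s x; apply: h2.
apply: (@smooth_family _ _ _ _
  (fun s x => (\prod_i D (count_mem i s) i (x ord0 i))%:C) openT) => // s x _.
split.
  split; last exact: cst_continuous.
  exact: (@continuous_tensor (fun i => D (count_mem i s) i)).
move=> j; split; last exact: is_derive_cst.
have := @is_derive_tensor (fun i => D (count_mem i s) i) j x _ (dD (count_mem j s) j (x ord0 j)).
rewrite [complex.Re _](_ : _ = D (count_mem j s).+1 j (x ord0 j) *
  \prod_(i | i != j) D (count_mem i s) i (x ord0 i)) // (bigD1 j) //=.
rewrite eqxx add1n; congr (_ * _); apply: eq_bigr => i ij.
by rewrite eq_sym (negbTE ij).
Qed.

Lemma closed_cube x (r : R) : closed [set y : vec | `|y - x| <= r].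
Proof.
have -> : [set y : vec | `|y - x| <= r] = (fun y => `|y - x|) @^-1` [set t | t <= r] by [].
apply: closed_comp; last exact: closed_le.
move=> y _; apply: (@continuous_comp _ _ _ (fun y : vec => y - x) (@Num.norm R vec)).
  by apply: continuousB; [exact: cvg_id|exact: cst_continuous].
exact: norm_continuous.
Qed.

Lemma compact_cube x (r : R) : compact [set y : vec | `|y - x| <= r].
Proof.
apply: bounded_closed_compact; last exact: closed_cube.
exists (r + `|x|); split; first exact: num_real.
move=> M hM y /= yr; apply: ltW; apply: le_lt_trans hM.
by have := ler_normD (y - x) x; rewrite subrK => /le_trans; apply; rewrite lerD2r.
Qed.

Lemma prod_fact_le (I : Type) (r : seq I) (F : I -> nat) :
  (\prod_(i <- r) (F i).*2`! <= (\sum_(i <- r) F i).*2`!)%N.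
Proof.
elim: r => [|i r IH]; first by rewrite !big_nil.
rewrite !big_cons doubleD; apply: leq_trans (leq_fact_add _ _).
by rewrite leq_mul2l IH orbT.
Qed.

(** A tensor product of rescaled plateaus, equal to 1 on a cube and supported in
    the concentric one of double size.  It inherits the Gevrey bounds of
    [plateau], because [(2k)! (2l)! <= (2(k + l))!]. *)
Lemma cutoff_cube x (r : R) : 0 < r -> exists chi : cfun, [/\ smooth setT chi,
  forall y, chi y != 0 -> `|y - x| <= 2 * r,
  forall y, `|y - x| <= r -> chi y = 1 &
  exists C b : R, [/\ 0 < C, 1 <= b & forall k y, jet_le k (C * b ^+ k * k.*2`!%:R) chi y]].
Proof.
move=> r0; have [D [C [C0 dD D1 D2 Db]]] := plateau R.
pose E n i t : R := r^-1 ^+ n * D n ((t - x ord0 i) / r).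
have dE n i (t : R) : is_derive t 1 (E n i) (E n.+1 i t).
  have d1 : is_derive t 1 (fun y : R => (y - x ord0 i) / r) r^-1.
    have := is_deriveZ r^-1 (is_deriveB (is_derive_id t (1 : R)) (is_derive_cst (x ord0 i) t 1)).
    rewrite subr0 [_ *: _]mulr1 => h.
    rewrite (_ : (fun _ => _) = r^-1 \*: (id - cst (x ord0 i))) //.
    by apply: funext => z; rewrite mulrC.
  have := is_deriveZ (r^-1 ^+ n)
    (@is_derive1_comp R (D n) (fun z : R => (z - x ord0 i) / r) t _ _ (dD n ((t - x ord0 i) / r)) d1).
  rewrite /E exprSr -mulrA [r^-1 * _]mulrC; exact.
have [sm cp] := smooth_tensor dE.
exists (fun y => (\prod_i E 0 i (y ord0 i))%:C); split=> //.
- move=> y; apply: contraNT; rewrite -ltNge => ry.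
  suff [i hi] : exists i, 2 * r < `|(y - x) ord0 i|.
    rewrite (bigD1 i) //= {1}/E D2 ?mulr0 ?mul0r //.
    rewrite normrM (gtr0_norm (x := r^-1)) ?invr_gt0 // ler_pdivlMr // ltW //.
    by move: hi; rewrite !mxE.
  apply: contrapT => /forallNP h.
  have : `|y - x| <= 2 * r.
    by apply/rv_norm_leP => [|i]; [rewrite mulr_ge0 // ltW|rewrite leNgt; apply/negP/h].
  by rewrite leNgt ry.
- move=> y yr; rewrite big1 // => i _; rewrite /E expr0 mul1r D1 //.
  rewrite normrM (gtr0_norm (x := r^-1)) ?invr_gt0 // ler_pdivrMr // mul1r.
  by apply: le_trans yr; have := norm_coord (y - x) i; rewrite !mxE.
have C1 : 1 <= C.
  by have := Db 0 0; rewrite D1 ?normr0 // normr1 expr0 !mulr1.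
pose b := Num.max 1 (4 / r).
have b1 : 1 <= b by rewrite /b le_max lexx.
exists (C ^+ d), b; split=> //; first exact: exprn_gt0.
move=> k y s sk; rewrite cp normc_real normr_prod.
have Eb n i t : `|E n i t| <= C * b ^+ n * n.*2`!%:R.
  rewrite /E normrM ger0_norm ?exprn_ge0 ?invr_ge0 ?(ltW r0) //.
  apply: le_trans (ler_wpM2l _ (Db _ _)) _; first by rewrite exprn_ge0 // invr_ge0 ltW.
  rewrite mulrA ler_wpM2r ?ler0n // mulrCA ler_wpM2l ?(ltW C0) // -exprMn.
  rewrite lerXn2r ?nnegrE ?mulr_ge0 ?invr_ge0 ?(ltW r0) //; last first.
    by rewrite /b le_max [r^-1 * 4]mulrC lexx orbT.
  by apply: le_trans b1.
apply: (@le_trans _ _ (\prod_(i < d) (C * b ^+ count_mem i s * (count_mem i s).*2`!%:R))).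
  by apply: ler_prod => i _; rewrite normr_ge0 Eb.
rewrite !big_split /= prodr_const card_ord -!mulrA ler_wpM2l ?exprn_ge0 ?(ltW C0) //.
rewrite -expr_sum -natr_prod.
have sz : (\sum_(i < d) count_mem i s = size s)%N.
  by rewrite (perm_size (perm_mlist s)) size_mlist.
apply: ler_pM; rewrite ?exprn_ge0 ?ler0n ?(le_trans _ b1) //.
  by rewrite sz ler_weXn2l.
rewrite ler_nat; apply: leq_trans (prod_fact_le _ _) _.
by rewrite sz; apply: leq_fact; rewrite leq_double.
Qed.

Lemma test_cube chi x (r : R) : smooth setT chi -> (forall y, chi y != 0 -> `|y - x| <= r) ->
  test [set y | `|y - x| <= r] chi.
Proof.
move=> sm h.
have sub : fsupport chi `<=` [set y | `|y - x| <= r] by apply: fsupport_sub; [exact: closed_cube|exact: h].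
split=> //; exact: subclosed_compact (@closed_fsupport _ _ _) (@compact_cube x r) sub.
Qed.

(** Cubes covering [K] are glued by [1 - chi := (1 - chi1) (1 - chi2)]. *)
Lemma cutoff_compact U K : open U -> compact K -> K `<=` U ->
  exists2 chi, test U chi & exists2 W, open W & K `<=` W /\ forall x, W x -> chi x = 1.
Proof.
move=> oU cK KU.
have loc (x : vec) : exists r : R, U x -> 0 < r /\ [set y | `|y - x| <= 2 * r] `<=` U.
  have [Ux|nUx] := pselect (U x); last by exists 0.
  have /nbhs_ballP[r /= r0 rU] := open_nbhs_nbhs (conj oU Ux).
  exists (r / 4) => _; split; first exact: divr_gt0.
  move=> y /= h; apply: rU; rewrite -ball_normE /= distrC; apply: le_lt_trans h _; lra.
have [r rP] := choice loc.
have [D' sub KD] : finite_subset_cover U (fun x : vec => ball x (r x)) K.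
  have := cK; rewrite compact_cover; apply.
    move=> x _; exact: ball_open.
  by move=> x /KU Ux; exists x => //; apply: ballxx; exact: (proj1 (rP x Ux)).
suff [chi tc [W oW [DW W1]]] : exists2 chi, test U chi & exists2 W, open W &
    (forall x, x \in (finmap.enum_fset D') -> ball x (r x) `<=` W) /\ forall x, W x -> chi x = 1.
  exists chi => //; exists W => //; split=> // x /KD[y yD]; exact: DW.
have {sub KD} : forall x, x \in finmap.enum_fset D' -> U x by move=> x /sub; rewrite inE.
elim: (finmap.enum_fset D') => [_|x l IH Ul].
  by exists (fun=> 0); [exact: test0|exists set0; [exact: open0|split]].
have [z zl|chi tc [W oW [lW W1]]] := IH; first by apply: Ul; rewrite inE zl orbT.
have [r0 rU] := rP x (Ul x (mem_head _ _)).
have [eta [sm s0 s1 _]] := cutoff_cube x r0.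
have te : test U eta by apply: test_sub (test_cube sm s0).
exists (fun y => (chi y + eta y) + -1 * (chi y * eta y)).
  apply: testD; first exact: testD.
  by apply: testZ; apply: testM => //; apply: test_smoothW te.
exists (W `|` ball x (r x)); first by apply: openU => //; exact: ball_open.
split=> y.
  by rewrite inE => /orP[/eqP-> z hz|/lW hW z /hW hz]; [right|left].
move=> [/W1->|yx]; first by rewrite mul1r mulN1r addrK.
rewrite s1; first by rewrite mulr1 mulN1r addrC addKr.
by move: yx; rewrite -ball_normE /= distrC => /ltW.
Qed.

End Cutoffs.

(** * Compactly supported distributions and their Fourier transforms *)

Section CompactSupport.
Variables (R : realType) (d : nat).
Notation vec := 'rV[R]_d.
Notation cfun := (vec -> R[i]).
Implicit Types (U K W : set vec) (x : vec) (phi psi chi : cfun).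
Implicit Types (v : cfun -> R[i]).

Definition linear_on U v := forall (a : R[i]) phi psi, test U phi -> test U psi ->
  v (fun x => a * phi x + psi x) = a * v phi + v psi.

Lemma eq_on_support U K W v phi psi : linear_on U v -> supported_in U K v ->
  open W -> K `<=` W -> test U phi -> test U psi -> (forall x, W x -> phi x = psi x) ->
  v phi = v psi.
Proof.
move=> lin sv oW KW t1 t2 e; apply/eqP; rewrite -subr_eq0 -(distrB lin) //; apply/eqP.
have t3 : test U (fun x => phi x - psi x).
  rewrite (_ : (fun _ => _) = fun x => phi x + -1 * psi x); first by apply: testD => //; apply: testZ.
  by apply: funext => x; rewrite mulN1r.
apply: sv => //; rewrite -subset0 => x [sx /KW Wx].
have cW : closed (~` W) by rewrite closedC.
have : (~` W) x; last by [].
apply: (fsupport_sub cW _ sx) => y ne Wy; by move: ne; rewrite e // subrr eqxx.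
Qed.

Lemma cutoff_test U K v chi W phi : open U -> linear_on U v -> supported_in U K v -> test U chi ->
  open W -> K `<=` W -> (forall x, W x -> chi x = 1) -> test U phi ->
  v (fun x => chi x * phi x) = v phi.
Proof.
move=> oU lin sv tc oW KW W1 tp.
apply: (eq_on_support lin sv oW KW) => //; first by apply: testM => //; apply: test_smoothW tp.
by move=> x /W1->; rewrite mul1r.
Qed.

(** Two admissible cut-offs give the same value, since each may be inserted into
    the value given by the other; hence the pairing may be computed with any. *)
Lemma pairingE U K W v chi phi : open U -> linear_on U v -> compact K -> K `<=` U ->
  supported_in U K v -> test U chi -> open W -> K `<=` W -> (forall x, W x -> chi x = 1) ->
  smooth U phi -> pairing U v phi = v (fun x => chi x * phi x).
Proof.
move=> oU lin cK KU sv tc oW KW W1 sm; rewrite /pairing.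
apply: xget_subset1.
  by exists K, chi; split=> //; split=> //; exists W.
move=> z1 z2 [K1 [c1 [cK1 KU1 sv1 t1 [[W1' oW1 [KW1 h1]] ->]]]]
       [K2 [c2 [cK2 KU2 sv2 t2 [[W2 oW2 [KW2 h2]] ->]]]].
rewrite -(cutoff_test oU lin sv2 t2 oW2 KW2 h2); last exact: testM.
rewrite -(cutoff_test oU lin sv1 t1 oW1 KW1 h1 (testM oU t2 sm)).
by congr v; apply: funext => x; rewrite mulrCA.
Qed.

Lemma compact_cutoff U v : open U -> compact_distribution U v ->
  exists chi, [/\ test U chi, forall phi, smooth U phi -> pairing U v phi = v (fun x => chi x * phi x) &
    forall phi psi, test U phi -> test U psi -> (forall x, chi x = 1 -> phi x = psi x) -> v phi = v psi].
Proof.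
move=> oU [[lin _] [K [cK KU sv]]].
have [chi tc [W oW [KW W1]]] := cutoff_compact oU cK KU.
exists chi; split=> //.
  by move=> phi sm; apply: (pairingE oU lin cK KU sv tc oW KW W1 sm).
move=> phi psi t1 t2 e; apply: (eq_on_support lin sv oW KW t1 t2) => x Wx.
by apply: e; apply: W1.
Qed.

Lemma pairing_test U v phi : open U -> compact_distribution U v -> test U phi ->
  pairing U v phi = v phi.
Proof.
move=> oU cv tp; have [chi [tc pE e]] := compact_cutoff oU cv.
rewrite pE; last exact: test_smoothW tp.
by apply: e => //; [apply: testM => //; exact: test_smoothW tp|move=> x ->; rewrite mul1r].
Qed.

Lemma pairingZ U v (z : R[i]) phi : open U -> compact_distribution U v -> smooth U phi ->
  pairing U v (fun x => z * phi x) = z * pairing U v phi.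
Proof.
move=> oU cv sm; have [chi [tc pE _]] := compact_cutoff oU cv.
have [[lin _] _] := cv.
rewrite !pE //; last by have [] := smoothZ_cpartials z oU sm.
rewrite -(distrZ lin); last exact: testM.
by congr v; apply: funext => x; rewrite mulrCA.
Qed.

(** Otherwise, scaling test functions supported ever farther out gives a bounded
    set of smooth functions on which the distributions are unbounded. *)
Lemma bounded_common_support U (u_ : nat -> cfun -> R[i]) : open U ->
  (forall N, compact_distribution U (u_ N)) -> bounded_compact_distributions U u_ ->
  exists rho : R, forall N phi, test U phi -> (forall x, `|x| <= rho -> phi x = 0) -> u_ N phi = 0.
Proof.
move=> oU cu bu; apply: contrapT => /forallNP H.
have {}H (k : nat) : exists p : nat * cfun,
    [/\ test U p.2, forall x, `|x| <= k%:R -> p.2 x = 0 & u_ p.1 p.2 != 0].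
  apply: contrapT => /forallNP h; apply: (H k%:R) => N phi t z.
  by apply: contrapT => /eqP ne; apply: (h (N, phi)).
have [p hp] := choice H.
pose z k : R[i] := (k%:R / normc (u_ (p k).1 (p k).2))%:C.
pose B : set cfun := [set psi | exists k, psi = fun x => z k * (p k).2 x].
have [|M hM] := bu B.
  apply/(bounded_smoothP _ oU); split.
    move=> _ [k ->]; have [t _ _] := hp k; apply: test_smoothW; exact: testZ t.
  move=> K n cK KU; have [M [_ KM]] := compact_bounded cK.
  pose m := Num.bound `|M + 1|.
  have [b hb] := choice (fun k => test_jet_le n (let: And3 t _ _ := hp k in testZ (z k) t)).
  exists (\sum_(k < m.+1) `|b k|) => _ x [k ->] Kx.
  have [km|km] := ltnP k m.+1.
    apply: jet_leW (leqnn n) _ (hb k x); apply: le_trans (ler_norm _) _.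
    by rewrite (bigD1 (Ordinal km)) //= lerDl sumr_ge0.
  move=> s _; rewrite cpartials_out ?normc0 ?sumr_ge0 //.
  have [t out _] := hp k.
  have xm : `|x| <= M + 1 by apply: KM => //; rewrite ltrDl.
  have mk : M + 1 < m%:R.
    by apply: le_lt_trans (ler_norm _) _; apply: archi_boundP; exact: normr_ge0.
  have cF : closed (~` [set y : vec | `|y| < k%:R]).
    rewrite closedC; have -> : [set y : vec | `|y| < k%:R] = ball (0 : vec) k%:R.
      by apply/seteqP; split=> y; rewrite -ball_normE /= sub0r normrN.
    exact: ball_open.
  move=> sx; apply: (fsupport_sub cF _ sx) => [y|].
    move=> ne /ltW/out e; move: ne; by rewrite e mulr0 eqxx.
  rewrite /=; apply: le_lt_trans xm _; apply: lt_le_trans mk _.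
  by rewrite ler_nat ltnW.
pose k := Num.bound `|M|.
have [t _ ne] := hp k.
have /= := hM (p k).1 _ (ex_intro _ k erefl).
rewrite pairingZ //; last exact: test_smoothW t.
rewrite pairing_test // normcM /z normc_real ger0_norm ?divr_ge0 ?normc_ge0 //.
rewrite divfK ?normc_eq0 // leNgt.
rewrite (le_lt_trans (ler_norm M)) //; apply: archi_boundP; exact: normr_ge0.
Qed.

(** ** Characters *)

(** The factor by which the derivation [j] multiplies a character. *)
Definition zeta (xi : vec) (j : 'I_d) : R[i] := 0 -i* (2 * pi * xi ord0 j).

Definition zpow xi (s : seq 'I_d) : R[i] := \prod_(j <- s) zeta xi j.

Lemma is_derive_of_line (f : vec -> R) x (v : vec) (l : R) :
  is_derive (0 : R) 1 (fun h => f (h *: v + x)) l -> is_derive x v f l.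
Proof.
move=> [h1 h2].
have e : (fun h : R => h^-1 *: (((fun h => f (h *: v + x)) \o shift 0) (h *: 1) - f (0 *: v + x)))
       = (fun h : R => h^-1 *: ((f \o shift x) (h *: v) - f x)).
  apply: funext => h; congr (_ *: (f _ - f _)) => /=.
    by rewrite [h *: 1]mulr1 addr0.
  by rewrite scale0r add0r.
by split; [move: h1; rewrite /derivable e|move: h2; rewrite /derive e].
Qed.

Lemma is_partial_character xi j x :
  is_partial j (character xi) x (zeta xi j * character xi x).
Proof.
have dotE h : 2 * pi * dot (h *: unit_vec R j + x) xi = h * (2 * pi * xi ord0 j) + 2 * pi * dot x xi.
  rewrite /dot mulrCA -mulrDr; congr (_ * _).
  rewrite (bigD1 j) //= [X in _ = _ + X](bigD1 j) //= addrA; congr (_ + _).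
    by rewrite /unit_vec !mxE !eqxx /= mulr1 mulrDl.
  by apply: eq_bigr => i ij; rewrite /unit_vec !mxE (negbTE ij) andbF mulr0 add0r.
set c := 2 * pi * xi ord0 j in dotE *.
have dl : is_derive (0 : R) 1 (fun h => h * c + 2 * pi * dot x xi) c.
  have := is_deriveD (is_deriveZ c (is_derive_id (0 : R) (1 : R)))
    (is_derive_cst (2 * pi * dot x xi) (0 : R) 1).
  rewrite addr0 [_ *: _]mulr1 => h.
  suff <- : c \*: id + cst (2 * pi * dot x xi) = fun h => h * c + 2 * pi * dot x xi by [].
  by apply: funext => y; rewrite [y * c]mulrC.
have e0 : 0 * c + 2 * pi * dot x xi = 2 * pi * dot x xi by rewrite mul0r add0r.
split; apply: is_derive_of_line.
  rewrite (_ : (fun h => _) = cos \o (fun h => h * c + 2 * pi * dot x xi)); last first.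
    by apply: funext => h; rewrite /repart /= dotE.
  have dc := is_derive_cos (0 * c + 2 * pi * dot x xi).
  have dcl := @is_derive1_comp R cos (fun h => h * c + 2 * pi * dot x xi) 0 _ _ dc dl.
  apply: is_derive_eq dcl _.
  by rewrite e0 ReM /= -/c; ring.
rewrite (_ : (fun h => _) = - (sin \o (fun h => h * c + 2 * pi * dot x xi))); last first.
  by apply: funext => h; rewrite /impart /= dotE.
have ds := is_derive_sin (0 * c + 2 * pi * dot x xi).
have dsl := @is_derive1_comp R sin (fun h => h * c + 2 * pi * dot x xi) 0 _ _ ds dl.
apply: is_derive_eq (is_deriveN dsl) _.
by rewrite e0 ImM /= -/c; ring.
Qed.

Lemma ccontinuous_character xi x : ccontinuous (character xi) x.
Proof.
have cd : {for x, continuous (fun y : vec => 2 * pi * dot y xi)}.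
  apply: (@continuousM _ _ (cst (2 * pi)) (fun y => dot y xi)); first exact: cst_continuous.
  rewrite /dot /index_enum; elim: (Finite.enum _) => [|i r IH].
    rewrite (_ : (fun _ => _) = cst 0); first exact: cst_continuous.
    by apply: funext => y; rewrite big_nil.
  rewrite (_ : (fun _ => _) = (fun y : vec => y ord0 i * xi ord0 i) +
      (fun y => \sum_(k <- r) y ord0 k * xi ord0 k)); last first.
    by apply: funext => y; rewrite big_cons.
  apply: continuousD; last exact: IH.
  apply: (@continuousM _ _ (fun y : vec => y ord0 i) (cst (xi ord0 i))); last exact: cst_continuous.
  exact: coord_continuous.
split.
  by apply: (continuous_comp cd); exact: continuous_cos.
apply: continuousN.
by apply: (continuous_comp cd); exact: continuous_sin.
Qed.

Lemma smooth_character_cpartials xi : smooth setT (character xi) /\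
  forall s x, setT x -> cpartials s (character xi) x = zpow xi s * character xi x.
Proof.
apply: (@smooth_family _ _ _ _ (fun s x => zpow xi s * character xi x) openT).
  by apply: funext => x; rewrite /zpow big_nil mul1r.
move=> s x _; split.
  by apply: ccontinuousM; [exact: ccontinuous_cst|exact: ccontinuous_character].
move=> j; have := is_partialM (is_partial_cst j (zpow xi s) x) (is_partial_character xi j x).
by rewrite mul0r add0r /zpow big_cons mulrA [_ * zeta _ _]mulrC.
Qed.

Lemma smooth_character U xi : smooth U (character xi).
Proof. by have [h _] := smooth_character_cpartials xi; apply: smooth_sub h. Qed.

Lemma cpartials_character xi s x : cpartials s (character xi) x = zpow xi s * character xi x.
Proof. by have [_ ->] := smooth_character_cpartials xi. Qed.

Lemma normc_character xi x : normc (character xi x) = 1.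
Proof. by rewrite /= sqrrN cos2Dsin2 sqrtr1. Qed.

Lemma characterD xi eta x : character (xi + eta) x = character xi x * character eta x.
Proof.
have -> : character (xi + eta) x = cos (2 * pi * dot x xi + 2 * pi * dot x eta)
    -i* sin (2 * pi * dot x xi + 2 * pi * dot x eta).
  rewrite /character -mulrDr (_ : dot x (xi + eta) = dot x xi + dot x eta) //.
  by rewrite /dot -big_split; apply: eq_bigr => i _; rewrite mxE mulrDr.
rewrite cosD sinD; apply/eqP; rewrite eq_complex /=; apply/andP; split; apply/eqP; ring.
Qed.

Lemma normc_zpow xi s : normc (zpow xi s) <= (2 * pi * `|xi|) ^+ size s.
Proof.
have p0 := @pi_ge0 R.
rewrite /zpow normc_prod; elim: s => [|j s IH]; first by rewrite big_nil.
rewrite big_cons exprS; apply: ler_pM; rewrite ?normc_ge0 ?prodr_ge0 //.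
  by move=> i _; apply: normc_ge0.
rewrite /zeta /= expr0n add0r sqrrN sqrtr_sqr normrM (ger0_norm (x := 2 * pi)) ?mulr_ge0 //.
by rewrite ler_wpM2l ?mulr_ge0 // norm_coord.
Qed.

Lemma jet_le_character k xi x : jet_le k ((1 + 2 * pi * `|xi|) ^+ k) (character xi) x.
Proof.
have p0 : 0 <= 2 * pi * `|xi| by rewrite !mulr_ge0 // pi_ge0.
move=> s sk; rewrite cpartials_character normcM normc_character mulr1.
apply: le_trans (normc_zpow xi s) _; apply: (@le_trans _ _ ((1 + 2 * pi * `|xi|) ^+ size s)).
  by rewrite lerXn2r ?nnegrE ?lerDr // addr_ge0.
by rewrite ler_weXn2l // lerDl.
Qed.

(** Normalising a character by a power of its frequency keeps its derivatives
    bounded up to the order of that power; letting the powers grow gives a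
    bounded set, on which a failure of every polynomial bound is seen. *)
Lemma bounded_fourier U (u_ : nat -> cfun -> R[i]) : open U ->
  (forall N, compact_distribution U (u_ N)) -> bounded_compact_distributions U u_ ->
  exists k : nat, forall N xi, normc (fourier U (u_ N) xi) <= k%:R * (1 + 2 * pi * `|xi|) ^+ k.
Proof.
move=> oU cu bu; apply: contrapT => /forallNP H.
have {}H (k : nat) : exists p : nat * vec,
    k%:R * (1 + 2 * pi * `|p.2|) ^+ k < normc (fourier U (u_ p.1) p.2).
  apply: contrapT => /forallNP h; apply: (H k) => N xi.
  by rewrite leNgt; apply/negP; exact: (h (N, xi)).
have [p hp] := choice H.
have w1 (xi : vec) : 1 <= 1 + 2 * pi * `|xi| by rewrite lerDl !mulr_ge0 // pi_ge0.
have w0 (xi : vec) : 0 < 1 + 2 * pi * `|xi| by apply: lt_le_trans (w1 xi).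
pose z k : R[i] := ((1 + 2 * pi * `|(p k).2|) ^- k)%:C.
pose B : set cfun := [set psi | exists k, psi = fun x => z k * character (p k).2 x].
have zn k : normc (z k) = (1 + 2 * pi * `|(p k).2|) ^- k.
  by rewrite normc_real ger0_norm // invr_ge0 exprn_ge0 // ltW.
have [|M hM] := bu B.
  apply/(bounded_smoothP _ oU); split.
    by move=> _ [k ->]; have [] := smoothZ_cpartials (z k) oU (@smooth_character U (p k).2).
  move=> K n cK KU.
  exists (1 + \sum_(k < n) normc (z k) * (1 + 2 * pi * `|(p k).2|) ^+ n) => _ x [k ->] Kx.
  have jl : jet_le n (normc (z k) * (1 + 2 * pi * `|(p k).2|) ^+ n)
      (fun x => z k * character (p k).2 x) x.
    by apply: (jet_leZ _ openT) => //; [exact: smooth_character|exact: jet_le_character].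
  have pos (i : 'I_n) : 0 <= normc (z i) * (1 + 2 * pi * `|(p i).2|) ^+ n.
    by rewrite mulr_ge0 ?normc_ge0 // exprn_ge0 // ltW.
  have [kn|kn] := ltnP k n.
    apply: jet_leW (leqnn n) _ jl; rewrite (bigD1 (Ordinal kn)) //=.
    by rewrite addrCA lerDl addr_ge0 // sumr_ge0 // => i _; exact: pos.
  apply: jet_leW (leqnn n) _ jl; apply: (@le_trans _ _ 1); last first.
    by rewrite lerDl sumr_ge0 // => i _; exact: pos.
  by rewrite zn mulrC ler_pdivrMr ?exprn_gt0 // mul1r ler_weXn2l.
pose k := Num.bound `|M|.
have /= := hM (p k).1 _ (ex_intro _ k erefl).
rewrite pairingZ //; last exact: smooth_character.
rewrite normcM zn mulrC leNgt; apply/negP; rewrite negbK.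
rewrite ltr_pdivlMr ?exprn_gt0 //; apply: le_lt_trans (hp k).
rewrite ler_wpM2r ?exprn_ge0 // ?ltW //.
apply: le_lt_trans (ler_norm M) _; apply: archi_boundP; exact: normr_ge0.
Qed.

End CompactSupport.

(** * Growth of the factorial weights *)

Section Growth.
Variable R : realType.
Implicit Types (x y h sigma rho : R) (m n k N : nat).

(** The exponent of the frequency paired with the index [N]. *)
Definition order_of sigma N : nat := Num.truncn (N%:R `^ sigma^-1 : R).

Lemma order_of0 sigma : 1 < sigma -> order_of sigma 0 = 0%N.
Proof.
by move=> s1; rewrite /order_of powR0 ?invr_eq0 ?gt_eqF ?(lt_trans ltr01).
Qed.

Lemma order_of_le sigma N : 1 < sigma -> (order_of sigma N <= N)%N.
Proof.
move=> s1; case: N => [|N]; first by rewrite order_of0.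
rewrite -(ler_nat R); apply: (@le_trans _ _ (N.+1%:R `^ sigma^-1)).
  by rewrite truncn_le powR_ge0.
by apply: ler1_powR; rewrite ?ler1n // invf_le1 ?ltW // (lt_trans ltr01).
Qed.

Lemma order_of_root sigma N : 1 < sigma -> (0 < N)%N -> let x : R := N%:R `^ sigma^-1 in
  [/\ 1 <= x, x <= N%:R, x `^ sigma = N%:R & (order_of sigma N)%:R <= x].
Proof.
move=> s1 N0 x; have s0 : 0 < sigma by apply: lt_trans s1.
have N1 : (1 : R) <= N%:R by rewrite ler1n.
split.
- have -> : (1 : R) = 1 `^ sigma^-1 by rewrite powR1.
  by apply: ge0_ler_powR; rewrite ?nnegrE ?invr_ge0 // ltW.
- by apply: ler1_powR => //; rewrite invf_le1 ?ltW.
- by rewrite -powRrM mulVf ?gt_eqF // powRr1.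
- by rewrite truncn_le powR_ge0.
Qed.

Lemma powR_expR x y : 0 < x -> x `^ y = expR (y * ln x).
Proof. by move=> x0; rewrite /powR gt_eqF. Qed.

Lemma expR_tangent x : expR x <= 1 + x * expR x.
Proof.
have h := expR_ge1Dx (- x).
have e0 := expR_gt0 x.
have := ler_wpM2r (ltW e0) h; rewrite [X in _ <= X]mulrC expRxMexpNx_1.
by rewrite mulrBl mul1r lerBlDr.
Qed.

Lemma ln_le_self x : 0 < x -> ln x <= x.
Proof. by move=> /ln_sublinear/ltW. Qed.

(** A first-order expansion of [(x + y) ^ sigma], by [exp t <= 1 + t exp t]. *)
Lemma powR_shift sigma x y : 0 <= sigma -> 1 <= x -> 0 <= y ->
  (x + y) `^ sigma <= x `^ sigma + sigma * y * (1 + y) `^ sigma * (x `^ sigma / x).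
Proof.
move=> s0 x1 y0; have x0 : 0 < x by apply: lt_le_trans x1.
set z := y / x; have z0 : 0 <= z by apply: divr_ge0 => //; apply: ltW.
have zy : z <= y by rewrite ler_pdivrMr // ler_peMr.
have z1 : 0 < 1 + z by rewrite ltr_wpDr.
have -> : x + y = x * (1 + z) by rewrite mulrDr mulr1 /z mulrCA divff ?gt_eqF // mulr1.
rewrite powRM ?(ltW x0) ?(ltW z1) //.
apply: (@le_trans _ _ (x `^ sigma * (1 + sigma * z * (1 + y) `^ sigma))); last first.
  by rewrite mulrDr mulr1 lerD2l /z le_eqVlt; apply/orP; left; apply/eqP; ring.
rewrite ler_wpM2l ?powR_ge0 // powR_expR //; apply: le_trans (expR_tangent _) _.
rewrite lerD2l -powR_expR //; apply: ler_pM; rewrite ?mulr_ge0 ?powR_ge0 ?ln_ge0 ?lerDl //.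
  rewrite ler_wpM2l //; apply: le_ln1Dx; apply: lt_le_trans z0; exact: ltrN10.
by apply: ge0_ler_powR; rewrite ?nnegrE ?lerD2l ?addr_ge0.
Qed.

Lemma fact_shift N k : ((N + k)`! <= N`! * (N + k) ^ k)%N.
Proof.
have H m : (m <= k)%N -> ((N + m)`! <= N`! * (N + k) ^ m)%N.
  elim: m => [|m IH] mk; first by rewrite addn0 expn0 muln1.
  rewrite addnS factS expnS mulnCA; apply: leq_mul; last exact: IH (ltnW mk).
  by rewrite -addnS leq_add2l.
exact: H.
Qed.

(** Raising the exponent by a constant costs only a geometric factor: near [N] the
    exponent grows by [m] within [O(N^(1 - 1/sigma))] steps, each of which
    multiplies the factorial by [N^O(1) = exp (O(N^(1/sigma)))]. *)
Lemma index_shift sigma rho h m : 1 < sigma -> 0 <= rho -> 0 < h ->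
  exists (f : nat -> nat) (A h' : R), [/\ 0 < A, 1 <= h' & forall N,
    (order_of sigma N + m <= order_of sigma (f N))%N /\
    h ^+ f N * (f N)`!%:R `^ rho <= A * (h' ^+ N * N`!%:R `^ rho)].
Proof.
move=> s1 r0 h0; have s0 : 0 < sigma by apply: lt_trans s1.
pose g N : R := (N%:R `^ sigma^-1 + m%:R) `^ sigma.
pose f N := (Num.truncn (g N)).+1.
have g0 N : 0 <= g N by apply: powR_ge0.
have fl N : g N < (f N)%:R by have /andP[] := truncn_itv (g0 N).
have fu N : (f N)%:R <= g N + 1.
  by rewrite -natr1 lerD2r; have /andP[] := truncn_itv (g0 N).
have ordf N : (order_of sigma N + m <= order_of sigma (f N))%N.
  rewrite truncn_ge_nat ?powR_ge0 // natrD.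
  apply: (@le_trans _ _ (g N `^ sigma^-1)); last first.
    by apply: ge0_ler_powR; rewrite ?nnegrE ?invr_ge0 // ltW.
  rewrite -powRrM mulfV ?gt_eqF // powRr1; last by rewrite addr_ge0 ?powR_ge0.
  by rewrite lerD2r truncn_le powR_ge0.
pose D : R := sigma * m%:R * (1 + m%:R) `^ sigma.
pose E : R := 1 + sigma * (1 + m%:R).
pose H := Num.max 1 h.
have H1 : 1 <= H by rewrite le_max lexx.
have D0 : 0 <= D by rewrite !mulr_ge0 ?powR_ge0 // ltW.
have E0 : 0 <= E by rewrite addr_ge0 // mulr_ge0 ?addr_ge0 // ltW.
pose h' := expR (ln H * (2 + D) + rho * (E * (1 + D))).
pose A := 1 + h ^+ f 0 * (f 0)`!%:R `^ rho.
have t0 : 0 <= h ^+ f 0 * (f 0)`!%:R `^ rho by rewrite mulr_ge0 ?powR_ge0 // exprn_ge0 // ltW.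
have h'1 : 1 <= h'.
  rewrite -expR0 ler_expR; apply: addr_ge0.
    by apply: mulr_ge0; [exact: ln_ge0|exact: addr_ge0].
  by apply: mulr_ge0 => //; apply: mulr_ge0 => //; exact: addr_ge0.
have A1 : 1 <= A by rewrite lerDl.
exists f, A, h'; split=> //; first exact: lt_le_trans A1.
move=> N; split; first exact: ordf.
have [->|N0] := posnP N.
  by rewrite expr0 fact0 powR1 !mulr1 lerDr.
have [x1 xN xs _] := order_of_root s1 N0; set x := _ `^ _ in x1 xN xs.
have x0 : 0 < x by apply: lt_le_trans x1.
have gE : g N = (x + m%:R) `^ sigma by [].
have gle : g N <= N%:R + D * (N%:R / x).
  by rewrite gE -xs; apply: powR_shift => //; apply: ltW.
have Nf : (N <= f N)%N.
  rewrite -(ler_nat R); apply: ltW; apply: le_lt_trans (fl N).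
  by rewrite gE -xs; apply: ge0_ler_powR; rewrite ?nnegrE ?addr_ge0 ?lerDl // ltW.
pose k := (f N - N)%N; have fk : f N = (N + k)%N by rewrite subnKC.
have kx : k%:R * x <= (1 + D) * N%:R.
  have : (f N)%:R <= N%:R + D * (N%:R / x) + 1 by apply: le_trans (fu N) _; rewrite lerD2r.
  rewrite fk natrD -addrA lerD2l => /(ler_wpM2r (ltW x0)) /le_trans; apply.
  rewrite mulrDl -mulrA divfK ?gt_eqF // mul1r [1 + D]addrC mulrDl mul1r lerD2l //.
have kN : k%:R <= (1 + D) * N%:R.
  by apply: le_trans kx; rewrite ler_peMr.
have fE : (f N)%:R <= expR (E * x).
  have xm : x + m%:R <= (1 + m%:R) * x by rewrite mulrDl mul1r lerD2l ler_peMr.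
  have xm0 : 0 < x + m%:R by rewrite ltr_wpDr.
  apply: le_trans (fu N) _; rewrite gE powR_expR //.
  apply: (@le_trans _ _ (expR (sigma * ((1 + m%:R) * x)) + expR (sigma * ((1 + m%:R) * x)))).
    apply: lerD.
      rewrite ler_expR ler_pM2l //; apply: le_trans xm; exact: ln_le_self.
    by rewrite -expR0 ler_expR !mulr_ge0 ?addr_ge0 // ltW.
  have -> : E * x = x + sigma * ((1 + m%:R) * x) by rewrite /E; ring.
  rewrite expRD -mulr2n -[X in X <= _]mulr_natl ler_wpM2r ?expR_ge0 //.
  by apply: le_trans (expR_ge1Dx x); rewrite -[2]/(1 + 1)%:R natrD lerD2l.
have fac : (f N)`!%:R <= N`!%:R * expR (E * (1 + D) * N%:R).
  apply: (@le_trans _ _ (N`! * f N ^ k)%:R).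
    by rewrite ler_nat {1}fk fk; exact: fact_shift.
  rewrite natrM ler_wpM2l // natrX.
  apply: (@le_trans _ _ (expR (E * x) ^+ k)); first by rewrite lerXn2r // nnegrE ?expR_ge0.
  by rewrite -expRM_natl ler_expR -mulrA mulrCA ler_wpM2l.
have facr : (f N)`!%:R `^ rho <= N`!%:R `^ rho * expR (rho * (E * (1 + D))) ^+ N.
  rewrite -expRM_natl.
  apply: (@le_trans _ _ ((N`!%:R * expR (E * (1 + D) * N%:R)) `^ rho)).
    by apply: ge0_ler_powR; rewrite ?nnegrE ?mulr_ge0 ?expR_ge0.
  rewrite powRM ?expR_ge0 // ler_wpM2l ?powR_ge0 // (powR_expR _ (expR_gt0 _)) expRK.
  by rewrite ler_expR mulrA [X in _ <= X]mulrC.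
have hf : h ^+ f N <= expR (ln H * (2 + D)) ^+ N.
  have H0 : 0 < H by apply: lt_le_trans H1.
  apply: (@le_trans _ _ (H ^+ f N)).
    by rewrite lerXn2r ?nnegrE ?(ltW h0) ?(ltW H0) // le_max lexx orbT.
  rewrite -{1}(lnK (x := H)) ?posrE // -!expRM_natl ler_expR.
  rewrite [X in X <= _]mulrC mulrCA ler_wpM2l ?ln_ge0 //.
  by rewrite fk natrD [N%:R * _]mulrC -[2]/(1 + 1) -addrA mulrDl mul1r lerD2l.
have := ler_pM _ _ hf facr => /(_ (exprn_ge0 _ (ltW h0)) (powR_ge0 _ _)) /le_trans; apply.
rewrite mulrCA -exprMn -expRD mulrC.
by rewrite -[X in X <= _]mul1r; apply: ler_wpM2r => //; rewrite mulr_ge0 ?powR_ge0 ?exprn_ge0 ?expR_ge0.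
Qed.

(** For [q := 2n] one has [q! <= q ^ q = exp (q ln q)] and [ln q <= q ^ e / e]. *)
Lemma double_fact_le (e c x : R) n : 0 < e -> 1 <= x -> n.*2%:R <= c * x ->
  n.*2`!%:R <= expR (c `^ (1 + e) / e * x `^ (1 + e)).
Proof.
move=> e0 x1 nc; have x0 : 0 < x by apply: lt_le_trans x1.
have p1 : 0 <= 1 + e by rewrite addr_ge0 // ltW.
have [n0|n0] := posnP n.
  by rewrite n0 double0 fact0 -expR0 ler_expR !mulr_ge0 ?powR_ge0 // invr_ge0 ltW.
have y0 : (0 : R) < n.*2%:R by rewrite ltr0n double_gt0.
have c0 : 0 <= c by rewrite -(pmulr_lge0 _ x0); apply: le_trans nc; apply: ltW.
set y : R := n.*2%:R in y0 nc.
apply: (@le_trans _ _ (y ^+ n.*2)).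
  rewrite /y -natrX ler_nat.
  by have := fact_shift 0 n.*2; rewrite add0n fact0 mul1n.
rewrite -(powR_mulrn _ (ltW y0)) powR_expR // ler_expR.
apply: (@le_trans _ _ (y `^ (1 + e) / e)).
  have -> : y `^ (1 + e) = y * y `^ e.
    by rewrite powRD ?(powRr1 (ltW y0)) // (gt_eqF y0) implybT.
  rewrite -mulrA ler_pM2l //.
  rewrite ler_pdivlMr // mulrC -ln_powR; apply: ln_le_self; exact: powR_gt0.
rewrite mulrAC ler_wpM2r ?invr_ge0 ?(ltW e0) // -powRM ?(ltW x0) //.
by apply: ge0_ler_powR; rewrite ?nnegrE ?mulr_ge0 ?(ltW x0) ?(ltW y0).
Qed.

(** If [k] is at most a multiple of [x := N ^ (1 / sigma)], then the logarithm of
    [(2k)!] is [O(x ^ (1 + e))] for every [e > 0], and [e := sigma - 1] turns this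
    into [O(N)]. *)
Lemma gevrey_growth sigma (C b : R) (a0 b0 : nat) : 1 < sigma -> 0 < C -> 1 <= b ->
  exists A h : R, [/\ 0 < A, 1 <= h & forall N k, (k <= a0 * order_of sigma N + b0)%N ->
    C * b ^+ k * k.*2`!%:R <= A * h ^+ N].
Proof.
move=> s1 C0 b1.
pose e := sigma - 1; have e0 : 0 < e by rewrite subr_gt0.
have se : 1 + e = sigma by rewrite /e addrC subrK.
pose c : R := (a0 + b0).*2%:R.
pose h := b ^+ (a0 + b0) * expR (c `^ sigma / e).
have h1 : 1 <= h.
  rewrite -[1]mulr1; apply: ler_pM => //; first exact: exprn_ege1.
  by rewrite -expR0 ler_expR mulr_ge0 ?powR_ge0 // invr_ge0 ltW.
pose A := C * (1 + b ^+ b0 * b0.*2`!%:R).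
have b0' : 0 <= b by apply: le_trans b1.
have t0 : 0 <= b ^+ b0 * b0.*2`!%:R by rewrite mulr_ge0 // exprn_ge0.
exists A, h; split=> //; first by rewrite mulr_gt0 // ltr_wpDr.
move=> N k hk; rewrite /A -!mulrA ler_pM2l //.
have [N0|N0] := posnP N.
  move: hk; rewrite N0 order_of0 // muln0 add0n expr0 mulr1 => hk.
  apply: (@le_trans _ _ (b ^+ b0 * b0.*2`!%:R)); last by rewrite lerDr.
  apply: ler_pM; rewrite ?exprn_ge0 //; first by rewrite ler_weXn2l.
  by rewrite ler_nat leq_fact // leq_double.
have [x1 xN xs ox] := order_of_root s1 N0; set x := _ `^ _ in x1 xN xs ox.
have x0 : 0 < x by apply: lt_le_trans x1.
apply: (@le_trans _ _ (h ^+ N)); last first.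
  by rewrite -[X in X <= _]mul1r; apply: ler_wpM2r; [apply: exprn_ge0; apply: le_trans h1|rewrite lerDl].
rewrite /h exprMn -exprM; apply: ler_pM; rewrite ?exprn_ge0 //.
  apply: ler_weXn2l => //; apply: leq_trans hk _; rewrite mulnDl; apply: leq_add.
    by rewrite leq_mul2l order_of_le ?orbT.
  by rewrite leq_pmulr.
rewrite -expRM_natl mulrC -xs -se; apply: double_fact_le => //.
apply: (@le_trans _ _ (2 * (a0%:R * x + b0%:R * x))); last first.
  by rewrite -mulrDl mulrA /c -mul2n natrM natrD.
rewrite -mul2n natrM ler_pM2l //; apply: (@le_trans _ _ (a0 * order_of sigma N + b0)%:R).
  by rewrite ler_nat.
rewrite natrD natrM; apply: lerD; first by rewrite ler_wpM2l.
by rewrite ler_peMr.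
Qed.

End Growth.

(** * Constant-coefficient operators do not enlarge the wave front set *)

Section Operator.
Variables (R : realType) (d : nat) (U : set 'rV[R]_d).
Hypothesis oU : open U.
Variables (c : R[i]) (m : nat) (a : multi_index d m -> R[i]).
Notation vec := 'rV[R]_d.
Notation cfun := (vec -> R[i]).
Implicit Types (x xi : vec) (phi psi chi : cfun) (alpha : multi_index d m).
Implicit Types (v : cfun -> R[i]).

Definition dirs alpha : seq 'I_d := mlist (mnat alpha).

Lemma size_dirs alpha : size (dirs alpha) = mdeg alpha.
Proof. exact: size_mlist. Qed.

(** The coefficients of the transposed operator, with respect to the plain
    derivatives. *)
Definition tcoef alpha : R[i] :=
  if (mdeg alpha <= m)%N then a alpha * (c ^+ mdeg alpha * (-1) ^+ mdeg alpha) else 0.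

Lemma pdoE v phi : pdo c a v phi = \sum_alpha tcoef alpha * v (cpartials (dirs alpha) phi).
Proof.
rewrite /pdo big_mkcond; apply: eq_bigr => alpha _; rewrite /tcoef.
by case: ifP => _; rewrite ?mul0r // /dderiv dpartialE !mulrA.
Qed.

(** The factor by which the transposed operator multiplies a character. *)
Definition symbol xi : R[i] := \sum_alpha tcoef alpha * zpow xi (dirs alpha).

Lemma pdo_linear v : linear_on U v -> linear_on U (pdo c a v).
Proof.
move=> lin z phi psi t1 t2; rewrite !pdoE mulr_sumr -big_split; apply: eq_bigr => alpha _ /=.
rewrite mulrCA -mulrDr -lin; try exact: test_cpartials.
congr (_ * v _); apply: funext => x.
have [s1 e1] := smoothZ_cpartials z openT (test_smooth t1).
have [_ e2] := smoothD_cpartials openT s1 (test_smooth t2).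
by rewrite e2 // e1.
Qed.

Lemma pdo_distribution v : is_distribution U v -> is_distribution U (pdo c a v).
Proof.
move=> /(is_distributionP _ oU)[lin h]; apply/(is_distributionP _ oU); split.
  exact: pdo_linear.
move=> K cK KU; have [C [k [C0 hC]]] := h K cK KU.
exists (\sum_alpha normc (tcoef alpha) * C), (k + m)%N; split.
  by apply: sumr_ge0 => alpha _; rewrite mulr_ge0 ?normc_ge0.
move=> phi M t sK jM; rewrite pdoE; apply: le_trans (normc_sum _ _ _) _.
rewrite mulr_suml; apply: ler_sum => alpha _; rewrite normcM -mulrA /tcoef.
case: ifP => am; last by rewrite normc0 !mul0r.
rewrite ler_wpM2l ?normc_ge0 //; apply: hC; first exact: test_cpartials.
  by move=> x /fsupport_cpartials/sK.
move=> x; apply: jet_le_cpartials; apply: jet_leW (lexx M) (jM x).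
by rewrite leq_add2l size_dirs.
Qed.

Lemma pdo_support K v : supported_in U K v -> supported_in U K (pdo c a v).
Proof.
move=> sv phi t e; rewrite pdoE big1 // => alpha _; rewrite sv ?mulr0 //.
  exact: test_cpartials.
by rewrite -subset0 => x [/fsupport_cpartials sx Kx]; rewrite -e.
Qed.

Lemma pdo_compact v : compact_distribution U v -> compact_distribution U (pdo c a v).
Proof.
move=> [dv [K [cK KU sv]]]; split; first exact: pdo_distribution.
by exists K; split=> //; exact: pdo_support.
Qed.

Lemma pairing_pdo v phi : compact_distribution U v -> smooth U phi ->
  pairing U (pdo c a v) phi = \sum_alpha tcoef alpha * pairing U v (cpartials (dirs alpha) phi).
Proof.
move=> [[lin _] [K [cK KU sv]]] sm.
have [chi tc [W oW [KW W1]]] := cutoff_compact oU cK KU.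
rewrite (pairingE oU (pdo_linear lin) cK KU (pdo_support sv) tc oW KW W1 sm) pdoE.
apply: eq_bigr => alpha _; congr (_ * _).
have sa := smooth_cpartials (dirs alpha) sm.
rewrite (pairingE oU lin cK KU sv tc oW KW W1 sa).
apply: (eq_on_support lin sv oW KW).
- by apply: test_cpartials; apply: testM.
- exact: testM.
move=> x Wx; rewrite (W1 x Wx) mul1r.
by apply: (eq_open_cpartials oW) => // y /W1->; rewrite mul1r.
Qed.

Lemma fourier_pdo v xi : compact_distribution U v ->
  fourier U (pdo c a v) xi = symbol xi * fourier U v xi.
Proof.
move=> cv; rewrite /fourier pairing_pdo //; last exact: smooth_character.
rewrite /symbol mulr_suml; apply: eq_bigr => alpha _; rewrite -mulrA; congr (_ * _).
rewrite -pairingZ //; last exact: smooth_character.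
by congr (pairing _ _ _); apply: funext => x; rewrite cpartials_character.
Qed.

Lemma pdo_bounded (u_ : nat -> cfun -> R[i]) :
  (forall N, compact_distribution U (u_ N)) -> bounded_compact_distributions U u_ ->
  bounded_compact_distributions U (fun N => pdo c a (u_ N)).
Proof.
move=> cu bu B /(bounded_smoothP _ oU)[sB bB].
pose B' alpha : set cfun := [set cpartials (dirs alpha) phi | phi in B].
have bB' alpha : bounded_smooth U (B' alpha).
  apply/(bounded_smoothP _ oU); split; first by move=> _ [phi /sB sm <-]; exact: smooth_cpartials.
  move=> K k cK KU; have [M hM] := bB K (k + size (dirs alpha))%N cK KU.
  by exists M => _ x [phi Bphi <-] Kx; apply: jet_le_cpartials; apply: hM.
have [M hM] := choice (fun alpha => bu _ (bB' alpha)).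
exists (\sum_alpha normc (tcoef alpha) * M alpha) => N phi Bphi.
rewrite pairing_pdo //; last exact: sB.
apply: le_trans (normc_sum _ _ _) _; apply: ler_sum => alpha _; rewrite normcM.
by rewrite ler_wpM2l ?normc_ge0 //; apply: hM; exists phi.
Qed.

Lemma symbol_bound : exists2 C : R, 0 < C & forall xi, normc (symbol xi) <= C * (1 + `|xi|) ^+ m.
Proof.
have p1 : 1 <= 2 * pi :> R.
  by have := @pi_ge2 R; lra.
exists (1 + (\sum_alpha normc (tcoef alpha)) * (2 * pi) ^+ m).
  by rewrite ltr_wpDr // mulr_ge0 ?exprn_ge0 ?(le_trans _ p1) // sumr_ge0 // => i _; apply: normc_ge0.
move=> xi; apply: le_trans (normc_sum _ _ _) _.
apply: (@le_trans _ _ ((\sum_alpha normc (tcoef alpha)) * (2 * pi) ^+ m * (1 + `|xi|) ^+ m)).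
  rewrite -mulrA -exprMn mulr_suml; apply: ler_sum => alpha _; rewrite normcM /tcoef.
  case: ifP => am; last by rewrite normc0 !mul0r.
  rewrite ler_wpM2l ?normc_ge0 //; apply: le_trans (normc_zpow _ _) _; rewrite size_dirs.
  have p2 : 1 <= 2 * pi * (1 + `|xi|).
    by apply: mulr_ege1 => //; rewrite lerDl.
  apply: (@le_trans _ _ ((2 * pi * (1 + `|xi|)) ^+ mdeg alpha)); last exact: ler_weXn2l.
  have q0 : 0 <= 2 * pi :> R by apply: le_trans p1.
  apply: lerXn2r; rewrite ?nnegrE ?(mulr_ge0 q0) ?addr_ge0 //.
  by apply: ler_wpM2l => //; rewrite lerDr.
by rewrite ler_wpM2r ?exprn_ge0 ?addr_ge0 // lerDr.
Qed.

End Operator.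

Section EuclideanNorm.
Variables (R : realType) (d : nat).
Implicit Type x : 'rV[R]_d.

Lemma norm_le_enorm x : `|x| <= enorm x.
Proof.
apply/rv_norm_leP => [|j]; first exact: sqrtr_ge0.
rewrite -sqrtr_sqr /enorm ler_sqrt; last by apply: sumr_ge0 => i _; rewrite -expr2 sqr_ge0.
rewrite /dot (bigD1 j) //= -expr2 lerDl; apply: sumr_ge0 => i _; rewrite -expr2 sqr_ge0 //.
Qed.

Lemma enorm_le_norm x : enorm x <= d.+1%:R * `|x|.
Proof.
rewrite -[X in _ <= X]ger0_norm ?mulr_ge0 // -sqrtr_sqr /enorm ler_sqrt ?sqr_ge0 //.
apply: (@le_trans _ _ (\sum_(j < d) `|x| ^+ 2)).
  apply: ler_sum => j _; rewrite -expr2 -[X in X <= _]ger0_norm ?sqr_ge0 // normrX.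
  by rewrite lerXn2r ?nnegrE ?normr_ge0 // norm_coord.
rewrite sumr_const card_ord -[X in X <= _]mulr_natl exprMn ler_wpM2r ?sqr_ge0 //.
by rewrite -natrX ler_nat expnS expn1 mulSn; apply: leq_trans (leq_addr _ _).
Qed.

Lemma enorm_gt0 x : x != 0 -> 0 < enorm x.
Proof. by move=> x0; apply: lt_le_trans (norm_le_enorm x); rewrite normr_gt0. Qed.

End EuclideanNorm.

Section Pseudolocality.
Variables (R : realType) (d : nat) (U : set 'rV[R]_d) (tau sigma : R).
Variables (c : R[i]) (m : nat) (a : multi_index d m -> R[i]).
Hypotheses (oU : open U) (tau0 : 0 <= tau) (sigma1 : 1 < sigma).

Lemma eq_distribution_pdo Omega (u v : ('rV[R]_d -> R[i]) -> R[i]) :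
  eq_distribution Omega u v -> eq_distribution Omega (pdo c a u) (pdo c a v).
Proof.
move=> e phi t; rewrite !pdoE; apply: eq_bigr => alpha _; congr (_ * _).
by apply: e; apply: test_cpartials.
Qed.

(** The adapted sequence is [P(D) u_(f N)] with [f] from [index_shift], which makes
    up for the growth of the symbol.  Below frequency 1 there is nothing to gain
    from the exponent, and the uniform bound of the transforms suffices. *)
Lemma WF_regular_pdo (u : ('rV[R]_d -> R[i]) -> R[i]) x0 xi0 :
  WF_regular tau sigma U u x0 xi0 -> WF_regular tau sigma U (pdo c a u) x0 xi0.
Proof.
move=> [V [G [u_ [hO hG [cu bu] eu [A [h [A0 h0 hu]]]]]]].
have rho0 : 0 <= tau / sigma by rewrite divr_ge0 // ltW // (lt_trans ltr01).
have [f [A2 [h2 [A20 h21 hf]]]] := index_shift m sigma1 rho0 h0.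
have [C C0 hC] := symbol_bound c a.
have [k hk] := bounded_fourier oU cu bu.
exists V, G, (fun N => pdo c a (u_ (f N))); split=> //.
- split; first by move=> N; exact: pdo_compact.
  move=> B bB; have [M hM] := pdo_bounded oU c a cu bu bB.
  by exists M => N phi Bphi; apply: hM.
- by move=> N; apply: eq_distribution_pdo.
set C2 := C * 2 ^+ m; have C20 : 0 < C2 by rewrite mulr_gt0 // exprn_gt0.
set M := k%:R * (1 + 2 * pi) ^+ k : R.
have p0 := @pi_ge0 R.
have M0 : 0 <= M by rewrite mulr_ge0 // exprn_ge0 // addr_ge0 // mulr_ge0.
have d1 : (1 : R) <= d.+1%:R by rewrite ler1n.
exists (C2 * M + C2 * (A * A2)), (d.+1%:R * h2); split.
- by apply: ltr_wpDl; [rewrite mulr_ge0 // ltW|apply: mulr_gt0 => //; exact: mulr_gt0].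
- by apply: mulr_gt0 => //; exact: lt_le_trans ltr01 h21.
move=> N xi Gxi xi0'; rewrite fourier_pdo // normcM.
have e0 := enorm_gt0 xi0'; have [ordf hfN] := hf N.
set p := Num.truncn _; set e := enorm xi in e0 *.
set F := N`!%:R `^ (tau / sigma).
have F1 : 1 <= F.
  have -> : (1 : R) = 1 `^ (tau / sigma) by rewrite powR1.
  by apply: ge0_ler_powR; rewrite ?nnegrE // ler1n fact_gt0.
have F0 : 0 <= F by apply: le_trans F1.
have h20 : 0 <= h2 by apply: le_trans h21.
have hN : h2 ^+ N <= (d.+1%:R * h2) ^+ N.
  by rewrite lerXn2r ?nnegrE ?mulr_ge0 // ler_peMl.
have main : 0 <= (d.+1%:R * h2) ^+ N * F / e ^+ p.
  by rewrite divr_ge0 ?mulr_ge0 ?exprn_ge0 ?mulr_ge0 // ltW.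
rewrite mulrDl; have [x1|/ltW x1] := lerP `|xi| 1.
  apply: ler_wpDr; first by rewrite mulr_ge0 // !mulr_ge0 // ltW.
  rewrite -[X in X <= _]mulr1; apply: ler_pM; rewrite ?mulr_ge0 ?normc_ge0 //.
    apply: ler_pM; rewrite ?normc_ge0 //.
      apply: le_trans (hC xi) _; rewrite /C2 ler_wpM2l ?(ltW C0) // lerXn2r ?nnegrE ?addr_ge0 //.
      by rewrite -[2]/(1 + 1)%:R natrD lerD2l.
    apply: le_trans (hk (f N) xi) _; rewrite ler_wpM2l // lerXn2r ?nnegrE ?addr_ge0 ?mulr_ge0 //.
    by rewrite lerD2l ler_piMr // mulr_ge0.
  rewrite ler_pdivlMr ?exprn_gt0 // mul1r.
  apply: (@le_trans _ _ (d.+1%:R ^+ N)).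
    apply: (@le_trans _ _ (d.+1%:R ^+ p)); last by apply: ler_weXn2l => //; exact: order_of_le.
    rewrite lerXn2r ?nnegrE ?(ltW e0) //; apply: le_trans (enorm_le_norm xi) _.
    by rewrite ler_piMr.
  rewrite exprMn -mulrA ler_peMr ?exprn_ge0 //; apply: mulr_ege1 => //; exact: exprn_ege1.
apply: ler_wpDl; first by rewrite mulr_ge0 // mulr_ge0 // ltW.
have ex : 1 <= e by apply: le_trans x1 (norm_le_enorm xi).
apply: (@le_trans _ _ ((C2 * e ^+ m) * (A * (A2 * (h2 ^+ N * F)) / e ^+ (p + m)))).
  apply: ler_pM; rewrite ?normc_ge0 //.
    apply: le_trans (hC xi) _; rewrite /C2 -mulrA ler_wpM2l ?(ltW C0) // -exprMn.
    rewrite lerXn2r ?nnegrE ?addr_ge0 ?mulr_ge0 ?(ltW e0) //.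
    rewrite [2 * _]mulr_natl mulr2n; apply: lerD => //; exact: norm_le_enorm.
  apply: le_trans (hu _ _ Gxi xi0') _; rewrite -[X in _ <= X]mulrA ler_wpM2l ?(ltW A0) //.
  apply: ler_pM; rewrite ?mulr_ge0 ?exprn_ge0 ?powR_ge0 ?invr_ge0 ?exprn_ge0 ?(ltW h0) ?(ltW e0) //.
  rewrite lef_pV2 ?posrE ?exprn_gt0 //; exact: ler_weXn2l.
have -> : C2 * e ^+ m * (A * (A2 * (h2 ^+ N * F)) / e ^+ (p + m)) =
    C2 * (A * A2) * (h2 ^+ N * F / e ^+ p).
  have em0 : e ^+ m != 0 by rewrite expf_neq0 // gt_eqF.
  have cancel_order (q r s t x y : R) : y != 0 -> q * y * (r * (s * t) / (x * y)) = q * (r * s) * (t / x).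
    by move=> y0; rewrite -[RHS]mulr1 -(divff y0) invfM; ring.
  by rewrite exprD cancel_order.
apply: ler_wpM2l; first by rewrite !mulr_ge0 // ltW.
by rewrite !ler_wpM2r // invr_ge0 exprn_ge0 // ltW.
Qed.

End Pseudolocality.

(** * Trigonometric interpolation on a grid *)

Section UnitCircle.
Variable R : realType.
Implicit Types (s t : R).

Definition cis t : R[i] := cos t +i* sin t.

Lemma cisD s t : cis (s + t) = cis s * cis t.
Proof.
rewrite /cis cosD sinD; apply/eqP; rewrite eq_complex /=; apply/andP; split; apply/eqP; ring.
Qed.

Lemma cis0 : cis 0 = 1.
Proof. by rewrite /cis cos0 sin0. Qed.

Lemma cisN t : cis t * cis (- t) = 1.
Proof. by rewrite -cisD subrr cis0. Qed.

Lemma cis_sum (I : Type) (r : seq I) (P : pred I) (F : I -> R) :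
  cis (\sum_(i <- r | P i) F i) = \prod_(i <- r | P i) cis (F i).
Proof. by apply: (big_morph cis) => [x y|]; [exact: cisD|exact: cis0]. Qed.

Lemma cisMn t n : cis (n%:R * t) = cis t ^+ n.
Proof.
elim: n => [|n IH]; first by rewrite mul0r cis0 expr0.
by rewrite -natr1 mulrDl mul1r cisD IH exprSr.
Qed.

Lemma cis_2pi : cis (2 * pi) = 1.
Proof. by rewrite /cis mulr_natl cos2pi sin2pi. Qed.

Lemma normc_cis_sub1 t : normc (cis t - 1) = 2 * `|sin (t / 2)|.
Proof.
have e : t = (t / 2) *+ 2 by rewrite mulr2n -splitr.
rewrite -[RHS]ger0_norm ?mulr_ge0 // -sqrtr_sqr.
have -> : cis t - 1 = (cos t - 1) +i* (sin t - 0) by [].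
rewrite /= subr0; congr Num.sqrt.
rewrite [in LHS]e cos_mulr2n sin_mulr2n exprMn real_normK ?num_real //.
have := cos2Dsin2 (t / 2); move: (cos _) (sin _) => x y h.
have hx : x ^+ 2 = 1 - y ^+ 2 by rewrite -h addrK.
transitivity ((2 * (x ^+ 2 - 1)) ^+ 2 + 4 * (x ^+ 2 * y ^+ 2)); first by ring.
by rewrite hx; ring.
Qed.

Lemma sin_lower t : 0 <= t -> t <= pi / 2 -> cos 1 / 2 * t <= sin t.
Proof.
move=> t0 tp; have c0 := @cos1_gt0 R.
have [p0 p2] : 0 <= pi / 2 :> R /\ pi / 2 <= 2 :> R.
  by have [/andP[]] := pihalf_02_cos_pihalf R.
have base s : 0 <= s -> s <= 1 -> cos 1 * s <= sin s.
  rewrite le_eqVlt => /orP[/eqP<- _|s0 s1]; first by rewrite sin0 mulr0.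
  have csin : {within `[0, s], continuous (@sin R)}.
    by apply: continuous_subspaceT => x; exact: continuous_sin.
  have [c] := @MVT R (@sin R) (@cos R) 0 s s0 (fun x _ => is_derive_sin x) csin.
  rewrite in_itv /= sin0 !subr0 => /andP[c1 c2] ->.
  rewrite ler_wpM2r ?(ltW s0) //; have [->//|cn1] := eqVneq c 1.
  have cl1 : c < 1 by apply: lt_le_trans s1.
  have pi2 := @pi_ge2 R.
  by apply: ltW; rewrite ltr_cos ?in_itv /= ?ler01 ?(ltW c1) //=; lra.
have [t1|t1] := lerP t 1.
  by apply: le_trans (base t t0 t1); rewrite ler_wpM2r // ler_pdivrMr // ler_peMr ?ler1n // ltW.
apply: (@le_trans _ _ (sin 1)).
  apply: le_trans (base 1 ler01 (lexx _)); rewrite mulr1 -[X in _ <= X]mulr1 -mulrA.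
  rewrite ler_wpM2l ?(ltW c0) // mulrC ler_pdivrMr // mul1r; exact: le_trans tp p2.
by apply: ltW; rewrite ltr_sin // in_itv /=; apply/andP; split; lra.
Qed.

Lemma cis_lower t : `|t| <= pi -> cos 1 / 2 * `|t| <= normc (cis t - 1).
Proof.
move=> tp; rewrite normc_cis_sub1.
have e : `|sin (t / 2)| = sin (`|t| / 2).
  have p0 := @pi_ge0 R.
  have h : 0 <= sin (`|t| / 2).
    apply: sin_ge0_pi; apply/andP; split; first exact: divr_ge0.
    have := normr_ge0 t; lra.
  have [t0|t0] := lerP 0 t; first by rewrite ger0_norm // -{1}(ger0_norm t0).
  have et : t / 2 = - (`|t| / 2) by rewrite ltr0_norm // mulNr opprK.
  by rewrite et sinN normrN ger0_norm.
rewrite e; have := @sin_lower (`|t| / 2) (divr_ge0 (normr_ge0 _) (ler0n _ 2)).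
by rewrite ler_pM2r ?invr_gt0 // => /(_ tp); lra.
Qed.

Lemma cis_neq1 t : 0 < `|t| < 2 * pi -> cis t != 1.
Proof.
move=> /andP[t0 t2]; rewrite -subr_eq0 -normc_eq0 normc_cis_sub1 mulf_eq0 negb_or.
rewrite pnatr_eq0 /= normr_eq0.
have s0 : 0 < sin (`|t| / 2) by apply: sin_gt0_pi; apply/andP; split; lra.
have [t1|t1] := lerP 0 t; first by rewrite -(ger0_norm t1) gt_eqF.
have et : t / 2 = - (`|t| / 2) by rewrite ltr0_norm // mulNr opprK.
by rewrite et sinN oppr_eq0 gt_eqF.
Qed.

(** Orthogonality of the characters of the cyclic group of order [2 n]. *)
Lemma geometric_orthogonality n (b b' : 'I_n.*2) : (0 < n)%N ->
  \sum_(k < n.*2) cis (2 * pi * ((k%:R - n%:R) * ((b%:R - b'%:R) / n.*2%:R))) =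
  (if b == b' then n.*2%:R else 0).
Proof.
move=> n0; have M0 : n.*2%:R != 0 :> R by rewrite pnatr_eq0 double_eq0 -lt0n.
have [->|bb] := eqVneq b b'.
  rewrite (eq_bigr (fun=> 1)) ?sumr_const ?card_ord // => k _.
  by rewrite subrr mul0r !mulr0 cis0.
pose t : R := 2 * pi * ((b%:R - b'%:R) / n.*2%:R).
have tE (k : 'I_n.*2) : cis (2 * pi * ((k%:R - n%:R) * ((b%:R - b'%:R) / n.*2%:R))) =
    cis (- (n%:R * t)) * cis t ^+ k.
  by rewrite -cisMn -cisD; congr cis; rewrite /t; ring.
rewrite (eq_bigr _ (fun k _ => tE k)) -mulr_sumr.
have z1 : cis t != 1.
  apply: cis_neq1.
  have p0 := @pi_gt0 R.
  have Mp : (0 : R) < n.*2%:R by rewrite ltr0n double_gt0.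
  have pp : (0 : R) < 2 * pi by rewrite mulr_gt0.
  have bd : 0 < `|b%:R - b'%:R : R|.
    rewrite normr_gt0 subr_eq0; apply: contra bb => /eqP/eqP.
    by rewrite eqr_nat => /eqP e; apply/eqP/val_inj.
  have bM : `|b%:R - b'%:R : R| < n.*2%:R.
    have b1 : (b%:R : R) < n.*2%:R by rewrite ltr_nat.
    have b2 : (b'%:R : R) < n.*2%:R by rewrite ltr_nat.
    have b3 : (0 : R) <= b%:R by []. have b4 : (0 : R) <= b'%:R by [].
    by rewrite ltr_norml; apply/andP; split; lra.
  rewrite /t normrM (gtr0_norm pp) normf_div (gtr0_norm Mp); apply/andP; split.
    by apply: mulr_gt0 => //; apply: divr_gt0.
  by rewrite gtr_pMr // ltr_pdivrMr // mul1r.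
have zM : cis t ^+ n.*2 = 1.
  rewrite -cisMn /t.
  have -> : n.*2%:R * (2 * pi * ((b%:R - b'%:R) / n.*2%:R)) = b%:R * (2 * pi) + - (b'%:R * (2 * pi)) :> R.
    by field; exact: M0.
  have cb (k : nat) : cis (k%:R * (2 * pi)) = 1 by rewrite cisMn cis_2pi expr1n.
  by rewrite cisD cb mul1r -[LHS]mul1r -[in LHS](cb b') cisN.
have : (cis t - 1) * \sum_(k < n.*2) cis t ^+ k = 0 by rewrite -subrX1 zM subrr.
move=> /eqP; rewrite mulf_eq0 subr_eq0 (negbTE z1) /= => /eqP ->.
by rewrite mulr0.
Qed.

End UnitCircle.

(** ** Interpolation and the decay of its coefficients *)

Section Translation.
Variables (R : realType) (d : nat).
Notation vec := 'rV[R]_d.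
Notation cfun := (vec -> R[i]).
Implicit Types (x : vec) (phi psi : cfun) (s : seq 'I_d).

Lemma is_derive_shift (f : vec -> R) x (v w : vec) (l : R) :
  is_derive (x + w) v f l -> is_derive x v (fun y => f (y + w)) l.
Proof.
move=> [h1 h2].
have e : (fun h : R => h^-1 *: (((fun y => f (y + w)) \o shift x) (h *: v) - f (x + w)))
       = (fun h : R => h^-1 *: ((f \o shift (x + w)) (h *: v) - f (x + w))).
  by apply: funext => h; rewrite /= addrA.
by split; [rewrite /derivable e|rewrite /derive e].
Qed.

Lemma smooth_shift (w : vec) phi : smooth setT phi -> smooth setT (fun y => phi (y + w)) /\
  forall s x, setT x -> cpartials s (fun y => phi (y + w)) x = cpartials s phi (x + w).
Proof.
move=> /smoothP sm; apply: (@smooth_family _ _ _ _ (fun s x => cpartials s phi (x + w)) openT) => //.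
move=> s x _; have [[c1 c2] p] := sm s (x + w) I.
have cw : {for x, continuous (fun y : vec => y + w)}.
  by apply: continuousD; [exact: cvg_id|exact: cst_continuous].
split.
  split; first exact: (@continuous_comp _ _ _ _ (repart (cpartials s phi)) x cw c1).
  exact: (@continuous_comp _ _ _ _ (impart (cpartials s phi)) x cw c2).
by move=> j; have [p1 p2] := p j; split; apply: is_derive_shift.
Qed.

Definition fdiff (h : R) (j : 'I_d) phi : cfun := fun x => phi (x + h *: unit_vec R j) - phi x.

Lemma smooth_fdiff h j phi : smooth setT phi -> smooth setT (fdiff h j phi) /\
  forall s x, cpartials s (fdiff h j phi) x = fdiff h j (cpartials s phi) x.
Proof.
move=> sm; have [s1 e1] := smooth_shift (h *: unit_vec R j) sm.
have [s2 e2] := smoothZ_cpartials (-1) openT sm.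
have [s3 e3] := smoothD_cpartials openT s1 s2.
have e : fdiff h j phi = fun x => phi (x + h *: unit_vec R j) + -1 * phi x.
  by apply: funext => x; rewrite mulN1r.
by rewrite e; split=> // s x; rewrite e3 // e1 // e2 // mulN1r.
Qed.

Lemma jet_le_fdiff h j k M phi : 0 <= h -> smooth setT phi -> (forall x, jet_le k.+1 M phi x) ->
  forall x, jet_le k (2 * h * M) (fdiff h j phi) x.
Proof.
move=> h0 sm jM x s sk; have [_ ->] := smooth_fdiff h j sm.
apply: increment_le => //; first exact: smooth_cpartials.
by move=> y; rewrite -cpartials_cat; apply: jM.
Qed.

Lemma iter_fdiff_le h j n k M phi : 0 <= h -> smooth setT phi -> (forall x, jet_le (n + k) M phi x) ->
  forall x, jet_le k ((2 * h) ^+ n * M) (iter n (fdiff h j) phi) x.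
Proof.
move=> h0 sm; elim: n phi sm k => [|n IH] phi sm k jM x; first by rewrite expr0 mul1r; apply: jM.
rewrite iterS exprS -mulrA; apply: jet_le_fdiff => //; last by move=> y; apply: IH => // z; rewrite addnS; apply: jM.
elim: n {IH jM} => [//|n IH]; rewrite iterS; by have [] := smooth_fdiff h j IH.
Qed.

End Translation.

Section Interpolation.
Variables (R : realType) (d n : nat) (L : R).
Hypotheses (n0 : (0 < n)%N) (L0 : 0 < L).
Notation vec := 'rV[R]_d.
Notation cfun := (vec -> R[i]).
Notation idx := {ffun 'I_d -> 'I_n.*2}.
Implicit Types (x xi : vec) (phi psi : cfun) (k kappa : idx) (j : 'I_d).

Definition step : R := L / n.*2%:R.
Definition grid kappa : vec := \row_j (((kappa j)%:R - n%:R) * step).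
Definition freq k : vec := \row_j (((k j)%:R - n%:R) / L).

Definition dft phi k : R[i] :=
  (n.*2%:R ^- d)%:C * \sum_kappa phi (grid kappa) * character (freq k) (grid kappa).

Definition trig phi x : R[i] := \sum_k dft phi k * character (- freq k) x.

Lemma step_gt0 : 0 < step.
Proof. by rewrite divr_gt0 // ltr0n double_gt0. Qed.

Lemma M_neq0 : n.*2%:R != 0 :> R.
Proof. by rewrite pnatr_eq0 double_eq0 -lt0n. Qed.

Lemma characterE xi x : character xi x = \prod_j cis (- (2 * pi * (x ord0 j * xi ord0 j))).
Proof.
rewrite -cis_sum -[RHS]/(_ +i* _) sumrN -mulr_sumr cosN sinN; by [].
Qed.

Lemma dft_kernel k kappa kappa0 :
  character (freq k) (grid kappa) * character (- freq k) (grid kappa0) =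
  \prod_j cis (2 * pi * (((k j)%:R - n%:R) * (((kappa0 j)%:R - (kappa j)%:R) / n.*2%:R))).
Proof.
rewrite !characterE -big_split; apply: eq_bigr => j _; rewrite /= -cisD !mxE; congr cis.
by rewrite /step; field; rewrite M_neq0 gt_eqF.
Qed.

(** Inversion of the discrete Fourier transform on the grid. *)
Lemma trig_grid phi kappa0 : trig phi (grid kappa0) = phi (grid kappa0).
Proof.
rewrite /trig /dft.
transitivity (\sum_kappa phi (grid kappa) * ((n.*2%:R ^- d)%:C *
    \sum_k character (freq k) (grid kappa) * character (- freq k) (grid kappa0))).
  under eq_bigr => k _ do rewrite mulrAC mulr_sumr.
  rewrite exchange_big /=; apply: eq_bigr => kappa _; rewrite !mulr_sumr.
  by apply: eq_bigr => k _; ring.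
have diag : \sum_k character (freq k) (grid kappa0) * character (- freq k) (grid kappa0) =
    (n.*2%:R ^+ d)%:C.
  rewrite (eq_bigr (fun=> 1)).
    by rewrite sumr_const card_ffun !card_ord -natrX rmorph_nat.
  by move=> k _; rewrite dft_kernel big1 // => j _; rewrite subrr mul0r !mulr0 cis0.
have off kappa : kappa != kappa0 ->
    \sum_k character (freq k) (grid kappa) * character (- freq k) (grid kappa0) = 0.
  move=> ne; under eq_bigr => k _ do rewrite dft_kernel.
  rewrite -(bigA_distr_bigA (fun j (a : 'I_n.*2) =>
    cis (2 * pi * ((a%:R - n%:R) * (((kappa0 j)%:R - (kappa j)%:R) / n.*2%:R))))).
  have [j hj] : exists j, kappa0 j != kappa j.
    apply: contrapT => /forallNP h; move: ne; apply/negP; rewrite negbK; apply/eqP/ffunP => j.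
    by apply/eqP; rewrite eq_sym; apply: contrapT => /negP; exact: h.
  by rewrite (bigD1 j) //= geometric_orthogonality // (negbTE hj) mul0r.
rewrite (bigD1 kappa0) // diag big1; last first.
  by move=> kappa /andP[_ /off ->]; rewrite !mulr0.
rewrite /= addr0 -rmorphM /= mulVf ?expf_neq0 ?M_neq0 //.
by rewrite mulr1.
Qed.

(** Shifting the grid by one step along an axis is invisible to functions that
    vanish near the faces of the box. *)
Lemma sum_grid_shift (F : cfun) j : (forall x, L / 2 <= `|x ord0 j| -> F x = 0) ->
  \sum_kappa F (grid kappa + step *: unit_vec R j) = \sum_kappa F (grid kappa).
Proof.
move=> out.
pose sh (f : 'I_n.*2 -> 'I_n.*2) kappa : idx := [ffun i => if i == j then f (kappa i) else kappa i].
have bij : bijective (sh (@ordS n.*2)).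
  by exists (sh (@ord_pred n.*2)) => kappa; apply/ffunP => i; rewrite !ffunE; case: eqP => // _;
    rewrite ?ordSK ?ord_predK.
rewrite [RHS](reindex _ (onW_bij _ bij)) /=; apply: eq_bigr => kappa _.
have halfL : L / 2 = n%:R * step.
  rewrite /step -mul2n natrM; field; by rewrite pnatr_eq0 -lt0n.
have [lt|ge] := ltnP (kappa j).+1 n.*2.
  congr F; apply/rowP => i; rewrite !mxE !ffunE; case: (eqVneq i j) => [->|ij]; last first.
    by rewrite andbF mulr0 addr0.
  by rewrite eqxx mulr1 /= modn_small // -natr1; ring.
have kj : (kappa j).+1 = n.*2 by apply/eqP; rewrite eqn_leq ge ltn_ord.
rewrite !out //.
  rewrite !mxE !ffunE !eqxx /= kj modnn sub0r mulNr normrN halfL ger0_norm //.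
  by rewrite mulr_ge0 // ltW // step_gt0.
rewrite !mxE !eqxx mulr1 halfL.
have -> : ((kappa j)%:R - n%:R) * step + step = n%:R * step.
  have -> : (kappa j)%:R = n.*2%:R - 1 :> R
    by have /(congr1 (fun q : nat => q%:R : R)) := kj; rewrite -natr1 => <-; rewrite addrK.
  by rewrite -mul2n natrM; ring.
by rewrite ler_norm.
Qed.

Lemma dft_fdiff phi k j : (forall x, L / 2 <= `|x ord0 j| -> phi x = 0) ->
  dft (fdiff step j phi) k = (cis (2 * pi * (((k j)%:R - n%:R) / n.*2%:R)) - 1) * dft phi k.
Proof.
move=> out; rewrite /dft mulrCA; congr (_ * _).
have sh := @sum_grid_shift (fun x => phi x * character (freq k) x) j.
rewrite mulrBl mul1r -[X in _ * X - _]sh; last by move=> x /out ->; rewrite mul0r.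
rewrite mulr_sumr -sumrB; apply: eq_bigr => kappa _.
rewrite /fdiff mulrBl; congr (_ - _); rewrite [RHS]mulrCA; congr (_ * _).
rewrite !characterE (bigD1 j) // [in RHS](bigD1 j) //.
rewrite [RHS]mulrA -cisD; congr (_ * _).
  congr cis; rewrite !mxE !eqxx mulr1 /step; field; by rewrite M_neq0 gt_eqF.
by apply: eq_bigr => i ij; rewrite !mxE (negbTE ij) andbF mulr0 addr0.
Qed.

Lemma iter_fdiff_out s delta phi j : (forall x, L / 2 - delta <= `|x ord0 j| -> phi x = 0) ->
  forall x, L / 2 - delta + s%:R * step <= `|x ord0 j| -> iter s (fdiff step j) phi x = 0.
Proof.
have h0 := step_gt0.
move=> out; elim: s => [|s IH] x; first by rewrite mul0r addr0; exact: out.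
rewrite -[s.+1%:R]natr1 mulrDl mul1r addrA => hx; rewrite iterS /fdiff.
rewrite !IH ?subrr //; first by apply: le_trans hx; rewrite lerDl ltW.
rewrite !mxE !eqxx mulr1; rewrite -lerBrDr in hx; apply: le_trans hx _.
have := ler_normB (x ord0 j + step) step.
by rewrite lerBlDr addrK (gtr0_norm h0).
Qed.

Lemma dft_iter_fdiff s delta phi k j : s%:R * step <= delta ->
  (forall x, L / 2 - delta <= `|x ord0 j| -> phi x = 0) ->
  dft (iter s (fdiff step j) phi) k =
    (cis (2 * pi * (((k j)%:R - n%:R) / n.*2%:R)) - 1) ^+ s * dft phi k.
Proof.
move=> sd out; elim: s sd => [|s IH] sd; first by rewrite expr0 mul1r.
have sd' : s%:R * step <= delta.
  by apply: le_trans sd; rewrite ler_wpM2r ?ler_nat // ltW // step_gt0.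
rewrite iterS dft_fdiff; first by rewrite IH // exprS mulrA.
move=> x hx; apply: (@iter_fdiff_out s delta phi j out x); apply: le_trans hx.
move: sd; rewrite -[s.+1%:R]natr1 mulrDl mul1r => sd; have := step_gt0; lra.
Qed.

Lemma normc_dft_le phi k B : (forall x, normc (phi x) <= B) -> normc (dft phi k) <= B.
Proof.
move=> hB; have Mp : (0 : R) < n.*2%:R by rewrite ltr0n double_gt0.
rewrite /dft normcM normc_real ger0_norm ?invr_ge0 ?exprn_ge0 // mulrC ler_pdivrMr ?exprn_gt0 //.
apply: le_trans (normc_sum _ _ _) _.
apply: (@le_trans _ _ (\sum_(kappa : idx) B)).
  by apply: ler_sum => kappa _; rewrite normcM normc_character mulr1.
by rewrite sumr_const card_ffun !card_ord -[_ *+ (_ ^ _)]mulr_natr natrX.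
Qed.

(** A difference of step [h] is at most [2 h] times a bound of the derivative
    ([increment_le]), while on the Fourier side it multiplies by at least
    [cos 1 / 2 * (2 pi h)] times the frequency ([cis_lower]); this is the
    quotient. *)
Definition kap : R := (cos 1 / 2 * (2 * pi))^-1 * 2.

Lemma kap_gt0 : 0 < kap.
Proof. by rewrite /kap mulr_gt0 // invr_gt0 !mulr_gt0 ?cos1_gt0 ?pi_gt0 ?invr_gt0. Qed.

(** Discrete counterpart of repeated integration by parts: differences replace
    derivatives, and the margin [delta] keeps the support of [s] of them away from
    the faces of the box. *)
Lemma dft_coord_decay s delta phi B k j : smooth setT phi -> s%:R * step <= delta ->
  (forall x, L / 2 - delta <= `|x ord0 j| -> phi x = 0) ->
  (forall x, jet_le s B phi x) ->
  normc (dft phi k) * `|freq k ord0 j| ^+ s <= kap ^+ s * B.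
Proof.
move=> sm sd out jB.
have p0 := @pi_gt0 R; have c0 := @cos1_gt0 R.
have Mp : (0 : R) < n.*2%:R by rewrite ltr0n double_gt0.
have h0 := step_gt0.
pose w := cos 1 / 2 * (2 * pi) : R.
have w0 : 0 < w by rewrite /w !mulr_gt0 // invr_gt0.
set r : R := (k j)%:R - n%:R.
have fE : freq k ord0 j = r / L by rewrite mxE.
have rM : `|r| <= n%:R.
  have eM : n.*2%:R = n%:R + n%:R :> R by rewrite -natrD addnn.
  have k1 : (k j)%:R < n%:R + n%:R :> R by rewrite -eM ltr_nat.
  have k2 : 0 <= (k j)%:R :> R by [].
  by rewrite /r ler_norml; apply/andP; split; lra.
have low : w * (`|r| / n.*2%:R) <= normc (cis (2 * pi * (r / n.*2%:R)) - 1).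
  have e : `|2 * pi * (r / n.*2%:R)| = 2 * pi * (`|r| / n.*2%:R).
    by rewrite normrM (gtr0_norm (x := 2 * pi)) ?mulr_gt0 // normf_div (gtr0_norm Mp).
  rewrite /w -mulrA -e; apply: cis_lower; rewrite e -mulrA mulrCA ger_pMr //.
  rewrite mulrA ler_pdivrMr // mul1r -mul2n natrM ler_pM2l //.
have eD : normc (dft (iter s (fdiff step j) phi) k) =
    normc (cis (2 * pi * (r / n.*2%:R)) - 1) ^+ s * normc (dft phi k).
  by rewrite (dft_iter_fdiff k sd out) normcM normcX.
have up : normc (dft (iter s (fdiff step j) phi) k) <= (2 * step) ^+ s * B.
  apply: normc_dft_le => x.
  have := @iter_fdiff_le R d step j s 0 B phi (ltW h0) sm.
  rewrite addn0 => /(_ jB x [::] isT); exact.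
rewrite eD in up.
have := le_trans (ler_wpM2r (normc_ge0 (dft phi k)) (lerXn2r s _ _ low)) up.
rewrite !nnegrE normc_ge0 mulr_ge0 ?(ltW w0) ?divr_ge0 // => /(_ isT isT) key.
have -> : `|freq k ord0 j| ^+ s = (w * (`|r| / n.*2%:R)) ^+ s * (n.*2%:R / (w * L)) ^+ s.
  rewrite -exprMn fE normf_div (gtr0_norm L0); congr (_ ^+ s).
  by field; rewrite M_neq0 !gt_eqF.
rewrite mulrA [X in X * _]mulrC.
have q0 : 0 <= (n.*2%:R / (w * L)) ^+ s by rewrite exprn_ge0 // divr_ge0 // mulr_ge0 // ltW.
apply: le_trans (ler_wpM2r q0 key) _.
rewrite mulrAC -exprMn.
have -> : 2 * step * (n.*2%:R / (w * L)) = kap.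
  rewrite /step /kap -/w; field; by rewrite M_neq0 !gt_eqF.
by [].
Qed.

(** The factor 2 comes from [1 + t <= 2 * max 1 t]. *)
Definition decay_rate : R := 2 * Num.max 1 kap.

Lemma decay_rate_ge1 : 1 <= decay_rate.
Proof. by rewrite /decay_rate; have : 1 <= Num.max 1 kap by [rewrite le_max lexx]; lra. Qed.

Lemma dft_decay s delta phi B k : smooth setT phi -> s%:R * step <= delta ->
  (forall j x, L / 2 - delta <= `|x ord0 j| -> phi x = 0) ->
  (forall x, jet_le s B phi x) ->
  normc (dft phi k) * (1 + `|freq k|) ^+ s <= decay_rate ^+ s * B.
Proof.
move=> sm sd out jB; set D := normc _; set t := `|_|.
have D0 : 0 <= D by apply: normc_ge0.
have B0 := jet_le_ge0 (jB 0).
have t0 : 0 <= t by apply: normr_ge0.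
have m1 : 1 <= Num.max 1 kap by rewrite le_max lexx.
have m0 : 0 <= Num.max 1 kap by apply: le_trans m1.
have DB : D <= B by apply: normc_dft_le => x; have := jB x [::] isT.
rewrite /decay_rate exprMn -mulrA.
have [t1|t1] := lerP t 1.
  apply: (@le_trans _ _ (2 ^+ s * D)).
    rewrite mulrC ler_wpM2r // lerXn2r ?nnegrE ?addr_ge0 //; lra.
  by rewrite ler_wpM2l ?exprn_ge0 //; apply: le_trans DB _; rewrite ler_peMl // exprn_ege1.
apply: (@le_trans _ _ (2 ^+ s * (D * t ^+ s))).
  rewrite mulrCA -exprMn ler_wpM2l // lerXn2r ?nnegrE ?addr_ge0 ?mulr_ge0 //; lra.
rewrite ler_wpM2l ?exprn_ge0 //.
have tne : mx_norm (freq k) != 0 by rewrite gt_eqF //; apply: lt_trans t1.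
have [[i j] /= e] := mx_norm_neq0 tne; rewrite (ord1 i) in e.
rewrite /t -[`|freq k|]/(mx_norm (freq k)) e.
apply: le_trans (dft_coord_decay k sm sd (out j) jB) _.
by rewrite ler_wpM2r // lerXn2r ?nnegrE ?(ltW kap_gt0) // le_max lexx orbT.
Qed.

Lemma sum_inv_sqr (N : nat) : \sum_(b < N) (b.+1%:R ^- 2 : R) <= 2 - N%:R^-1.
Proof.
elim: N => [|N IH]; first by rewrite big_ord0 invr0 subr0.
rewrite big_ord_recr /=; case: N IH => [|N] IH.
  by rewrite big_ord0 add0r expr1n invr1; lra.
apply: le_trans (lerD IH (lexx _)) _.
have a0 : (0 : R) < N.+1%:R by rewrite ltr0n.
have b0 : (0 : R) < N.+2%:R by rewrite ltr0n.
rewrite -addrA lerD2l -lerBrDl opprK addrC.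
have -> : N.+1%:R^-1 - N.+2%:R^-1 = (N.+1%:R * N.+2%:R)^-1 :> R.
  rewrite -[N.+2%:R]natr1; move: a0; set x : R := N.+1%:R => a0.
  by field; rewrite !gt_eqF // ltr_wpDr.
rewrite lef_pV2 ?posrE ?mulr_gt0 ?exprn_gt0 // expr2 ler_pM2r // ler_nat //.
Qed.

(** The exponent is chosen so that the sum splits into a product of convergent sums
    over the coordinates; the bound does not depend on the mesh. *)
Lemma sum_freq_inv : 1 <= L -> \sum_(k : idx) (1 + `|freq k|) ^- (2 * d) <= (4 * L ^+ 2) ^+ d.
Proof.
move=> L1.
pose F (b : 'I_n.*2) : R := L ^+ 2 * (1 + `|b%:R - n%:R|) ^- 2.
have pos (b : 'I_n.*2) : 0 < 1 + `|b%:R - n%:R| :> R by rewrite ltr_pwDl.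
apply: (@le_trans _ _ (\sum_(k : idx) \prod_j F (k j))).
  apply: ler_sum => k _.
  have -> : (1 + `|freq k|) ^- (2 * d) = \prod_(j < d) (1 + `|freq k|) ^- 2.
    by rewrite prodr_const card_ord exprVn -exprM.
  apply: ler_prod => j _; rewrite invr_ge0 exprn_ge0 ?addr_ge0 //=.
  rewrite /F -[L ^+ 2]invrK -invfM lef_pV2 ?posrE ?mulr_gt0 ?invr_gt0 ?exprn_gt0 ?ltr_pwDl //.
  rewrite -exprVn -exprMn lerXn2r ?nnegrE ?mulr_ge0 ?invr_ge0 ?addr_ge0 ?(ltW L0) //.
  rewrite mulrDr mulr1; apply: lerD; first by rewrite invf_le1.
  by apply: le_trans (norm_coord (freq k) j); rewrite mxE normrM mulrC (gtr0_norm (x := L^-1)) ?invr_gt0.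
rewrite -(bigA_distr_bigA (fun (_ : 'I_d) b => F b)) prodr_const card_ord.
apply: lerXn2r; rewrite ?nnegrE ?sumr_ge0 ?mulr_ge0 ?exprn_ge0 ?(ltW L0) //.
  by move=> b _; rewrite mulr_ge0 ?exprn_ge0 ?(ltW L0) // invr_ge0 exprn_ge0 // ltW.
rewrite -mulr_sumr mulrC ler_wpM2r ?exprn_ge0 ?(ltW L0) //.
have half : \sum_(b < n.*2) (1 + `|b%:R - n%:R|) ^- 2 <=
    \sum_(b < n) (b.+1%:R ^- 2 : R) + \sum_(b < n) (b.+1%:R ^- 2 : R).
  rewrite -!(big_mkord xpredT (fun b => b.+1%:R ^- 2)).
  rewrite -(big_mkord xpredT (fun b => (1 + `|b%:R - n%:R|) ^- 2)).
  rewrite (big_cat_nat (n := n)) //=; last by rewrite -addnn leq_addr.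
  apply: lerD.
    rewrite big_nat_rev /= add0n !big_nat; apply: ler_sum => b /andP[_ bn].
    rewrite natrB // addrAC subrr sub0r normrN normr_nat.
    rewrite lef_pV2 ?posrE ?exprn_gt0 ?ltr_pwDl // lerXn2r ?nnegrE ?addr_ge0 //.
    by rewrite lerDr.
  rewrite -{1}[n]add0n -addnn big_addn addnK !big_nat; apply: ler_sum => b _.
  by rewrite natrD addrK normr_nat nat1r.
have s2 := sum_inv_sqr n.
have i0 : 0 <= n%:R^-1 :> R by rewrite invr_ge0.
apply: le_trans half _; lra.
Qed.

End Interpolation.

(** ** Convergence of the interpolants *)

Section WeightedSums.
Variables (R : realType) (d n : nat) (L : R).
Hypotheses (n0 : (0 < n)%N) (L1 : 1 <= L).
Notation vec := 'rV[R]_d.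
Notation cfun := (vec -> R[i]).
Notation idx := {ffun 'I_d -> 'I_n.*2}.
Implicit Types (x xi : vec) (phi psi : cfun) (k kappa : idx) (j : 'I_d).

Let L0 : 0 < L. Proof. exact: lt_le_trans ltr01 L1. Qed.

Lemma weighted_dft_sum s delta psi B : smooth setT psi -> (s + 2 * d)%:R * step n L <= delta ->
  (forall j x, L / 2 - delta <= `|x ord0 j| -> psi x = 0) ->
  (forall x, jet_le (s + 2 * d) B psi x) ->
  \sum_(k : idx) normc (dft L psi k) * (1 + `|freq L k|) ^+ s <=
    decay_rate R ^+ (s + 2 * d) * B * (4 * L ^+ 2) ^+ d.
Proof.
move=> sm sd out jB.
have Q0 : 0 <= decay_rate R ^+ (s + 2 * d) * B.
  by rewrite mulr_ge0 ?(jet_le_ge0 (jB 0)) // exprn_ge0 // (le_trans _ (decay_rate_ge1 R)).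
apply: le_trans (ler_wpM2l Q0 (sum_freq_inv d n L0 L1)).
rewrite mulr_sumr; apply: ler_sum => k _.
have f0 : 0 < (1 + `|freq L k|) ^+ (2 * d) by rewrite exprn_gt0 // ltr_pwDl.
rewrite ler_pdivlMr // -mulrA -exprD.
exact: (dft_decay n0 L0 k sm sd out jB).
Qed.

Lemma smooth_trig psi : smooth setT (trig n L psi) /\ forall s x,
  cpartials s (trig n L psi) x = \sum_(k : idx) dft L psi k * cpartials s (character (- freq L k)) x.
Proof.
have h (k : idx) := smoothZ_cpartials (dft L psi k) openT (@smooth_character R d setT (- freq L k)).
have [s1 e1] := smooth_sum_cpartials (index_enum idx) openT (fun k => proj1 (h k)).
split=> // s x; rewrite e1 //; apply: eq_bigr => k _.
by have [_ ->] := h k.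
Qed.

Lemma jet_le_trig s delta psi B : smooth setT psi -> (s + 2 * d)%:R * step n L <= delta ->
  (forall j x, L / 2 - delta <= `|x ord0 j| -> psi x = 0) ->
  (forall x, jet_le (s + 2 * d) B psi x) ->
  forall x, jet_le s ((2 * pi) ^+ s * (decay_rate R ^+ (s + 2 * d) * B * (4 * L ^+ 2) ^+ d)) (trig n L psi) x.
Proof.
move=> sm sd out jB x t ts; have [_ ->] := smooth_trig psi.
apply: le_trans (normc_sum _ _ _) _.
have p1 : 1 <= 2 * pi :> R by have := @pi_ge2 R; lra.
have p0 : 0 <= 2 * pi :> R by apply: le_trans p1.
apply: le_trans (ler_wpM2l (exprn_ge0 _ p0) (weighted_dft_sum sm sd out jB)).
rewrite mulr_sumr; apply: ler_sum => k _; rewrite normcM mulrCA ler_wpM2l ?normc_ge0 // -exprMn.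
apply: le_trans (jet_le_character _ _ ts) _; rewrite normrN.
have f0 := normr_ge0 (freq L k).
apply: lerXn2r; rewrite ?nnegrE ?addr_ge0 ?(mulr_ge0 p0) ?addr_ge0 //.
have -> : 2 * pi * (1 + `|freq L k|) = 2 * pi + 2 * pi * `|freq L k| by ring.
by rewrite lerD2r.
Qed.

End WeightedSums.

Section DifferenceQuotients.
Variables (R : realType) (d : nat) (h : R).
Hypothesis h0 : 0 < h.
Notation vec := 'rV[R]_d.
Notation cfun := (vec -> R[i]).
Implicit Types (x : vec) (phi psi g : cfun) (j : 'I_d) (t : seq 'I_d).

Fixpoint fdiffs t phi : cfun := if t is j :: t' then fdiffs t' (fdiff h j phi) else phi.

Definition lattice (z : 'I_d -> int) : vec := \row_j ((z j)%:~R * h).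

Lemma fdiffs_lattice0 t phi (a b : int) :
  (forall z, (forall j, a <= z j < b) -> phi (lattice z) = 0) ->
  forall z, (forall j, a <= z j /\ z j + (size t)%:Z < b) -> fdiffs t phi (lattice z) = 0.
Proof.
elim: t phi b => [|j t IH] phi b H z hz /=.
  by apply: H => j; have [-> /=] := hz j; rewrite addr0.
apply: (IH _ (b - 1)).
  move=> w hw; rewrite /fdiff.
  have e : lattice w + h *: unit_vec R j = lattice (fun i => w i + (i == j)%:Z).
    apply/rowP => i; rewrite !mxE intrD mulrDl; congr (_ + _).
    by rewrite eqxx /= mulrC; case: (i == j).
  rewrite e !H ?subrr // => i; have /andP[w1 w2] := hw i.
    by rewrite w1 /=; lia.
  by case: (i == j); apply/andP; split; lia.
by move=> i; have [z1 z2] := hz i; split=> //; move: z2 => /=; lia.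
Qed.

Lemma fdiffs_approx t phi C : smooth setT phi -> (forall x, jet_le (size t).+1 C phi x) ->
  forall x, normc (fdiffs t phi x - (h ^+ size t)%:C * cpartials t phi x) <=
    2 ^+ (size t).+1 * C * h ^+ (size t).+1.
Proof.
(* the sharper constant is the one that reproduces itself in the induction *)
suff H : smooth setT phi -> (forall x, jet_le (size t).+1 C phi x) ->
  forall x, normc (fdiffs t phi x - (h ^+ size t)%:C * cpartials t phi x) <=
    (2 ^+ (size t).+1 - 2) * C * h ^+ (size t).+1.
  move=> sm jC x; apply: le_trans (H sm jC x) _.
  rewrite ler_wpM2r ?exprn_ge0 ?(ltW h0) // ler_wpM2r ?(jet_le_ge0 (jC x)) //.
  by rewrite gerDl oppr_le0.
elim: t phi C => [|j t IH] phi C sm jC x.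
  by rewrite /= expr0 mul1r subrr normc0 expr1 subrr !mul0r.
have [sd ed] := smooth_fdiff h j sm.
have jd : forall y, jet_le (size t).+1 (2 * h * C) (fdiff h j phi) y.
  by apply: jet_le_fdiff => //; exact: ltW.
have a1 := IH _ _ sd jd x.
have a2 : normc (fdiff h j (cpartials t phi) x - h%:C * cpartials (j :: t) phi x) <= 2 * h ^+ 2 * C.
  apply: increment2_le; [exact: smooth_cpartials|exact: ltW|].
  by move=> y; rewrite -cpartials_cat; apply: jC.
rewrite ed in a1.
set F := fdiffs _ _ _ in a1; set G := fdiff _ _ _ _ in a1 a2; set D := cpartials _ _ _ in a2.
rewrite -[fdiffs _ _ _]/F -/D [size _]/=.
have -> : F - (h ^+ (size t).+1)%:C * D = (F - (h ^+ size t)%:C * G) + (h ^+ size t)%:C * (G - h%:C * D).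
  by rewrite exprSr rmorphM; ring.
apply: le_trans (normcD _ _) _; rewrite normcM normc_real ger0_norm ?exprn_ge0 ?(ltW h0) //.
apply: le_trans (lerD a1 (ler_wpM2l (exprn_ge0 (size t) (ltW h0)) a2)) _.
rewrite le_eqVlt; apply/orP; left; apply/eqP; rewrite !exprS; ring.
Qed.

Lemma path_increment (l : seq 'I_d) phi B (r : 'I_d -> R) y : smooth setT phi ->
  (forall j, 0 <= r j <= h) -> (forall x, jet_le 1 B phi x) ->
  normc (phi (y + \sum_(j <- l) r j *: unit_vec R j) - phi y) <= (size l)%:R * (2 * h * B).
Proof.
move=> sm hr jB; elim: l y => [|j l IH] y.
  by rewrite big_nil addr0 subrr normc0 mul0r.
rewrite big_cons addrA; have /andP[r0 rh] := hr j.
set w := y + r j *: _.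
have -> : phi (w + \sum_(j0 <- l) r j0 *: unit_vec R j0) - phi y =
  (phi (w + \sum_(j0 <- l) r j0 *: unit_vec R j0) - phi w) + (phi w - phi y) by ring.
apply: le_trans (normcD _ _) _; rewrite [size _]/= -natr1 mulrDl mul1r; apply: lerD; first exact: IH.
apply: le_trans (increment_le y sm r0 (fun x => jB x [:: j] isT)) _.
by rewrite ler_wpM2r ?(jet_le_ge0 (jB 0)) // ler_wpM2l.
Qed.

(** At the lattice points the iterated differences vanish, and they approximate
    the derivatives, which vary little from there to the nearest points. *)
Lemma small_of_lattice0 s g C rho (m : nat) : smooth setT g -> (forall x, jet_le s.+1 C g x) ->
  (forall z, (forall j, - m%:Z <= z j < m%:Z) -> g (lattice z) = 0) ->
  rho + s%:R * h < m%:R * h ->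
  forall x, `|x| <= rho -> jet_le s ((2 ^+ s.+1 + d%:R * 2) * C * h) g x.
Proof.
move=> sm jC g0 rs x xr t ts.
have C0 := jet_le_ge0 (jC 0).
pose z j : int := Num.floor (x ord0 j / h).
have zlo j : (z j)%:~R * h <= x ord0 j.
  by rewrite -ler_pdivlMr //; exact: floor_le.
have zhi j : x ord0 j <= (z j)%:~R * h + h.
  rewrite -[X in _ + X]mul1r -mulrDl -ler_pdivrMr // ltW //.
  by rewrite -[1]/(1%:~R) -intrD; have /andP[] := floor_itv (x ord0 j / h).
have tn : (size t)%:R * h <= s%:R * h by rewrite ler_wpM2r ?(ltW h0) // ler_nat.
have s0 : 0 <= s%:R * h by rewrite mulr_ge0 // ltW.
have hz j : - m%:Z <= z j /\ z j + (size t)%:Z < m%:Z.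
  have := norm_coord x j; move=> /le_trans/(_ xr); rewrite ler_norml => /andP[x1 x2]; split.
    rewrite /z floor_ge_int // intrN ler_pdivlMr // mulNr.
    by apply: le_trans x1; rewrite lerN2; lra.
  rewrite -(ltr_int R) intrD -(ltr_pM2r h0) mulrDl.
  by have := zlo j; rewrite -!pmulrn; lra.
have at_lattice : normc (cpartials t g (lattice z)) <= 2 ^+ s.+1 * C * h.
  have jt : forall x, jet_le (size t).+1 C g x by move=> y; apply: jet_leW (jC y).
  have := fdiffs_approx sm jt (lattice z).
  rewrite (fdiffs_lattice0 g0 hz) sub0r (normcN ((h ^+ size t)%:C * _)) normcM normc_real.
  rewrite ger0_norm ?exprn_ge0 ?(ltW h0) // [h ^+ _.+1]exprS [X in _ <= X]mulrA.
  rewrite [X in X <= _]mulrC ler_pM2r ?exprn_gt0 // => /le_trans; apply.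
  by rewrite !ler_wpM2r ?(ltW h0) // ler_weXn2l // ler1n.
have xE : x = lattice z + \sum_(j <- index_enum 'I_d) (x ord0 j - (z j)%:~R * h) *: unit_vec R j.
  apply/rowP => i; rewrite !mxE summxE (bigD1 i) //= big1 ?addr0.
    by rewrite !mxE !eqxx mulr1 addrC subrK.
  by move=> j ji; rewrite !mxE [i == j]eq_sym (negbTE ji) andbF mulr0.
have hr j : 0 <= x ord0 j - (z j)%:~R * h <= h.
  by rewrite subr_ge0 zlo /= lerBlDl zhi.
have jt1 : forall y, jet_le 1 C (cpartials t g) y.
  by move=> y; apply: jet_le_cpartials; apply: jet_leW (jC y).
have := path_increment (index_enum 'I_d) (lattice z) (smooth_cpartials t sm) hr jt1.
rewrite -xE => inc.
have -> : cpartials t g x = (cpartials t g x - cpartials t g (lattice z)) + cpartials t g (lattice z) by ring.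
apply: le_trans (normcD _ _) _; apply: le_trans (lerD inc at_lattice) _.
have -> : size (index_enum 'I_d) = d by rewrite -[RHS]card_ord cardT enumT.
rewrite le_eqVlt; apply/orP; left; apply/eqP; ring.
Qed.

End DifferenceQuotients.

Section Convergence.
Variables (R : realType) (d : nat) (L : R).
Hypothesis L1 : 1 <= L.
Notation vec := 'rV[R]_d.
Notation cfun := (vec -> R[i]).
Implicit Types (x xi : vec) (psi : cfun).

Let L0 : 0 < L. Proof. exact: lt_le_trans ltr01 L1. Qed.

(** The interpolants have bounded derivatives, uniformly in the mesh, and agree
    with [psi] on a lattice that becomes finer and finer. *)
Lemma trig_error psi s rho : smooth setT psi -> rho + 1 < L / 2 ->
  (forall k, exists B, forall x, jet_le k B psi x) ->
  (forall j x, L / 2 - 1 <= `|x ord0 j| -> psi x = 0) ->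
  exists2 E : R, 0 <= E & forall n, (0 < n)%N -> (s.+1 + 2 * d)%:R * step n L <= 1 ->
    forall x, `|x| <= rho -> jet_le s (E * step n L) (fun y => psi y - trig n L psi y) x.
Proof.
move=> sm rL jB out; have [B hB] := jB (s.+1 + 2 * d)%N.
pose T := (2 * pi) ^+ s.+1 * (decay_rate R ^+ (s.+1 + 2 * d) * B * (4 * L ^+ 2) ^+ d).
have B0 := jet_le_ge0 (hB 0).
have T0 : 0 <= T.
  have p0 := @pi_ge0 R; have q0 : 0 <= decay_rate R by apply: le_trans (decay_rate_ge1 R).
  apply: mulr_ge0; first by apply: exprn_ge0; exact: mulr_ge0.
  apply: mulr_ge0; first by apply: mulr_ge0 => //; exact: exprn_ge0.
  by apply: exprn_ge0; apply: mulr_ge0 => //; apply: exprn_ge0; exact: ltW.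
exists ((2 ^+ s.+1 + d%:R * 2) * (B + T)).
  apply: mulr_ge0; last exact: addr_ge0.
  by apply: addr_ge0; [exact: exprn_ge0|exact: mulr_ge0].
move=> n n0 hn x xr.
have h0 := step_gt0 n0 L0.
have [st et] := smooth_trig n L psi.
have eg : (fun y => psi y - trig n L psi y) = (fun y => psi y + -1 * trig n L psi y).
  by apply: funext => y; rewrite mulN1r.
have [st' _] := smoothZ_cpartials (-1) openT st.
have jt := jet_le_trig n0 L1 sm hn out hB.
rewrite eg; apply: (@small_of_lattice0 _ _ (step n L) h0 s _ _ rho n _ _ _ _ x xr).
- exact: smoothD openT sm st'.
- move=> y; have jz := jet_leZ (-1) openT I st (jt y).
  rewrite (normcN 1) normc1 mul1r in jz.
  exact: (jet_leD openT I sm st' (jet_leW (leq_addr _ _) (lexx B) (hB y)) jz).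
- move=> z hz; rewrite mulN1r.
  have kz j : (`|(z j + n%:Z)%R|%N < n.*2)%N by have := hz j; rewrite -addnn; lia.
  pose kappa : {ffun 'I_d -> 'I_n.*2} := [ffun j => Ordinal (kz j)].
  have -> : lattice (step n L) z = grid L kappa.
    apply/rowP => j; rewrite !mxE ffunE /=; congr (_ * _).
    have -> : (`|(z j + n%:Z)%R|%N)%:R = (z j + n%:Z)%:~R :> R.
      by rewrite pmulrn gez0_abs //; have := hz j; lia.
    by rewrite intrD pmulrn addrK.
  by rewrite (trig_grid n0 L0) subrr.
have half : n%:R * step n L = L / 2.
  rewrite /step -mul2n natrM; field; by rewrite pnatr_eq0 -lt0n.
rewrite half; apply: le_lt_trans rL; rewrite lerD2l; apply: le_trans hn.
by rewrite ler_wpM2r ?(ltW h0) // ler_nat addSn ltnW // ltnS leq_addr.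
Qed.

End Convergence.

(** * Localised Fourier transforms *)

Section Inversion.
Variables (R : realType) (d : nat) (U : set 'rV[R]_d) (rho : R).
Hypotheses (oU : open U) (rho0 : 0 <= rho).
Notation vec := 'rV[R]_d.
Notation cfun := (vec -> R[i]).
Implicit Types (x xi : vec) (phi psi chi : cfun) (v : cfun -> R[i]).

(** A box so large that a cut-off of the support fits in it with a margin. *)
Definition period : R := 4 * rho + 8.

Lemma period_ge1 : 1 <= period.
Proof. rewrite /period; have := rho0; lra. Qed.

(** The interpolant of [psi] is a finite sum of characters, on which [v] takes the
    values of its Fourier transform; the error of interpolation is small in the
    norms for which [v] is continuous, hence contributes at most [eps]. *)
Lemma fourier_inversion v psi xi (s0 : nat) (eps : R) : compact_distribution U v ->
  (forall phi, test U phi -> (forall x, `|x| <= rho -> phi x = 0) -> v phi = 0) ->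
  test U psi -> (forall x, rho <= `|x| -> psi x = 0) -> 0 < eps ->
  exists n, [/\ (0 < n)%N, s0%:R * step n period <= 1 &
    normc (v (fun x => character xi x * psi x)) <=
      (\sum_(k : {ffun 'I_d -> 'I_n.*2}) normc (dft period psi k) *
         normc (fourier U v (xi - freq period k))) + eps].
Proof.
move=> cv sv tp out e0.
have L1 := period_ge1; have L0 : 0 < period by apply: lt_le_trans L1.
have [chi [tc pE e1]] := compact_cutoff oU cv.
have [dv _] := cv; have [lin hb] := (is_distributionP v oU).1 dv.
have rho1 : 0 < rho + 1 by rewrite ltr_wpDl.
have [kap [sk kout k1 _]] := cutoff_cube (0 : vec) rho1.
have [_ cK KU] := tc.
have [C [kk [C0 hC]]] := hb _ cK KU.
have tchi xi' : test U (fun x => chi x * character xi' x).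
  by apply: testM => //; exact: smooth_character.
pose P x := chi x * character xi x.
have tP : test U P by exact: tchi.
have tkP : test U (fun x => P x * kap x).
  by apply: testM => //; apply: smooth_sub sk.
have [A hA] := test_jet_le kk tkP.
have smp := test_smooth tp.
have outj j x : period / 2 - 1 <= `|x ord0 j| -> psi x = 0.
  move=> h; apply: out; apply: le_trans (norm_coord x j); apply: le_trans h.
  by rewrite /period; have := rho0; lra.
have jB k : exists B, forall x, jet_le k B psi x by exact: test_jet_le tp.
have margin : 2 * (rho + 1) + 1 < period / 2 by rewrite /period; lra.
have [E E0 hE] := trig_error L1 kk smp margin jB outj.
pose Q := C * (2 ^+ kk * (A * E)).
have A0 := jet_le_ge0 (hA 0).
have Q0 : 0 <= Q by rewrite !mulr_ge0 // exprn_ge0.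
have Qe : 0 <= Q / eps by rewrite divr_ge0 // ltW.
pose W := s0%:R + ((kk.+1 + 2 * d)%:R + Q / eps).
have W0 : 0 <= W by rewrite !addr_ge0.
pose n := (Num.bound (period * W)).+1.
have n0 : (0 < n)%N by [].
have h0 := step_gt0 n0 L0.
have hn : step n period * W <= 1.
  have Mp : (0 : R) < n.*2%:R by rewrite ltr0n double_gt0.
  rewrite /step mulrAC ler_pdivrMr // mul1r; apply: (@le_trans _ _ (Num.bound (period * W))%:R).
    by apply: ltW; apply: archi_boundP; rewrite mulr_ge0 // ltW.
  by rewrite ler_nat /n doubleS; apply: leq_trans (leqnSn _); apply: leq_trans (leqnSn _); rewrite -addnn leq_addr.
have hn' (w : R) : w <= W -> w * step n period <= 1.
  by move=> wW; apply: le_trans hn; rewrite mulrC ler_wpM2l // ltW.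
have b1 : s0%:R * step n period <= 1.
  by apply: hn'; rewrite /W lerDl addr_ge0.
have b2 : (kk.+1 + 2 * d)%:R * step n period <= 1.
  by apply: hn'; rewrite /W addrCA lerDl addr_ge0.
have b3 : Q * step n period <= eps.
  have : Q / eps * step n period <= 1 by apply: hn'; rewrite /W addrA lerDr addr_ge0.
  by rewrite mulrAC ler_pdivrMr // mul1r.
exists n; split=> //.
have [st _] := smooth_trig n period psi.
pose g := fun y => psi y + -1 * trig n period psi y.
have sg : smooth setT g.
  by apply: smoothD openT smp _; have [] := smoothZ_cpartials (-1) openT st.
have tPg : test U (fun x => P x * g x) by apply: testM => //; apply: smooth_sub sg.
have tPt : test U (fun x => P x * trig n period psi x) by apply: testM => //; apply: smooth_sub st.
have tPp : test U (fun x => P x * psi x) by apply: testM => //; apply: smooth_sub smp.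
have tep : test U (fun x => character xi x * psi x).
  rewrite (_ : (fun _ => _) = fun x => psi x * character xi x); last by apply: funext => x; rewrite mulrC.
  by apply: testM => //; exact: smooth_character.
have eq1 : v (fun x => character xi x * psi x) =
    v (fun x => P x * trig n period psi x) + v (fun x => P x * g x).
  rewrite -(distrD lin) //.
  have -> : (fun x => P x * trig n period psi x + P x * g x) = fun x => P x * psi x.
    by apply: funext => x; rewrite /g; ring.
  by apply: e1 => // x c1; rewrite /P c1 mul1r.
have eq2 : v (fun x => P x * trig n period psi x) =
    \sum_(k : {ffun 'I_d -> 'I_n.*2}) dft period psi k * fourier U v (xi - freq period k).
  transitivity (\sum_(k : {ffun 'I_d -> 'I_n.*2}) dft period psi k *
      v (fun x => chi x * character (xi - freq period k) x)); last first.
    by apply: eq_bigr => k _; rewrite /fourier pE //; exact: smooth_character.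
  rewrite -(distr_sum lin) //; congr v; apply: funext => x; rewrite /trig mulr_sumr.
  by apply: eq_bigr => k _; rewrite /P characterD; ring.
have eq3 : v (fun x => P x * g x) = v (fun x => (P x * kap x) * g x).
  have tkg : test U (fun x => (P x * kap x) * g x) by apply: testM => //; apply: smooth_sub sg.
  apply/eqP; rewrite -subr_eq0 -(distrB lin) //; apply/eqP; apply: sv.
    rewrite (_ : (fun _ => _) = fun x => P x * g x + -1 * (P x * kap x * g x)).
      exact: (testD tPg (testZ (-1) tkg)).
    by apply: funext => x; rewrite mulN1r.
  move=> x xr; rewrite k1 ?mulr1 ?subrr // subr0.
  by apply: le_trans xr _; rewrite lerDl.
rewrite eq1; apply: le_trans (normcD _ _) _; apply: lerD.
  rewrite eq2; apply: le_trans (normc_sum _ _ _) _.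
  by apply: ler_sum => k _; rewrite normcM.
rewrite eq3; apply: le_trans b3.
have tkg : test U (fun x => (P x * kap x) * g x) by apply: testM => //; apply: smooth_sub sg.
have sup : fsupport (fun x => (P x * kap x) * g x) `<=` fsupport chi.
  by move=> x /fsupportM[/fsupportM[/fsupportM[]]].
have jets x : jet_le kk (2 ^+ kk * (A * (E * step n period))) (fun x => (P x * kap x) * g x) x.
  have [xin|xout] := lerP `|x| (2 * (rho + 1)).
    have gE : (fun y => psi y - trig n period psi y) = g.
      by apply: funext => y; rewrite /g mulN1r.
    have := hE n n0 b2 x xin; rewrite gE => jg.
    exact: (jet_leM openT I (test_smooth tkP) sg (hA x) jg).
  move=> s _; rewrite cpartials_out ?normc0; first by rewrite !mulr_ge0 ?exprn_ge0 // ltW.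
  move=> /fsupportM[/fsupportM[_ sk1] _].
  have : `|x - 0| <= 2 * (rho + 1) by apply: (fsupport_sub (@closed_cube _ _ 0 _) kout sk1).
  by rewrite subr0 leNgt xout.
apply: le_trans (hC _ _ tkg sup jets) _.
by rewrite le_eqVlt; apply/orP; left; apply/eqP; rewrite /Q; ring.
Qed.

(** The transform of [psi v] near a frequency [xi] sees [v] at frequencies close
    to [xi], where the decay of [v] is used, and at remote ones, where the decay of
    the coefficients of [psi] beats the polynomial growth of [v]. *)
Lemma localized_fourier_bound (k0 : nat) (e0 : R) : 0 < e0 ->
  exists Q0 Q1 : R, [/\ 0 < Q0, 0 < Q1 & forall v psi xi (p : nat) (T B : R),
    compact_distribution U v ->
    (forall phi, test U phi -> (forall x, `|x| <= rho -> phi x = 0) -> v phi = 0) ->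
    (forall eta, normc (fourier U v eta) <= k0%:R * (1 + 2 * pi * `|eta|) ^+ k0) ->
    test U psi -> (forall x, rho <= `|x| -> psi x = 0) ->
    (forall x, jet_le (p + k0 + 2 * d) B psi x) ->
    xi != 0 -> 0 <= T ->
    (forall eta, `|eta| <= e0 * `|xi| -> normc (fourier U v (xi - eta)) <= T) ->
    normc (v (fun x => character xi x * psi x)) <= Q0 * B * (T + Q1 ^+ p / `|xi| ^+ p)].
Proof.
move=> e00.
have L1 := period_ge1; have L0 : 0 < period by apply: lt_le_trans L1.
have q1 := decay_rate_ge1 R; have q0 : 0 < decay_rate R by apply: lt_le_trans q1.
have p0 := @pi_ge0 R.
pose Lam := (4 * period ^+ 2) ^+ d : R.
have Lam0 : 0 < Lam by rewrite exprn_gt0 // mulr_gt0 // exprn_gt0.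
pose c2 := 1 + 2 * pi * (e0^-1 + 1) : R.
have c20 : 0 < c2 by rewrite ltr_pwDl // !mulr_ge0 // addr_ge0 // invr_ge0 ltW.
pose Q0 := decay_rate R ^+ (2 * d) * Lam + k0%:R * c2 ^+ k0 * (decay_rate R ^+ (k0 + 2 * d) * Lam).
exists Q0, (decay_rate R / e0); split.
- apply: ltr_pwDl; first by apply: mulr_gt0 => //; exact: exprn_gt0.
  apply: mulr_ge0; first by apply: mulr_ge0 => //; apply: exprn_ge0; exact: ltW.
  by apply: mulr_ge0; [apply: exprn_ge0; exact: ltW|exact: ltW].
- exact: divr_gt0.
move=> v psi xi p T B cv sv hv tp out jB xi0 T0 hT.
have x0 : 0 < `|xi| by rewrite normr_gt0.
have B0 := jet_le_ge0 (jB 0).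
apply/ler_addgt0Pr => eps eps0.
have [n [n0 hn hmain]] := fourier_inversion xi (p + k0 + 2 * d) cv sv tp out eps0.
apply: le_trans hmain _; rewrite lerD2r.
have smp := test_smooth tp.
have outj j x : period / 2 - 1 <= `|x ord0 j| -> psi x = 0.
  move=> h; apply: out; apply: le_trans (norm_coord x j); apply: le_trans h.
  by rewrite /period; have := rho0; lra.
have h0 := step_gt0 n0 L0.
pose w (s : nat) := \sum_(k : {ffun 'I_d -> 'I_n.*2}) normc (dft period psi k) * (1 + `|freq period k|) ^+ s.
have ws s : (s <= p + k0)%N -> w s <= decay_rate R ^+ (s + 2 * d) * B * Lam.
  move=> sp; apply: (weighted_dft_sum n0 L1 smp _ outj).
    by apply: le_trans hn; rewrite ler_wpM2r ?(ltW h0) // ler_nat leq_add2r.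
  by move=> x; apply: jet_leW (jB x) => //; rewrite leq_add2r.
apply: (@le_trans _ _ (w 0 * T + w (p + k0)%N * (k0%:R * c2 ^+ k0 / (e0 * `|xi|) ^+ p))).
  rewrite /w !mulr_suml -big_split; apply: ler_sum => k _ /=.
  rewrite expr0 mulr1 -[X in _ <= _ + X]mulrA -mulrDr ler_wpM2l ?normc_ge0 //.
  set f := `|freq period k|; have f0 : 0 <= f by apply: normr_ge0.
  have tail0 : 0 <= (1 + f) ^+ (p + k0) * (k0%:R * c2 ^+ k0 / (e0 * `|xi|) ^+ p).
    apply: mulr_ge0; first by apply: exprn_ge0; exact: addr_ge0.
    apply: divr_ge0; first by apply: mulr_ge0 => //; apply: exprn_ge0; exact: ltW.
    by apply: exprn_ge0; apply: mulr_ge0 => //; exact: ltW.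
  have [near|far] := lerP f (e0 * `|xi|).
    exact: (ler_wpDr tail0 (hT _ near)).
  apply: (ler_wpDl T0); apply: le_trans (hv _) _.
  rewrite -[X in _ <= _ * X]mulrA [X in _ <= X]mulrCA ler_wpM2l // exprD.
  have far' : `|xi| <= e0^-1 * f by rewrite -ler_pdivrMl ?invr_gt0 // invrK ltW.
  have bd : 1 + 2 * pi * `|xi - freq period k| <= c2 * (1 + f).
    have tri : `|xi - freq period k| <= (e0^-1 + 1) * f.
      by apply: le_trans (ler_normB _ _) _; rewrite mulrDl mul1r lerD2r.
    have pp : 0 <= 2 * pi :> R by rewrite mulr_ge0.
    have m0 : 0 <= (e0^-1 + 1) * f by rewrite mulr_ge0 ?addr_ge0 // invr_ge0 ltW.
    apply: (@le_trans _ _ (1 + 2 * pi * ((e0^-1 + 1) * f))); first by rewrite lerD2l ler_wpM2l.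
    rewrite [2 * pi * (_ * f)]mulrA /c2; set q := 2 * pi * _.
    have qpos : 0 <= q by rewrite mulr_ge0 // addr_ge0 // invr_ge0 ltW.
    have -> : (1 + q) * (1 + f) = 1 + q * f + (f + q) by ring.
    by rewrite lerDl addr_ge0.
  apply: (@le_trans _ _ ((c2 * (1 + f)) ^+ k0)).
    apply: lerXn2r; rewrite ?nnegrE //; last by apply: mulr_ge0; [exact: ltW|exact: addr_ge0].
    by apply: addr_ge0 => //; apply: mulr_ge0 => //; exact: mulr_ge0.
  rewrite exprMn [X in _ <= X](_ : _ = c2 ^+ k0 * (1 + f) ^+ k0 * ((1 + f) ^+ p / (e0 * `|xi|) ^+ p)); last by ring.
  have z0 : 0 <= c2 ^+ k0 * (1 + f) ^+ k0.
    by apply: mulr_ge0; apply: exprn_ge0; [exact: ltW|exact: addr_ge0].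
  rewrite -[X in X <= _]mulr1 ler_wpM2l //.
  rewrite ler_pdivlMr ?exprn_gt0 ?mulr_gt0 // mul1r.
  apply: lerXn2r; rewrite ?nnegrE ?addr_ge0 //; first by apply: mulr_ge0 => //; exact: ltW.
  by apply: le_trans (ltW far) _; rewrite lerDr.
have r0 : 0 <= k0%:R * c2 ^+ k0 / (e0 * `|xi|) ^+ p.
  apply: divr_ge0; first by apply: mulr_ge0 => //; apply: exprn_ge0; exact: ltW.
  by apply: exprn_ge0; apply: mulr_ge0 => //; exact: ltW.
apply: le_trans (lerD (ler_wpM2r T0 (ws 0 (leq0n _))) (ler_wpM2r r0 (ws _ (leqnn _)))) _.
rewrite add0n.
have Y0 : 0 <= (decay_rate R / e0) ^+ p / `|xi| ^+ p.
  by apply: divr_ge0; apply: exprn_ge0 => //; apply: divr_ge0; exact: ltW.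
have a0 : 0 <= decay_rate R ^+ (2 * d) * Lam.
  by apply: mulr_ge0; [apply: exprn_ge0; exact: ltW|exact: ltW].
have b0 : 0 <= k0%:R * c2 ^+ k0 * (decay_rate R ^+ (k0 + 2 * d) * Lam).
  apply: mulr_ge0; first by apply: mulr_ge0 => //; apply: exprn_ge0; exact: ltW.
  by apply: mulr_ge0; [apply: exprn_ge0; exact: ltW|exact: ltW].
have -> : decay_rate R ^+ (p + k0 + 2 * d) * B * Lam * (k0%:R * c2 ^+ k0 / (e0 * `|xi|) ^+ p) =
    k0%:R * c2 ^+ k0 * (decay_rate R ^+ (k0 + 2 * d) * Lam) * B * ((decay_rate R / e0) ^+ p / `|xi| ^+ p).
  rewrite -addnA exprD !exprMn exprVn invfM; ring.
have -> : decay_rate R ^+ (2 * d) * B * Lam * T = decay_rate R ^+ (2 * d) * Lam * B * T by ring.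
rewrite /Q0; set a := decay_rate R ^+ (2 * d) * Lam in a0 *; set b := k0%:R * c2 ^+ k0 * _ in b0 *.
set Y := _ / _ in Y0 *.
rewrite mulrDr !mulrDl; apply: lerD.
  by rewrite lerDl mulr_ge0 // mulr_ge0.
by rewrite lerDr mulr_ge0 // mulr_ge0.
Qed.

End Inversion.

(** * Elliptic regularity *)

Section Localization.
Variables (R : realType) (d : nat) (U : set 'rV[R]_d).
Hypothesis oU : open U.
Notation vec := 'rV[R]_d.
Notation cfun := (vec -> R[i]).
Implicit Types (x xi : vec) (phi psi chi : cfun) (u v : cfun -> R[i]).

Definition localize chi u : cfun -> R[i] := fun phi => u (fun x => chi x * phi x).

Lemma localize_compact chi u : is_distribution U u -> test U chi ->
  compact_distribution U (localize chi u) /\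
  forall phi, smooth U phi -> pairing U (localize chi u) phi = localize chi u phi.
Proof.
move=> /(is_distributionP _ oU)[lin hb] tc.
have [smc cK KU] := tc.
have lin' : linear_on U (localize chi u).
  move=> z phi psi t1 t2; rewrite /localize -lin; last 2 first.
  - by apply: testM => //; exact: test_smoothW t1.
  - by apply: testM => //; exact: test_smoothW t2.
  by congr u; apply: funext => x; ring.
have sup : supported_in U (fsupport chi) (localize chi u).
  move=> phi t e; rewrite /localize -[RHS](distr0 lin); congr u; apply: funext => x.
  have [/eqP->|ne] := boolP (chi x == 0); first by rewrite mul0r.
  have [/eqP->|ne'] := boolP (phi x == 0); first by rewrite mulr0.
  have : (fsupport phi `&` fsupport chi) x by split; exact: fsupport_incl.
  by rewrite e.
split.
  split; last by exists (fsupport chi).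
  apply/(is_distributionP _ oU); split=> // K cK' KU'.
  have [C [k [C0 hC]]] := hb _ cK KU.
  have [A hA] := test_jet_le k tc.
  have A0 := jet_le_ge0 (hA 0).
  exists (C * (2 ^+ k * A)), k; split; first by rewrite !mulr_ge0 // exprn_ge0.
  move=> phi M t _ jM; rewrite /localize -mulrA -[2 ^+ k * A * M]mulrA; apply: hC.
  - by apply: testM => //; exact: test_smoothW t.
  - by move=> x /fsupportM[].
  - by move=> x; exact: (jet_leM openT I smc (test_smooth t) (hA x) (jM x)).
move=> phi sm.
have [chi0 t0 [W oW [KW W1]]] := cutoff_compact oU cK KU.
rewrite (pairingE oU lin' cK KU sup t0 oW KW W1 sm) /localize; congr u; apply: funext => x.
have [/eqP->|ne] := boolP (chi x == 0); first by rewrite !mul0r.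
by rewrite W1 ?mul1r //; apply: KW; exact: fsupport_incl.
Qed.

Lemma localize_bounded chi u : is_distribution U u -> test U chi ->
  bounded_compact_distributions U (fun=> localize chi u).
Proof.
move=> du tc B /(bounded_smoothP _ oU)[sB bB].
have [_ pE] := localize_compact du tc.
have [_ hb] := (is_distributionP u oU).1 du.
have [smc cK KU] := tc; have [C [k [C0 hC]]] := hb _ cK KU.
have [A hA] := test_jet_le k tc.
have [M hM] := bB _ k cK KU.
exists (C * (2 ^+ k * (A * `|M|))) => _ phi Bphi; rewrite pE; last exact: sB.
have t : test U (fun x => chi x * phi x) by apply: testM => //; exact: sB.
apply: hC => //; first by move=> x /fsupportM[].
move=> x; have [Kx|nKx] := pselect (fsupport chi x).
  have jp := jet_leW (leqnn k) (ler_norm M) (hM phi x Bphi Kx).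
  exact: (jet_leM oU (KU x Kx) (smooth_sub (@subsetT _ _) smc) (sB _ Bphi) (hA x) jp).
move=> s _; rewrite cpartials_out ?normc0; last by move=> /fsupportM[].
by rewrite !mulr_ge0 ?exprn_ge0 ?(jet_le_ge0 (hA 0)).
Qed.

(** The conjugate of the operator by a character: each derivation either falls on
    the character and multiplies by a frequency, or on the amplitude. *)
Lemma pdo_character u (c : R[i]) (m : nat) (a : multi_index d m -> R[i]) psi xi :
  linear_on U u -> test U psi ->
  pdo c a u (fun x => character xi x * psi x) =
    \sum_alpha tcoef c a alpha * \sum_(p <- splits (dirs alpha))
      zpow xi p.1 * u (fun x => character xi x * cpartials p.2 psi x).
Proof.
move=> lin t; rewrite pdoE; apply: eq_bigr => alpha _; congr (_ * _).
rewrite -(distr_sum lin); last first.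
  move=> p; rewrite (_ : (fun _ => _) = fun x => cpartials p.2 psi x * character xi x).
    by apply: testM; [|exact: test_cpartials|exact: smooth_character].
  by apply: funext => x; rewrite mulrC.
congr u; apply: funext => x.
rewrite (cpartialsM _ openT (@smooth_character R d setT xi) (test_smooth t)) //.
by apply: eq_bigr => p _; rewrite cpartials_character mulrA.
Qed.

(** Isolates the term in which every derivation falls on the first factor. *)
Lemma splits_nil (s : seq 'I_d) (F : seq 'I_d * seq 'I_d -> R[i]) :
  \sum_(p <- splits s) F p = F (s, [::]) + \sum_(p <- splits s | p.2 != [::]) F p.
Proof.
elim: s F => [|j s IH] F; first by rewrite big_seq1 big_cons big_nil /= addr0.
by rewrite /= !big_cat !big_map /= IH /= -!addrA.
Qed.

End Localization.

(** Downward induction on the order of derivation: each step costs a constant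
    factor, whence a geometric one in the number of steps. *)
Lemma recursion_bound (R : realType) (T : Type) (Y : seq T -> R) (c0 C2 E : R) (l m : nat) :
  0 < c0 -> 0 <= C2 -> 0 <= E ->
  (forall t, (l <= size t <= l + m)%N -> Y t <= E) ->
  (forall t Z, (size t < l)%N -> 0 <= Z ->
    (forall b, (0 < size b <= m)%N -> Y (b ++ t) <= Z) -> c0 * Y t <= E + C2 * Z) ->
  Y [::] <= (1 + (1 + C2) / c0) ^+ (l + m) * E.
Proof.
move=> c00 C20 E0 H1 H2.
set K := 1 + (1 + C2) / c0.
have K1 : 1 <= K by rewrite lerDl divr_ge0 ?addr_ge0 // ltW.
have K0 : 0 <= K by apply: le_trans K1.
suff H n t : (size t <= l + m)%N -> (l + m - size t <= n)%N -> Y t <= K ^+ n * E.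
  by apply: H => //; rewrite subn0.
elim: n t => [|n IH] t tl tn.
  rewrite expr0 mul1r; apply: H1; rewrite tl andbT; apply: leq_trans (leq_addr m _) _.
  by move: tn; rewrite leqn0 subn_eq0.
have [lt|ge] := ltnP (size t) l; last first.
  apply: le_trans (H1 t _) _; first by rewrite ge tl.
  by rewrite ler_peMl // exprn_ege1.
have := H2 t (K ^+ n * E) lt (mulr_ge0 (exprn_ge0 _ K0) E0).
have Hb (b : seq T) : (0 < size b <= m)%N -> Y (b ++ t) <= K ^+ n * E.
  by move=> /andP[b0 bm]; apply: IH; rewrite size_cat; lia.
move=> /(_ Hb); rewrite mulrC -ler_pdivlMr // => /le_trans; apply.
rewrite ler_pdivrMr // exprS -mulrA mulrAC.
have KE : E <= K ^+ n * E by rewrite ler_peMl // exprn_ege1.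
have Kc : 1 + C2 <= K * c0.
  by rewrite /K mulrDl mul1r divfK ?gt_eqF // lerDr ltW.
apply: (@le_trans _ _ ((1 + C2) * (K ^+ n * E))); first by rewrite mulrDl mul1r lerD2r.
by apply: ler_wpM2r => //; exact: le_trans KE.
Qed.

Section EllipticSymbol.
Variables (R : realType) (d : nat) (c : R[i]) (m : nat) (a : multi_index d m -> R[i]).
Notation vec := 'rV[R]_d.
Implicit Types (x xi eta : vec) (alpha : multi_index d m).

(** The factor relating [zeta] to the plain frequency coordinates. *)
Definition omega : R[i] := 0 -i* (2 * pi).

Lemma zpow_dirs xi alpha : zpow xi (dirs alpha) =
  omega ^+ mdeg alpha * \prod_(j < d) (xi ord0 j)%:C ^+ alpha j.
Proof.
have zE j : zeta xi j = omega * (xi ord0 j)%:C.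
  by rewrite /zeta /omega; apply/eqP; rewrite eq_complex /=; apply/andP; split; apply/eqP; ring.
rewrite /zpow (eq_bigr _ (fun j _ => zE j)) big_split /= big_const_seq count_predT size_dirs.
rewrite -[in RHS](iter_mulr_1); congr (_ * _).
rewrite /dirs /mlist big_flatten big_map big_enum /=; apply: eq_bigr => j _.
by rewrite big_nseq iter_mulr_1.
Qed.

Lemma principal_symbolZ (t : R) xi :
  principal_symbol a (t *: xi) = t%:C ^+ m * principal_symbol a xi.
Proof.
rewrite /principal_symbol mulr_sumr; apply: eq_bigr => alpha /eqP am.
rewrite [RHS]mulrCA; congr (_ * _).
have -> : t%:C ^+ m = \prod_(j < d) t%:C ^+ alpha j by rewrite -[in LHS]am expr_sum.
rewrite -big_split.
by apply: eq_bigr => j _; rewrite mxE rmorphM exprMn.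
Qed.

Lemma ccontinuous_principal_symbol xi : ccontinuous (principal_symbol a) xi.
Proof.
have cX (j : 'I_d) (n : nat) : ccontinuous (fun eta : vec => (eta ord0 j)%:C ^+ n) xi.
  elim: n => [|n IH]; first exact: ccontinuous_cst.
  rewrite (_ : (fun _ => _) = fun eta : vec => (eta ord0 j)%:C * (eta ord0 j)%:C ^+ n).
    apply: ccontinuousM => //; split; last exact: cst_continuous.
    exact: coord_continuous.
  by apply: funext => eta; rewrite exprS.
have cprod (r : seq 'I_d) alpha :
    ccontinuous (fun eta : vec => \prod_(j <- r) (eta ord0 j)%:C ^+ alpha j) xi.
  elim: r => [|j r IH].
    rewrite (_ : (fun _ => _) = fun=> 1); first exact: ccontinuous_cst.
    by apply: funext => eta; rewrite big_nil.
  rewrite (_ : (fun _ => _) = fun eta : vec => (eta ord0 j)%:C ^+ alpha j *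
      \prod_(k <- r) (eta ord0 k)%:C ^+ alpha k); first exact: ccontinuousM.
  by apply: funext => eta; rewrite big_cons.
rewrite (_ : principal_symbol a = fun eta => \sum_alpha
    (if mdeg alpha == m then a alpha else 0) * \prod_(j < d) (eta ord0 j)%:C ^+ alpha j).
  apply: ccontinuous_sum => alpha; apply: ccontinuousM; first exact: ccontinuous_cst.
  exact: cprod.
apply: funext => eta; rewrite /principal_symbol big_mkcond; apply: eq_bigr => alpha _.
by case: ifP; rewrite ?mul0r.
Qed.

(** By continuity the principal symbol is bounded below near [xi0], by homogeneity
    in the cone over that neighbourhood, and far out the terms of lower order do
    not matter. *)
Lemma symbol_elliptic xi0 : c != 0 -> principal_symbol a xi0 != 0 ->
  exists delta c0 R0 : R, [/\ 0 < delta, 0 < c0, 1 <= R0 &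
    forall xi (t : R), 0 < t -> `|t *: xi - xi0| < delta -> R0 <= `|xi| ->
      c0 * `|xi| ^+ m <= normc (symbol c a xi)].
Proof.
move=> cn0 Pn0.
pose kp := normc (principal_symbol a xi0) / 4.
have kp0 : 0 < kp.
  by rewrite /kp divr_gt0 // lt_def normc_ge0 andbT normc_eq0.
have [c1 c2] := ccontinuous_principal_symbol xi0.
have /cvgrPdist_lt/(_ _ kp0)/nbhs_ballP[d1 /= d10 h1] := c1.
have /cvgrPdist_lt/(_ _ kp0)/nbhs_ballP[d2 /= d20 h2] := c2.
pose delta := Num.min d1 d2.
have delta0 : 0 < delta by rewrite lt_min d10.
have low eta : `|eta - xi0| < delta -> kp <= normc (principal_symbol a eta).
  rewrite /delta lt_min => /andP[e1 e2].
  have r1 := h1 eta; have r2 := h2 eta.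
  rewrite -ball_normE /= distrC in r1; rewrite -ball_normE /= distrC in r2.
  have {}r1 := r1 e1; have {}r2 := r2 e2.
  have tri : normc (principal_symbol a xi0 - principal_symbol a eta) <= kp + kp.
    apply: le_trans (normc_le_ReIm _) _; apply: lerD; apply: ltW.
      by move: r1; rewrite /repart; case: (principal_symbol a xi0); case: (principal_symbol a eta).
    by move: r2; rewrite /impart; case: (principal_symbol a xi0); case: (principal_symbol a eta).
  have := normcD (principal_symbol a xi0 - principal_symbol a eta) (principal_symbol a eta).
  rewrite subrK => h; have e4 : normc (principal_symbol a xi0) = kp * 4 by rewrite /kp divfK.
  move: h; rewrite e4; lra.
have om0 : omega != 0.
  by rewrite -normc_eq0 /omega /= expr0n add0r sqrrN sqrtr_sqr normr_eq0 gt_eqF // mulr_gt0 // pi_gt0.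
pose w := normc (c * -1 * omega).
have w0 : 0 < w.
  by rewrite /w lt_def normc_ge0 andbT normc_eq0 !mulf_neq0 // oppr_eq0 oner_eq0.
pose D := `|xi0| + delta; have D0 : 0 < D by rewrite ltr_wpDl.
pose c3 := w ^+ m * kp / D ^+ m.
have c30 : 0 < c3 by apply: divr_gt0; [apply: mulr_gt0 => //|]; exact: exprn_gt0.
pose S := (\sum_alpha normc (tcoef c a alpha)) * (2 * pi) ^+ m : R.
have p1 : 1 <= 2 * pi :> R by have := @pi_ge2 R; lra.
have p0 : 0 <= 2 * pi :> R by apply: le_trans p1.
have S0 : 0 <= S.
  by rewrite mulr_ge0 ?exprn_ge0 // sumr_ge0 // => i _; exact: normc_ge0.
pose R0 := 1 + S * 2 / c3.
have R01 : 1 <= R0 by rewrite lerDl; apply: divr_ge0; [exact: mulr_ge0|exact: ltW].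
exists delta, (c3 / 2), R0; split=> //; first exact: divr_gt0.
move=> xi t t0 near xR.
have x1 : 1 <= `|xi| by apply: le_trans xR.
have x0 : 0 < `|xi| by apply: lt_le_trans x1.
pose top := \sum_(alpha | mdeg alpha == m) tcoef c a alpha * zpow xi (dirs alpha).
pose rest := \sum_(alpha | mdeg alpha != m) tcoef c a alpha * zpow xi (dirs alpha).
have symE : symbol c a xi = top + rest by rewrite /symbol (bigID (fun alpha => mdeg alpha == m)).
have topE : top = (c * -1 * omega) ^+ m * principal_symbol a xi.
  rewrite /top /principal_symbol mulr_sumr; apply: eq_bigr => alpha /eqP am.
  by rewrite /tcoef zpow_dirs am leqnn !exprMn; ring.
have top_low : c3 * `|xi| ^+ m <= normc top.
  rewrite topE normcM normcX -/w.
  have := low _ near; rewrite principal_symbolZ normcM normcX normc_real (gtr0_norm t0) => l1.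
  have tx : t * `|xi| <= D.
    rewrite -(gtr0_norm t0) -normrZ -[t *: xi](subrK xi0) addrC.
    by apply: le_trans (ler_normD _ _) _; rewrite lerD2l ltW.
  have tx0 : 0 < t ^+ m by rewrite exprn_gt0.
  have -> : c3 * `|xi| ^+ m = w ^+ m * (kp * (D ^- m * `|xi| ^+ m)).
    by rewrite /c3; move: (kp) => q; ring.
  rewrite ler_wpM2l ?exprn_ge0 ?(ltW w0) //.
  rewrite -(ler_pM2l tx0); apply: le_trans l1.
  have -> : t ^+ m * (kp * (D ^- m * `|xi| ^+ m)) = kp * ((t * `|xi|) ^+ m / D ^+ m).
    by move: (kp) => q; rewrite exprMn; ring.
  rewrite ler_piMr ?(ltW kp0) // ler_pdivrMr ?exprn_gt0 // mul1r.
  by apply: lerXn2r; rewrite ?nnegrE ?(ltW D0) // mulr_ge0 // ltW.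
have rest_up : normc rest * `|xi| <= S * `|xi| ^+ m.
  apply: le_trans (ler_wpM2r (ltW x0) (normc_sum _ _ _)) _.
  rewrite /S mulr_suml -mulrA mulr_suml big_mkcond; apply: ler_sum => alpha _.
  have r0 : 0 <= normc (tcoef c a alpha) * ((2 * pi) ^+ m * `|xi| ^+ m).
    by rewrite !mulr_ge0 ?normc_ge0 ?exprn_ge0.
  case: ifP => // am; rewrite normcM -mulrA /tcoef; case: ifP => am'; last first.
    by rewrite normc0 !mul0r.
  rewrite ler_wpM2l ?normc_ge0 //.
  apply: le_trans (ler_wpM2r (ltW x0) (normc_zpow _ _)) _; rewrite size_dirs exprMn -mulrA.
  have xn0 : 0 <= `|xi| ^+ mdeg alpha * `|xi|.
    by apply: mulr_ge0 (ltW x0); apply: exprn_ge0; exact: ltW.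
  apply: (ler_pM (exprn_ge0 _ p0) xn0); first exact: ler_weXn2l.
  by rewrite -exprSr ler_weXn2l // ltn_neqAle am.
have rest_half : normc rest <= c3 / 2 * `|xi| ^+ m.
  rewrite -(ler_pM2r x0); apply: le_trans rest_up _.
  have h : S <= c3 / 2 * `|xi|.
    have : S * 2 / c3 <= `|xi| by apply: le_trans xR; rewrite lerDr.
    by rewrite ler_pdivrMr //; lra.
  apply: le_trans (ler_wpM2r (exprn_ge0 m (ltW x0)) h) _.
  by rewrite le_eqVlt; apply/orP; left; apply/eqP; ring.
have := normcD (symbol c a xi) (- rest); rewrite {1}symE addrK (normcN rest) => tri.
have : c3 * `|xi| ^+ m = c3 / 2 * `|xi| ^+ m + c3 / 2 * `|xi| ^+ m by rewrite -mulrDl -splitr.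
lra.
Qed.

End EllipticSymbol.

Section EllipticRegularity.
Variables (R : realType) (d : nat) (U : set 'rV[R]_d) (tau sigma : R).
Variables (c : R[i]) (m : nat) (a : multi_index d m -> R[i]).
Hypotheses (oU : open U) (tau0 : 0 <= tau) (sigma1 : 1 < sigma).
Notation vec := 'rV[R]_d.
Notation cfun := (vec -> R[i]).
Implicit Types (x xi : vec) (phi psi chi : cfun) (u v : cfun -> R[i]) (t : seq 'I_d).

(** The Fourier transform of [psi u] at [xi]. *)
Definition amplitude u psi xi : R[i] := u (fun x => character xi x * psi x).

Lemma test_amplitude psi xi : test U psi -> test U (fun x => character xi x * psi x).
Proof.
move=> tp; rewrite (_ : (fun _ => _) = fun x => psi x * character xi x).
  by apply: testM => //; exact: smooth_character.
by apply: funext => x; rewrite mulrC.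
Qed.

(** The constants depend on the support of [chi] only, so that the bounds on the
    derivatives of [chi] enter linearly and with their explicit dependence on the
    order. *)
Lemma amplitude_base u chi : is_distribution U u -> test U chi ->
  exists (C : R) (k : nat), 0 <= C /\ forall t xi B,
    (forall x, jet_le (k + size t) B chi x) ->
    normc (amplitude u (cpartials t chi) xi) <= C * B * (1 + 2 * pi * `|xi|) ^+ k.
Proof.
move=> du tc; have [_ hb] := (is_distributionP u oU).1 du.
have [smc cK KU] := tc; have [C [k [C0 hC]]] := hb _ cK KU.
exists (C * 2 ^+ k), k; split; first by rewrite mulr_ge0 // exprn_ge0.
move=> t xi B jB.
have jets x : jet_le k (2 ^+ k * ((1 + 2 * pi * `|xi|) ^+ k * B))
    (fun x => character xi x * cpartials t chi x) x.
  apply: (jet_leM openT I (@smooth_character R d setT xi) (smooth_cpartials t smc)).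
    exact: jet_le_character.
  exact: jet_le_cpartials.
have sup : fsupport (fun x => character xi x * cpartials t chi x) `<=` fsupport chi.
  by move=> x /fsupportM[_ /fsupport_cpartials].
apply: le_trans (hC _ _ (test_amplitude xi (test_cpartials t tc)) sup jets) _.
by rewrite le_eqVlt; apply/orP; left; apply/eqP; ring.
Qed.

(** At most [2 ^ m] splittings per multi-index, each with at most [m] frequency
    factors. *)
Definition step_const : R := \sum_alpha normc (tcoef c a alpha) * ((2 * pi) ^+ m * 2 ^+ m).

Lemma step_const_ge0 : 0 <= step_const.
Proof.
apply: sumr_ge0 => alpha _; apply: mulr_ge0; first exact: normc_ge0.
by apply: mulr_ge0; apply: exprn_ge0 => //; rewrite mulr_ge0 // pi_ge0.
Qed.

(** The conjugated equation is solved for the term in which all derivations fall on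
    the character.  A derivation that falls on the amplitude instead costs a power
    of the frequency, which the quotient by [`|xi| ^+ size t] restores. *)
Lemma amplitude_step u chi xi (c0 : R) t (Z : R) : linear_on U u -> test U chi ->
  1 <= `|xi| -> c0 * `|xi| ^+ m <= normc (symbol c a xi) -> 0 <= Z ->
  (forall b, (0 < size b <= m)%N ->
     normc (amplitude u (cpartials (b ++ t) chi) xi) / `|xi| ^+ size (b ++ t) <= Z) ->
  c0 * (normc (amplitude u (cpartials t chi) xi) / `|xi| ^+ size t) <=
    normc (amplitude (pdo c a u) (cpartials t chi) xi) + step_const * Z.
Proof.
move=> lin tc x1 ell Z0 hZ.
have x0 : 0 < `|xi| by apply: lt_le_trans x1.
have p1 : 1 <= 2 * pi :> R by have := @pi_ge2 R; lra.
have p0 : 0 <= 2 * pi :> R by apply: le_trans p1.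
set F := amplitude u (cpartials t chi) xi; set G := amplitude (pdo c a u) _ xi.
pose rest := \sum_alpha tcoef c a alpha * \sum_(p <- splits (dirs alpha) | p.2 != [::])
  zpow xi p.1 * amplitude u (cpartials p.2 (cpartials t chi)) xi.
have GE : G = symbol c a xi * F + rest.
  rewrite /G /amplitude (pdo_character oU c a xi lin (test_cpartials t tc)).
  rewrite /symbol mulr_suml /rest -big_split; apply: eq_bigr => alpha _.
  by rewrite splits_nil mulrDr mulrA.
set X := `|xi| ^+ (m + size t).
have X0 : 0 < X by rewrite exprn_gt0.
have rest_le : normc rest <= step_const * Z * X.
  apply: le_trans (normc_sum _ _ _) _; rewrite /step_const !mulr_suml.
  apply: ler_sum => alpha _; rewrite normcM /tcoef; case: ifP => am; last first.
    by rewrite normc0 !mul0r.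
  rewrite -!mulrA ler_wpM2l ?normc_ge0 //; apply: le_trans (normc_sum _ _ _) _.
  apply: (@le_trans _ _ (\sum_(p <- splits (dirs alpha)) (2 * pi) ^+ m * (Z * X))).
    rewrite big_mkcond big_seq [X in _ <= X]big_seq; apply: ler_sum => p ps.
    have b0 : 0 <= (2 * pi) ^+ m * (Z * X).
      by apply: mulr_ge0; [exact: exprn_ge0|apply: mulr_ge0 => //; exact: ltW].
    case: ifP => // p2; rewrite normcM.
    have sz := splits_size ps; rewrite size_dirs in sz.
    have h := hZ p.2; rewrite size_cat ler_pdivrMr ?exprn_gt0 // in h.
    have szp : (0 < size p.2 <= m)%N.
      by rewrite lt0n size_eq0 p2 /=; apply: leq_trans am; rewrite -sz leq_addl.
    rewrite -cpartials_cat.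
    apply: (@le_trans _ _ ((2 * pi * `|xi|) ^+ size p.1 * (Z * `|xi| ^+ (size p.2 + size t)))).
      by apply: ler_pM; rewrite ?normc_ge0 ?normc_zpow ?h.
    rewrite exprMn -mulrA; apply: ler_pM; rewrite ?exprn_ge0 //.
    - by apply: mulr_ge0; [exact: exprn_ge0|apply: mulr_ge0 => //; exact: exprn_ge0].
    - by apply: ler_weXn2l => //; apply: leq_trans am; rewrite -sz leq_addr.
    rewrite mulrCA ler_wpM2l // -exprD addnA sz; apply: ler_weXn2l => //.
    by rewrite leq_add2r.
  rewrite big_const_seq count_predT size_splits size_dirs iter_addr_0.
  rewrite -[_ *+ (2 ^ _)]mulr_natl natrX mulrCA ler_wpM2l ?exprn_ge0 //.
  rewrite ler_wpM2r ?mulr_ge0 ?(ltW X0) //; apply: ler_weXn2l => //; rewrite ler1n //.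
have key : c0 * `|xi| ^+ m * normc F <= normc G + step_const * Z * X.
  apply: le_trans (ler_wpM2r (normc_ge0 F) ell) _.
  rewrite -normcM (_ : symbol c a xi * F = G - rest); last by rewrite GE addrK.
  by apply: le_trans (normcB _ _) _; rewrite lerD2l.
rewrite -(ler_pM2r X0).
have -> : c0 * (normc F / `|xi| ^+ size t) * X = c0 * `|xi| ^+ m * normc F.
  rewrite /X exprD -[RHS]mulr1 -(@divff _ (`|xi| ^+ size t)) ?expf_neq0 ?gt_eqF //; ring.
apply: le_trans key _; rewrite mulrDl lerD2r ler_peMr ?normc_ge0 //.
exact: exprn_ege1.
Qed.

(** The open cone generated by the ball of radius [delta] around [xi0]. *)
Definition subcone (xi0 : vec) (delta : R) : set vec :=
  [set xi | exists2 t : R, 0 < t & `|t *: xi - xi0| < delta].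

Lemma open_subcone xi0 delta : open (subcone xi0 delta).
Proof.
have -> : subcone xi0 delta =
    \bigcup_(t in [set t : R | 0 < t]) [set xi | `|t *: xi - xi0| < delta].
  by apply/seteqP; split=> xi [t t0 h]; exists t.
apply: bigcup_open => t _.
have -> : [set xi : vec | `|t *: xi - xi0| < delta] =
    (fun xi => `|t *: xi - xi0|) @^-1` [set s | s < delta] by [].
apply: open_comp; last exact: open_lt.
move=> y _; apply: (@continuous_comp _ _ _ (fun y : vec => t *: y - xi0) (@Num.norm R vec)).
  by apply: continuousB; [exact: scaler_continuous|exact: cst_continuous].
exact: norm_continuous.
Qed.

Lemma cone_subcone xi0 delta : cone (subcone xi0 delta).
Proof.
move=> s xi s0 [t t0 h]; exists (t / s); first exact: divr_gt0.
by rewrite scalerA divfK ?gt_eqF.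
Qed.

(** By homogeneity only the relative size of a shift matters. *)
Lemma subcone_shift (G : set vec) xi0 : open G -> cone G -> G xi0 ->
  exists delta e0 : R, [/\ 0 < delta, 0 < e0, e0 <= 1 / 2 &
    forall xi eta, subcone xi0 delta xi -> `|eta| <= e0 * `|xi| -> G (xi - eta)].
Proof.
move=> oG cG G0; have /nbhs_ballP[r /= r0 rG] := open_nbhs_nbhs (conj oG G0).
pose delta := r / 2; have delta0 : 0 < delta by apply: divr_gt0.
pose D := `|xi0| + delta; have D0 : 0 < D by rewrite ltr_wpDl.
pose e0 := Num.min (1 / 2) (delta / D).
exists delta, e0; split=> //.
- by rewrite lt_min divr_gt0 //= divr_gt0.
- by rewrite ge_min lexx.
move=> xi eta [t t0 near] he.
have -> : xi - eta = t^-1 *: (t *: (xi - eta)) by rewrite scalerA mulVf ?gt_eqF // scale1r.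
apply: cG; first by rewrite invr_gt0.
apply: rG; rewrite -ball_normE /= distrC.
have -> : t *: (xi - eta) - xi0 = (t *: xi - xi0) - t *: eta by rewrite scalerBr addrAC.
apply: le_lt_trans (ler_normB _ _) _; rewrite [r]splitr -/delta.
apply: ltr_leD => //; rewrite normrZ (gtr0_norm t0).
have tx : t * `|xi| <= D.
  rewrite -(gtr0_norm t0) -normrZ -[t *: xi](subrK xi0) addrC.
  by apply: le_trans (ler_normD _ _) _; rewrite lerD2l ltW.
apply: le_trans (ler_wpM2l (ltW t0) he) _; rewrite mulrCA.
apply: (@le_trans _ _ (delta / D * (t * `|xi|))).
  by apply: ler_wpM2r; [rewrite mulr_ge0 // ltW|rewrite ge_min lexx orbT].
apply: le_trans (ler_wpM2l _ tx) _; first by rewrite divr_ge0 // ltW.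
by rewrite divfK ?gt_eqF.
Qed.

(** Derivatives of [chi] of order at least [l] satisfy the estimate by the growth
    of [u] alone; those of lower order do by the equation, at the price of a
    constant factor for each order below [l + m]. *)
Lemma amplitude_bound u chi xi (c0 E : R) (l : nat) : linear_on U u -> test U chi ->
  1 <= `|xi| -> 0 < c0 -> c0 * `|xi| ^+ m <= normc (symbol c a xi) -> 0 <= E ->
  (forall t, (l <= size t <= l + m)%N ->
     normc (amplitude u (cpartials t chi) xi) / `|xi| ^+ size t <= E) ->
  (forall t, (size t < l)%N -> normc (amplitude (pdo c a u) (cpartials t chi) xi) <= E) ->
  normc (amplitude u chi xi) <= (1 + (1 + step_const) / c0) ^+ (l + m) * E.
Proof.
move=> lin tc x1 c00 ell E0 H1 H2.
have := @recursion_bound R 'I_d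
  (fun t => normc (amplitude u (cpartials t chi) xi) / `|xi| ^+ size t) c0 step_const E l m
  c00 step_const_ge0 E0 H1.
rewrite /= expr0 divr1; apply=> t Z tl Z0 hZ.
apply: le_trans (amplitude_step lin tc x1 ell Z0 hZ) _.
by rewrite lerD2r; exact: H2.
Qed.

End EllipticRegularity.

Section WaveFront.
Variables (R : realType) (d : nat) (U : set 'rV[R]_d) (tau sigma : R).
Variables (c : R[i]) (m : nat) (a : multi_index d m -> R[i]).
Hypotheses (oU : open U) (tau0 : 0 <= tau) (sigma1 : 1 < sigma).
Notation vec := 'rV[R]_d.
Notation cfun := (vec -> R[i]).
Implicit Types (x xi : vec) (phi psi chi : cfun) (u v : cfun -> R[i]) (t : seq 'I_d).

Lemma weight_ge1 N : 1 <= N`!%:R `^ (tau / sigma).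
Proof.
have e : 1 `^ (tau / sigma) = 1 :> R by rewrite powR1.
rewrite -[X in X <= _]e.
have rho0 : 0 <= tau / sigma.
  by apply: divr_ge0 => //; apply: ltW; exact: lt_trans sigma1.
apply: ge0_ler_powR; rewrite ?nnegrE //.
by rewrite ler1n fact_gt0.
Qed.

(** The recursion starts at the order [l := p + ku], where [ku] is the order of
    [u] on the support of the cut-off: [ku] powers of the frequency are lost to the
    growth of [u], and [p] remain.  The derivatives of the cut-off that occur have
    order at most [2 p] up to a constant, [p] for the recursion and [p] for the
    decay of the transforms of the derivatives. *)
Lemma WF_regular_elliptic u x0 xi0 : is_distribution U u -> c != 0 -> principal_symbol a xi0 != 0 ->
  WF_regular tau sigma U (pdo c a u) x0 xi0 -> WF_regular tau sigma U u x0 xi0.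
Proof.
move=> du cn0 pn0 [V [G [f_ [[oV VU Vx0] [oG cG Gxi0] [cf bf] ef [A [h [A0 h0 hf]]]]]]].
have [lin _] := du.
have idx_low (q k k' s : nat) : (s <= q + k + m)%N ->
    (k + s <= 2 * q + (2 * k + m + k' + 2 * d))%N by clear; lia.
have idx_reg (q k k' s : nat) : (s < q + k)%N ->
    (q + k' + 2 * d + s <= 2 * q + (2 * k + m + k' + 2 * d))%N by clear; lia.
(* rho is large enough for all supports to lie in the ball, and for the cut-off
   around x0 to fit in it *)
have [rho1 hrho1] := bounded_common_support oU cf bf.
pose rho := `|rho1| + `|x0| + 1; have rho0 : 0 <= rho by rewrite !addr_ge0.
have sv N phi : test U phi -> (forall x, `|x| <= rho -> phi x = 0) -> f_ N phi = 0.
  move=> tp z; apply: hrho1 => // x xr; apply: z; apply: le_trans xr _.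
  apply: le_trans (ler_norm _) _; rewrite /rho -addrA lerDl addr_ge0 //.
have [k0 hk0] := bounded_fourier oU cf bf.
have /nbhs_ballP[rV /= rV0 rVs] := open_nbhs_nbhs (conj oV Vx0).
pose r := Num.min (1 / 4) (rV / 4).
have r0 : 0 < r by rewrite lt_min !divr_gt0.
have r14 : r <= 1 / 4 by rewrite ge_min lexx.
have rV4 : r <= rV / 4 by rewrite ge_min lexx orbT.
have [chi [smc cout c1 [C [b [C0 b1 hj]]]]] := cutoff_cube x0 r0.
have cubeV : [set y | `|y - x0| <= 2 * r] `<=` V.
  move=> y /= hy; apply: rVs; rewrite -ball_normE /= distrC; apply: le_lt_trans hy _.
  by lra.
have tcube := test_cube smc cout.
have tV : test V chi by exact: test_sub cubeV tcube.
have tU : test U chi by exact: test_sub VU tV.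
have nsup x : rho <= `|x| -> ~ fsupport chi x.
  move=> hx; have [_ _ sub] := tcube; move=> /sub /= hy.
  have := ler_normD (x - x0) x0; rewrite subrK => hx'.
  have n1 := normr_ge0 rho1; move: hx; rewrite /rho; clear -r14 hy hx' n1; lra.
pose B k : R := C * b ^+ k * k.*2`!%:R.
have b0 : 0 <= b by apply: le_trans b1.
have Bmono k k' : (k <= k')%N -> B k <= B k'.
  move=> kk; rewrite /B -!mulrA ler_wpM2l ?(ltW C0) //; apply: ler_pM; rewrite ?exprn_ge0 //.
    exact: ler_weXn2l.
  by rewrite ler_nat leq_fact // leq_double.
have B0 k : 0 <= B k by rewrite !mulr_ge0 ?exprn_ge0 // ltW.
have jetB k k' y : (k <= k')%N -> jet_le k (B k') chi y.
  by move=> kk; apply: jet_leW (hj k y) => //; exact: Bmono.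
have [d1 [c0 [R0 [d10 c00 R01 hell]]]] := symbol_elliptic cn0 pn0.
have [d2 [e0 [d20 e00 e0h hshift]]] := subcone_shift oG cG Gxi0.
have [Q0 [Q1 [Q00 Q10 hQ]]] := localized_fourier_bound oU rho0 k0 e00.
have [Cu [ku [Cu0 hCu]]] := amplitude_base oU du tU.
have [A3 [h3 [A30 h31 hgrow]]] := gevrey_growth 2 (2 * ku + m + k0 + 2 * d) sigma1 C0 b1.
have {hgrow} Bgrow N : B (2 * order_of sigma N + (2 * ku + m + k0 + 2 * d))%N <= A3 * h3 ^+ N.
  exact: hgrow.
clearbody B.
(* K is the factor per order of the recursion; M0 serves the frequencies below
   R0, and M1 and H those above *)
pose K := 1 + (1 + step_const c a) / c0.
have K1 : 1 <= K.
  by rewrite lerDl divr_ge0 ?(ltW c00) // addr_ge0 // step_const_ge0.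
have p0 : 0 <= 2 * pi :> R by rewrite mulr_ge0 // pi_ge0.
pose Cv := Cu * (1 + 2 * pi) ^+ ku.
have Cv0 : 0 <= Cv by rewrite mulr_ge0 // exprn_ge0 // addr_ge0.
pose hm := Num.max 1 h; pose Qm := Num.max 1 Q1; pose D : R := d.+1%:R.
have hm1 : 1 <= hm by rewrite le_max lexx.
have Qm1 : 1 <= Qm by rewrite le_max lexx.
have D1 : 1 <= D by rewrite /D ler1n.
pose H := K * (2 * hm * Qm) * h3.
pose M0 := Cu * B ku * (1 + 2 * pi * R0) ^+ ku.
pose M1 := K ^+ (ku + m) * (Cv + Q0 * (A + 1)) * A3.
have R00 : 0 < R0 by apply: lt_le_trans R01.
have M00 : 0 <= M0.
  apply: mulr_ge0; first exact: mulr_ge0.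
  by apply: exprn_ge0; apply: addr_ge0 => //; apply: mulr_ge0 => //; exact: ltW.
have M10 : 0 <= M1.
  apply: mulr_ge0 (ltW A30); apply: mulr_ge0; first by apply: exprn_ge0; apply: le_trans K1.
  by apply: addr_ge0 => //; apply: mulr_ge0; [exact: ltW|rewrite addr_ge0 // ltW].
have H21 : 1 <= 2 * hm * Qm by apply: mulr_ege1 => //; apply: mulr_ege1 => //; lra.
have H1 : 1 <= H by apply: mulr_ege1 => //; exact: mulr_ege1.
have high N xi : subcone xi0 (Num.min d1 d2) xi -> R0 <= `|xi| ->
    normc (amplitude u chi xi) <= M1 * (H ^+ N * N`!%:R `^ (tau / sigma)) / `|xi| ^+ order_of sigma N.
  move=> [t t0 ht] xR; have x1 : 1 <= `|xi| by apply: le_trans xR.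
  have x0' : 0 < `|xi| by apply: lt_le_trans x1.
  have xn0 : xi != 0 by rewrite -normr_gt0.
  have F1 := weight_ge1 N; have pN := order_of_le N sigma1; have Bn := Bgrow N.
  have hfN : forall eta, G eta -> eta != 0 -> normc (fourier U (f_ N) eta) <=
      A * (h ^+ N * N`!%:R `^ (tau / sigma) / enorm eta ^+ order_of sigma N) := hf N.
  move: (order_of sigma N) (N`!%:R `^ _) F1 pN Bn hfN => p F F1 pN Bn hfN.
  have F0 : 0 <= F by apply: le_trans F1.
  move: ht; rewrite lt_min => /andP[ht1 ht2].
  have ell := hell xi t t0 ht1 xR.
  have sub2 : subcone xi0 d2 xi by exists t.
  have low_n s : (s <= p + ku + m)%N -> (ku + s <= _)%N := idx_low p ku k0 s.
  have reg_n s : (s < p + ku)%N -> (p + k0 + 2 * d + s <= _)%N := idx_reg p ku k0 s.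
  move: (2 * p + (2 * ku + m + k0 + 2 * d))%N Bn low_n reg_n => n Bn low_n reg_n.
  pose X := (Cv + Q0 * (A * (h ^+ N * F) * 2 ^+ p + Q1 ^+ p)) * B n.
  have xp0 : 0 < `|xi| ^+ p by rewrite exprn_gt0.
  have T0 : 0 <= A * (h ^+ N * F) * 2 ^+ p.
    by rewrite !mulr_ge0 ?exprn_ge0 // ltW.
  have Qp0 : 0 <= Q1 ^+ p by rewrite exprn_ge0 // ltW.
  have QT0 : 0 <= Q0 * (A * (h ^+ N * F) * 2 ^+ p + Q1 ^+ p).
    by rewrite mulr_ge0 ?(ltW Q00) // addr_ge0.
  have X0 : 0 <= X by rewrite /X mulr_ge0 // addr_ge0.
  have low_order s : (p + ku <= size s <= p + ku + m)%N ->
      normc (amplitude u (cpartials s chi) xi) / `|xi| ^+ size s <= X / `|xi| ^+ p.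
    move=> /andP[s1 s2]; rewrite ler_pdivrMr ?exprn_gt0 //.
    apply: le_trans (hCu s xi (B n) _) _.
      by move=> y; apply: jetB; exact: low_n.
    have e1 : (1 + 2 * pi * `|xi|) ^+ ku <= (1 + 2 * pi) ^+ ku * `|xi| ^+ ku.
      rewrite -exprMn; apply: lerXn2r; rewrite ?nnegrE.
      - by apply: addr_ge0 => //; apply: mulr_ge0.
      - by apply: mulr_ge0 => //; apply: addr_ge0.
      have -> : (1 + 2 * pi) * `|xi| = `|xi| + 2 * pi * `|xi| by ring.
      by rewrite lerD2r.
    apply: le_trans (ler_wpM2l (mulr_ge0 Cu0 (B0 n)) e1) _.
    have e2 : `|xi| ^+ p * `|xi| ^+ ku <= `|xi| ^+ size s by rewrite -exprD ler_weXn2l.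
    rewrite [X in _ <= X]mulrAC ler_pdivlMr //.
    have -> : Cu * B n * ((1 + 2 * pi) ^+ ku * `|xi| ^+ ku) * `|xi| ^+ p =
        Cv * B n * (`|xi| ^+ p * `|xi| ^+ ku) by rewrite /Cv; ring.
    apply: ler_pM.
    - exact: mulr_ge0.
    - by apply: mulr_ge0; apply: exprn_ge0; exact: ltW.
    - by rewrite /X ler_wpM2r // lerDl.
    exact: e2.
  have regular s : (size s < p + ku)%N ->
      normc (amplitude (pdo c a u) (cpartials s chi) xi) <= X / `|xi| ^+ p.
    move=> sl; pose T := A * (h ^+ N * F) * 2 ^+ p / `|xi| ^+ p.
    have Tn : 0 <= T by rewrite divr_ge0 // ltW.
    have hT eta : `|eta| <= e0 * `|xi| -> normc (fourier U (f_ N) (xi - eta)) <= T.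
      move=> he; have Gs := hshift xi eta sub2 he.
      have half : `|xi| / 2 <= `|xi - eta|.
        have := lerB_dist xi eta; have : e0 * `|xi| <= 1 / 2 * `|xi| by rewrite ler_wpM2r.
        by lra.
      have half0 : 0 < `|xi| / 2 by rewrite divr_gt0.
      have xe0 : xi - eta != 0 by rewrite -normr_gt0; exact: lt_le_trans half.
      have e_half : `|xi| / 2 <= enorm (xi - eta) by apply: le_trans half (norm_le_enorm _).
      apply: le_trans (hfN _ Gs xe0) _.
      have -> : T = A * (h ^+ N * F / (`|xi| / 2) ^+ p).
        by rewrite /T exprMn exprVn invfM invrK; ring.
      rewrite ler_wpM2l ?(ltW A0) // ler_wpM2l ?mulr_ge0 ?exprn_ge0 ?(ltW h0) //.
      rewrite lef_pV2 ?posrE ?exprn_gt0 //; last exact: lt_le_trans half0 e_half.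
      by apply: lerXn2r; rewrite ?nnegrE ?(ltW half0) //; apply: le_trans e_half; exact: ltW.
    have tVs : test V (fun x => character xi x * cpartials s chi x).
      by apply: test_amplitude => //; exact: test_cpartials.
    have -> : amplitude (pdo c a u) (cpartials s chi) xi =
        f_ N (fun x => character xi x * cpartials s chi x) by rewrite ef.
    apply: le_trans (hQ (f_ N) (cpartials s chi) xi p T (B n) (cf N) (sv N) (hk0 N)
      (test_cpartials s tU) _ _ xn0 Tn hT) _.
    - by move=> x /nsup ns; apply: cpartials_out.
    - by move=> x; apply: jet_le_cpartials; apply: jetB; exact: reg_n.
    have -> : Q0 * B n * (T + Q1 ^+ p / `|xi| ^+ p) =
        Q0 * (A * (h ^+ N * F) * 2 ^+ p + Q1 ^+ p) * B n / `|xi| ^+ p by rewrite /T; ring.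
    by rewrite ler_wpM2r ?invr_ge0 ?(ltW xp0) // /X ler_wpM2r // lerDr.
  have E0 : 0 <= X / `|xi| ^+ p by rewrite divr_ge0 // ltW.
  apply: le_trans (amplitude_bound oU lin tU x1 c00 ell E0 low_order regular) _.
  rewrite -/K mulrA ler_wpM2r ?invr_ge0 ?(ltW xp0) //.
  have K0 : 0 <= K by apply: le_trans K1.
  have hm0 : 0 <= hm by apply: le_trans hm1.
  have Qm0 : 0 <= Qm by apply: le_trans Qm1.
  have n2 : 1 <= 2 ^+ N :> R by rewrite exprn_ege1 // ler1n.
  have nh : 1 <= hm ^+ N by rewrite exprn_ege1.
  have nQ : 1 <= Qm ^+ N by rewrite exprn_ege1.
  pose P := (2 * hm * Qm) ^+ N * F.
  have P1 : 1 <= P by apply: mulr_ege1 => //; exact: exprn_ege1.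
  have hN : h ^+ N <= hm ^+ N.
    by apply: lerXn2r; rewrite ?nnegrE ?(ltW h0) // le_max lexx orbT.
  have a1 : A * (h ^+ N * F) * 2 ^+ p <= A * P.
    rewrite -[X in X <= _]mulrA ler_wpM2l ?(ltW A0) //.
    have -> : P = hm ^+ N * F * (2 ^+ N * Qm ^+ N) by rewrite /P !exprMn; ring.
    apply: ler_pM; rewrite ?mulr_ge0 ?exprn_ge0 ?(ltW h0) //; first by rewrite ler_wpM2r.
    apply: (@le_trans _ _ (2 ^+ N)); first by rewrite ler_weXn2l // ler1n.
    by rewrite ler_peMr // exprn_ge0.
  have a2 : Q1 ^+ p <= P.
    apply: (@le_trans _ _ (Qm ^+ N)).
      apply: (@le_trans _ _ (Qm ^+ p)); last by rewrite ler_weXn2l.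
      by apply: lerXn2r; rewrite ?nnegrE ?(ltW Q10) // le_max lexx orbT.
    have -> : P = Qm ^+ N * (2 ^+ N * hm ^+ N * F) by rewrite /P !exprMn; ring.
    rewrite ler_peMr ?exprn_ge0 //; apply: mulr_ege1 => //; exact: mulr_ege1.
  have XP : X <= (Cv + Q0 * (A + 1)) * P * (A3 * h3 ^+ N).
    apply: ler_pM => //; first by rewrite addr_ge0.
    have -> : (Cv + Q0 * (A + 1)) * P = Cv * P + Q0 * (A * P + P) by ring.
    apply: lerD; first by rewrite ler_peMr.
    by rewrite ler_wpM2l ?(ltW Q00) //; exact: lerD.
  have Kp : K ^+ (p + ku + m) <= K ^+ (ku + m) * K ^+ N.
    by rewrite -exprD ler_weXn2l // -addnA addnC leq_add2l.
  apply: le_trans (ler_pM (exprn_ge0 _ K0) X0 Kp XP) _.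
  by rewrite le_eqVlt; apply/orP; left; apply/eqP; rewrite /M1 /H /P !exprMn; ring.
clearbody H M1.
pose W := localize chi u.
have [cW pW] := localize_compact oU du tU.
have fW xi : fourier U W xi = amplitude u chi xi.
  rewrite /fourier pW; last exact: smooth_character.
  by rewrite /localize /amplitude; congr u; apply: funext => x; rewrite mulrC.
exists (ball x0 r), (subcone xi0 (Num.min d1 d2)), (fun=> W); split.
- split; [exact: ball_open|move=> y hy|exact: ballxx].
  apply: VU; apply: cubeV; move: hy; rewrite -ball_normE /= distrC => /ltW hy.
  by apply: le_trans hy _; lra.
- split; [exact: open_subcone|exact: cone_subcone|].
  by exists 1 => //; rewrite scale1r subrr normr0 lt_min d10.
- by split=> //; exact: localize_bounded.
- move=> _ phi [_ _ sub]; rewrite /W /localize; congr u; apply: funext => x.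
  have [/eqP->|ne] := boolP (phi x == 0); first by rewrite mulr0.
  rewrite c1 ?mul1r //; have := sub _ (fsupport_incl ne).
  by rewrite -ball_normE /= distrC => /ltW.
exists (M0 + M1 + 1), (D * R0 * H); split.
- by rewrite ltr_wpDl // addr_ge0.
- by rewrite !mulr_gt0 // (lt_le_trans ltr01).
move=> N xi sx xn0; rewrite fW -/(order_of sigma N).
have := high N xi sx; have := order_of_le N sigma1; have := weight_ge1 N.
have := enorm_gt0 xn0; have : enorm xi <= D * `|xi| := enorm_le_norm xi.
move: (order_of sigma N) (N`!%:R `^ (tau / sigma)) (enorm xi) => p F e ex e0' F1 pN hxi.
have F0 : 0 <= F by apply: le_trans F1.
have D0 : 0 <= D by apply: le_trans D1.
have H0 : 0 <= H by apply: le_trans H1.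
clearbody D.
have main0 : 0 <= (D * R0 * H) ^+ N * F / e ^+ p.
  apply: divr_ge0; last by apply: exprn_ge0; exact: ltW.
  by apply: mulr_ge0 => //; apply: exprn_ge0; apply: mulr_ge0 => //; apply: mulr_ge0 => //; exact: ltW.
have [xR|xR] := lerP R0 `|xi|.
  apply: (@le_trans _ _ (M1 * ((D * R0 * H) ^+ N * F / e ^+ p))); last first.
    by apply: ler_wpM2r => //; rewrite addrAC lerDr addr_ge0.
  apply: le_trans (hxi xR) _; rewrite -mulrA ler_wpM2l //.
  have x0' : 0 < `|xi| by rewrite normr_gt0.
  rewrite ler_pdivrMr ?exprn_gt0 // mulrAC ler_pdivlMr ?exprn_gt0 //.
  have ep : e ^+ p <= D ^+ N * `|xi| ^+ p.
    apply: (@le_trans _ _ ((D * `|xi|) ^+ p)).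
      by apply: lerXn2r; rewrite ?nnegrE ?mulr_ge0 // ltW.
    by rewrite exprMn ler_wpM2r ?exprn_ge0 // ler_weXn2l.
  apply: le_trans (ler_wpM2l (mulr_ge0 (exprn_ge0 N H0) F0) ep) _.
  have -> : (D * R0 * H) ^+ N * F * `|xi| ^+ p = H ^+ N * F * (D ^+ N * `|xi| ^+ p) * R0 ^+ N.
    by rewrite !exprMn; ring.
  rewrite ler_peMr ?exprn_ege1 // mulr_ge0 //; first by rewrite mulr_ge0 ?exprn_ge0.
  by rewrite mulr_ge0 ?exprn_ge0.
apply: (@le_trans _ _ (M0 * 1)).
  rewrite mulr1; apply: le_trans (hCu [::] xi (B ku) _) _.
    by move=> y; apply: jetB; rewrite addn0.
  rewrite /M0 ler_wpM2l ?mulr_ge0 //; apply: lerXn2r; rewrite ?nnegrE.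
  - by apply: addr_ge0 => //; apply: mulr_ge0.
  - by apply: addr_ge0 => //; apply: mulr_ge0 => //; exact: ltW.
  by rewrite lerD2l ler_wpM2l // ltW.
apply: ler_pM => //; first by rewrite -addrA lerDl addr_ge0.
rewrite ler_pdivlMr ?exprn_gt0 // mul1r.
have DR1 : 1 <= D * R0 by exact: mulr_ege1.
have DR0 : 0 <= D * R0 by apply: le_trans DR1.
apply: (@le_trans _ _ ((D * R0) ^+ p)).
  apply: lerXn2r; rewrite ?nnegrE ?(ltW e0') //; apply: le_trans ex _.
  by rewrite ler_wpM2l // ltW.
apply: (@le_trans _ _ ((D * R0) ^+ N)); first exact: ler_weXn2l.
rewrite [in X in _ <= X]exprMn -mulrA ler_peMr ?exprn_ge0 //.
by apply: mulr_ege1 => //; exact: exprn_ege1.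
Qed.

End WaveFront.

(** The weights increase with [tau] because [N! >= 1]. *)
Lemma WF_regular_mono (R : realType) (d : nat) (U : set 'rV[R]_d) (tau tau' sigma : R) u x0 xi0 :
  0 < sigma -> tau <= tau' -> WF_regular tau sigma U u x0 xi0 -> WF_regular tau' sigma U u x0 xi0.
Proof.
move=> s0 tt [V [G [u_ [hV hG hu eu [A [h [A0 h0 hb]]]]]]].
exists V, G, u_; split=> //; exists A, h; split=> // N xi Gxi xn0.
apply: le_trans (hb N xi Gxi xn0) _.
rewrite ler_wpM2l ?(ltW A0) // ler_wpM2r ?invr_ge0 ?exprn_ge0 ?sqrtr_ge0 //.
rewrite ler_wpM2l ?exprn_ge0 ?(ltW h0) //; apply: ler_powR; first by rewrite ler1n fact_gt0.
by rewrite ler_wpM2r // invr_ge0 ltW.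
Qed.

Theorem theorem1p1 (R : realType) (d : nat) (U : set 'rV[R]_d)
    (tau sigma : R) (u : ('rV[R]_d -> R[i]) -> R[i])
    (c : R[i]) (m : nat) (a : multi_index d m -> R[i]) :
  open U -> 0 < tau -> 1 < sigma -> is_distribution U u -> c != 0 ->
  WF (2 `^ (sigma - 1) * tau) sigma U (pdo c a u)
    `<=` WF (2 `^ (sigma - 1) * tau) sigma U u /\
  WF (2 `^ (sigma - 1) * tau) sigma U u
    `<=` WF tau sigma U (pdo c a u) `|` U `*` Char a.
Proof.
move=> oU tau0 sigma1 du cn0; split=> -[x xi] [/= Ux xi0 nreg].
  split=> // reg; apply: nreg; apply: WF_regular_pdo => //.
  by rewrite mulr_ge0 ?powR_ge0 // ltW.
have [Pxi|Pxi] := eqVneq (principal_symbol a xi) 0; [right|left]; first by [].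
split=> // reg; apply: nreg; apply: (@WF_regular_mono _ _ _ tau).
- exact: lt_trans sigma1.
- rewrite ler_peMl ?(ltW tau0) // -[X in X <= _](powRr0 2) ler_powR ?ler1n //.
  by rewrite subr_ge0 ltW.
exact: (WF_regular_elliptic oU (ltW tau0) sigma1 du cn0 Pxi reg).
Qed.
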